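(* Let $\mathbb D$ be the open unit disk of $\mathbb C$. The Dirichlet space is, up to a positive multiplicative factor, the only reproducing kernel Hilbert space of functions analytic in $\mathbb D$ for which the equality $$\partial_{z}^2 k=\overline\omega^{\,2}\,\partial_z\partial_{\overline\omega}k$$ holds for its kernel $k=k(z,\omega)$, pointwise for $z,\omega\in\mathbb D$.
   Context: A reproducing kernel Hilbert space on a non-empty set $\Omega$ is a Hilbert space $\mathcal H$ of complex-valued functions on $\Omega$ for which there is a function $k:\Omega\times\Omega\to\mathbb C$ (the reproducing kernel, or kernel for short) such that $k_\omega: z\mapsto k(z,\omega)$ belongs to $\mathcal H$ and $\langle f,k_\omega\rangle=f(\omega)$ for all $f\in\mathcal H$, $\omega\in\Omega$. If the elements of $\mathcal H$ are analytic in an open set $\Omega\subset\mathbb C$, then $k(z,\omega)$ is jointly analytic in $z$ and $\overline\omega$; $\partial_z$ and $\partial_{\overline\omega}$ denote the derivatives with respect to $z$ and $\overline\omega$, and $\partial_z^2$ is the second derivative with respect to $z$. The Dirichlet space consists of the functions $f$ analytic in $\mathbb D$ which vanish at the origin and satisfy $\frac1\pi\iint_{\mathbb D}|f'(z)|^2\,dx\,dy<\infty$; its reproducing kernel is $-\ln(1-z\overline\omega)=\sum_{n=1}^\infty\frac{z^n\overline\omega^n}{n}$. The displayed equality is an equality between analytic functions, not an equality in the Dirichlet space.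
   Formalization: Uniqueness is claimed only among nonzero reproducing kernel Hilbert spaces whose functions all vanish at the origin; without this it fails, e.g. the constant functions with kernel k = 1 satisfy the equality (both sides are 0). *)

(* Defs.v *)
From HB Require Import structures.
From mathcomp Require Import all_boot all_order all_algebra.
From mathcomp Require Import complex.
From mathcomp Require Import all_classical all_reals all_analysis.

Set Implicit Arguments.
Unset Strict Implicit.
Unset Printing Implicit Defensive.

Import Order.TTheory GRing.Theory Num.Theory.
Import numFieldNormedType.Exports.

Local Open Scope ring_scope.
Local Open Scope classical_set_scope.

(* R[i] packed as a numClosedFieldType, so that it carries the topology of its
   norm and [derive1] over it is the complex derivative. *)
Definition Cplx (R : realType) : numClosedFieldType := R[i].

Definition hnorm (R : realType) (T : Type)
    (ip : (T -> Cplx R) -> (T -> Cplx R) -> Cplx R) (f : T -> Cplx R) : R :=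
  Num.sqrt (complex.Re (ip f f)).

(* Functions on Omega are represented by total functions that are 0 outside
   Omega, so that equality of functions on Omega is Leibniz equality.
   The form ip is meaningful only on H, and k only on T * Omega. *)
Record is_rkhs (R : realType) (T : Type) (Omega : set T)
    (H : set (T -> Cplx R))
    (ip : (T -> Cplx R) -> (T -> Cplx R) -> Cplx R)
    (k : T -> T -> Cplx R) : Prop := IsRKHS {
  rkhs_nonempty : Omega !=set0 ;
  rkhs_off : forall f, H f -> forall z, ~ Omega z -> f z = 0 ;
  rkhs_zero : H (fun=> 0) ;
  rkhs_lin : forall (a : Cplx R) f g, H f -> H g ->
    H (fun z => a * f z + g z) ;
  rkhs_ip_lin : forall (a : Cplx R) f g h, H f -> H g -> H h ->
    ip (fun z => a * f z + g z) h = a * ip f h + ip g h ;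
  rkhs_ip_conj : forall f g, H f -> H g -> ip g f = (ip f g)^* ;
  rkhs_ip_ge0 : forall f, H f -> 0 <= ip f f ;
  rkhs_ip_eq0 : forall f, H f -> ip f f = 0 -> f = (fun=> 0) ;
  rkhs_complete : forall u : nat -> T -> Cplx R,
    (forall n, H (u n)) ->
    (forall e : R, 0 < e -> exists N : nat, forall m n : nat,
      (N <= m)%N -> (N <= n)%N ->
      hnorm ip (fun z => u m z - u n z) < e) ->
    exists2 f, H f &
      (fun n : nat => hnorm ip (fun z => u n z - f z)) @ \oo --> (0 : R) ;
  rkhs_kernel : forall w, Omega w -> H (fun z => k z w) ;
  rkhs_repro : forall f w, H f -> Omega w -> ip f (fun z => k z w) = f w
}.

Definition unit_disk (R : realType) : set (Cplx R) := [set z | `|z| < 1].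

Definition analytic_on (R : realType) (U : set (Cplx R))
    (f : Cplx R -> Cplx R) : Prop :=
  forall z0, U z0 -> exists a : nat -> Cplx R,
    \forall z \near z0, series (fun n => a n * (z - z0) ^+ n) @ \oo --> f z.

Section dirichlet.
Variable R : realType.
Implicit Types f g : Cplx R -> Cplx R.

Definition pt (p : R * R) : Cplx R := (p.1 +i* p.2)%C.

Definition disk2 : set (R * R) := [set p | unit_disk (pt p)].

Local Notation lebesgue2 := (@lebesgue_measure R \x @lebesgue_measure R)%E.

Definition dirichlet_energy f : \bar R :=
  ((pi^-1)%:E * \int[lebesgue2]_(p in disk2)
     (complex.Re (derive1 f (pt p)) ^+ 2 + complex.Im (derive1 f (pt p)) ^+ 2)%:E)%E.

Definition dirichlet_space : set (Cplx R -> Cplx R) :=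
  [set f | [/\ analytic_on (@unit_disk R) f,
               forall z, ~ unit_disk z -> f z = 0,
               f 0 = 0
             & (dirichlet_energy f < +oo)%E]].

(* The polarization of dirichlet_energy: (1/pi) times the area integral of
   f' times the conjugate of g', through its real and imaginary parts. *)
Definition dirichlet_ip f g : Cplx R :=
  let h (p : R * R) : Cplx R := derive1 f (pt p) * (derive1 g (pt p))^* in
  (((pi^-1 * \int[lebesgue2]_(p in disk2) complex.Re (h p))%R) +i*
   ((pi^-1 * \int[lebesgue2]_(p in disk2) complex.Im (h p))%R))%C.

End dirichlet.

(* k z w is analytic in conj w: it is differentiated with respect to the
   complex variable v = conj w, at the point conj w. *)
Definition d_wbar (R : realType) (k : Cplx R -> Cplx R -> Cplx R) :
    Cplx R -> Cplx R -> Cplx R :=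
  fun z w => derive1 (fun v : Cplx R => k z v^*) w^*.

Definition d_z (R : realType) (k : Cplx R -> Cplx R -> Cplx R) :
    Cplx R -> Cplx R -> Cplx R :=
  fun z w => derive1 (fun u : Cplx R => k u w) z.

Definition kernel_equation (R : realType) (k : Cplx R -> Cplx R -> Cplx R) :
    Prop :=
  forall z w, unit_disk z -> unit_disk w ->
    d_z (d_z k) z w = (w^*) ^+ 2 * d_z (d_wbar k) z w.

(* Main.v *)
Require Import Defs.
From HB Require Import structures.
From mathcomp Require Import all_boot all_order all_algebra.
From mathcomp Require Import cyclic separable cyclotomic complex ring lra.
From mathcomp Require Import all_classical all_reals all_analysis measurable_realfun.

Import Order.TTheory GRing.Theory Num.Theory.
Import numFieldNormedType.Exports.

Local Open Scope ring_scope.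
Local Open Scope classical_set_scope.
Set Implicit Arguments.
Unset Strict Implicit.
Unset Printing Implicit Defensive.

(* If E_n in H represents the n-th Taylor coefficient, the Taylor coefficients of
   the kernel are the entries of the Gram matrix <E_j, E_n>, and the kernel
   equation turns into the recursion
     (n + 2) <E_(j+2), E_(n+2)> = (j + 1) <E_(j+1), E_(n+1)>.
   Together with the vanishing at 0 it forces the Gram matrix to be diagonal,
   with entries C / n. By completeness H then consists of the power series with
   sum_n n |a_n|^2 < oo, which is the Dirichlet space, since the Dirichlet
   integral of sum_n a_n z^n is that sum.
   Separate analyticity of the kernel is enough: by uniform boundedness the
   kernels k_w are bounded for w in a compact disk, hence E_n is the norm limit
   of discretized Cauchy integrals of kernels, and |E_n| grows subexponentially.
   Taylor's theorem on the disk comes from Cauchy's estimate over roots of unity,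
   and the integrals of z^m conj(z)^n over the disk from Green's identity for
   (r^2 - |z|^2) z^a conj(z)^b. *)

(** * Complex modulus and series *)

(** The hypotheses make each [f] in [H] locally a power series, so [k] is analytic in [z] and, by
    Hermitian symmetry, in conj(w), but only separately. The right side of the kernel equation needs
    more: [d_wbar k] at fixed [w] must have a Taylor expansion in [z]. It has one because it belongs
    to [H], being the norm-convergent sum of the (n + 1) conj(w)^n E_(n+1); the growth bound on
    |E_n| serves exactly this convergence. Off the diagonal the Gram matrix vanishes for three
    reasons: the entries of index 0 are zero, the factor conj(w)^2 leaves no term of degree 1 in
    conj(w), and the matrix is Hermitian. The recursion carries these zeros along every diagonal.
    Averages over roots of unity stand for circle integrals because they are exact on polynomials of
    lower degree and have a geometric error on series. The factor r^2 - |z|^2 is zero on the circle,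
    so that Green's identity has no boundary term. [H] is a bare set with a form [ip], so each
    Hilbert space fact starts from the fields of [is_rkhs]. In the converse direction these fields
    are checked on coefficient sequences. *)

Definition rc (R : realType) (x : R) : Cplx R := (x%:C)%C.
(** The norm of [Cplx R] takes its values in [Cplx R] itself; [cmod] brings it back to [R], where
    suprema and linear arithmetic apply. *)
Definition cmod (R : realType) (z : Cplx R) : R := complex.Re `|z|.

Section cmod.
Variable R : realType.
Implicit Types (z w : Cplx R) (x : R).

Lemma cmodE z : `|z| = rc (cmod z).
Proof. by rewrite /cmod normc_def. Qed.

Lemma rcD x y : rc (x + y) = rc x + rc y.
Proof. exact: rmorphD. Qed.

Lemma rcN x : rc (- x) = - rc x.
Proof. exact: rmorphN. Qed.

Lemma rcM x y : rc (x * y) = rc x * rc y.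
Proof. exact: rmorphM. Qed.

Lemma rc_inj : injective (@rc R).
Proof. by move=> x y []. Qed.

Lemma rc_nat n : rc (n%:R : R) = n%:R.
Proof. exact: (rmorph_nat (real_complex R)). Qed.

Lemma rc0 : rc (0 : R) = 0.
Proof. exact: (rc_nat 0). Qed.

Lemma rc1 : rc (1 : R) = 1.
Proof. exact: (rc_nat 1). Qed.

Lemma rcX x n : rc (x ^+ n) = rc x ^+ n.
Proof. exact: (rmorphXn (real_complex R)). Qed.

Lemma rcV x : rc x^-1 = (rc x)^-1.
Proof. exact: (fmorphV (real_complex R)). Qed.

Lemma le_rc x y : (rc x <= rc y) = (x <= y).
Proof. exact: lecR. Qed.

Lemma lt_rc x y : (rc x < rc y) = (x < y).
Proof. exact: ltcR. Qed.

(** [z^*] is the conjugation of a closed numeric field, [conjc] the one on pairs; they agree because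
    the former fixes real elements and negates ['i]. *)
Lemma conjE z : z^* = (conjc z : Cplx R).
Proof.
case: z => a b.
have -> : (a +i* b)%C = rc a + 'i * rc b :> Cplx R.
  by rewrite -complexiE; apply/eqP; rewrite eq_complex /=
    !(mul0r, mul1r, mulr0, subr0, addr0, add0r) !eqxx.
rewrite rmorphD rmorphM /= conjCi !conj_Creal ?/rc ?complex_real//.
by rewrite -complexiE; apply/eqP; rewrite eq_complex /=
  !(mul0r, mul1r, mulr0, subr0, addr0, add0r, mulNr, oppr0, mulN1r, sub0r) !eqxx.
Qed.

Lemma conj_rc x : (rc x)^* = rc x.
Proof. by rewrite conjE /= oppr0. Qed.

Lemma Re_conj z : complex.Re z^* = complex.Re z.
Proof. by rewrite conjE; case: z. Qed.

Lemma Im_conj z : complex.Im z^* = - complex.Im z.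
Proof. by rewrite conjE; case: z. Qed.

Lemma ReD z w : complex.Re (z + w) = complex.Re z + complex.Re w.
Proof. by case: z w => ? ? []. Qed.

Lemma ImD z w : complex.Im (z + w) = complex.Im z + complex.Im w.
Proof. by case: z w => ? ? []. Qed.

Lemma ReN z : complex.Re (- z) = - complex.Re z.
Proof. by case: z. Qed.

Lemma ImN z : complex.Im (- z) = - complex.Im z.
Proof. by case: z. Qed.

Lemma ReM z w : complex.Re (z * w) =
  complex.Re z * complex.Re w - complex.Im z * complex.Im w.
Proof. by case: z w => ? ? []. Qed.

Lemma ImM z w : complex.Im (z * w) =
  complex.Re z * complex.Im w + complex.Im z * complex.Re w.
Proof. by case: z w => ? ? []. Qed.

Lemma Re_sum I (r : seq I) P (F : I -> Cplx R) :
  complex.Re (\sum_(i <- r | P i) F i) = \sum_(i <- r | P i) complex.Re (F i).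
Proof. by elim/big_rec2: _ => [|i y x _ <-] //; rewrite ReD. Qed.

Lemma Cplx_eq z w : complex.Re z = complex.Re w -> complex.Im z = complex.Im w -> z = w.
Proof. by case: z w => ? ? [? ?] /= -> ->. Qed.

Lemma cmodK z : cmod z ^+ 2 = complex.Re z ^+ 2 + complex.Im z ^+ 2.
Proof. by apply: rc_inj; rewrite rcX -cmodE -add_Re2_Im2. Qed.

Lemma cmodJ z : z * z^* = rc (cmod z ^+ 2).
Proof. by rewrite rcX -cmodE conjE -sqr_normc. Qed.

Lemma cmod_ge0 z : 0 <= cmod z.
Proof. by rewrite -le_rc -cmodE normr_ge0. Qed.
Hint Extern 0 (is_true (0 <= cmod _)) => exact: cmod_ge0 : core.

Lemma cmodM z w : cmod (z * w) = cmod z * cmod w.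
Proof. by apply: rc_inj; rewrite rcM -!cmodE normrM. Qed.

Lemma cmodX z n : cmod (z ^+ n) = cmod z ^+ n.
Proof. by apply: rc_inj; rewrite rcX -!cmodE normrX. Qed.

Lemma cmodV z : cmod z^-1 = (cmod z)^-1.
Proof. by apply: rc_inj; rewrite rcV -!cmodE normfV. Qed.

Lemma cmodN z : cmod (- z) = cmod z.
Proof. by rewrite /cmod normrN. Qed.

Lemma cmodBC z w : cmod (z - w) = cmod (w - z).
Proof. by rewrite /cmod distrC. Qed.

Lemma cmodC z : cmod z^* = cmod z.
Proof. by rewrite conjE /cmod normcJ. Qed.

Lemma cmod_rc x : cmod (rc x) = `|x|.
Proof. by rewrite /cmod normc_def /= expr0n addr0 sqrtr_sqr. Qed.

Lemma cmod_nat n : cmod (n%:R : Cplx R) = n%:R.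
Proof. by rewrite -rc_nat cmod_rc ger0_norm. Qed.

Lemma cmod0 : cmod (0 : Cplx R) = 0.
Proof. exact: (cmod_nat 0). Qed.

Lemma cmod1 : cmod (1 : Cplx R) = 1.
Proof. exact: (cmod_nat 1). Qed.

Lemma cmod_eq0 z : (cmod z == 0) = (z == 0).
Proof. by rewrite -(inj_eq (@rc_inj)) -cmodE rc0 normr_eq0. Qed.

Lemma cmod_gt0 z : (0 < cmod z) = (z != 0).
Proof. by rewrite lt0r cmod_ge0 andbT cmod_eq0. Qed.

Lemma cmodD z w : cmod (z + w) <= cmod z + cmod w.
Proof. by rewrite -le_rc rcD -!cmodE ler_normD. Qed.

Lemma cmodB z w : cmod (z - w) <= cmod z + cmod w.
Proof. by rewrite -(cmodN w) cmodD. Qed.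

Lemma cmod_distD y z w : cmod (z - w) <= cmod (z - y) + cmod (y - w).
Proof. by rewrite -[z - w](subrKA y) cmodD. Qed.

Lemma cmod_leD z w : cmod z <= cmod (z - w) + cmod w.
Proof. by rewrite -{1}[z](subrK w) cmodD. Qed.

Lemma cmod_sum I (r : seq I) P (F : I -> Cplx R) :
  cmod (\sum_(i <- r | P i) F i) <= \sum_(i <- r | P i) cmod (F i).
Proof.
elim/big_rec2: _ => [|i y x _ yx]; first by rewrite cmod0.
by rewrite (le_trans (cmodD _ _))// lerD2l.
Qed.

Lemma Re_le_cmod z : `|complex.Re z| <= cmod z.
Proof.
by rewrite -(ler_pXn2r (ltn0Sn 1)) ?nnegrE// cmodK real_normK ?num_real// lerDl sqr_ge0.
Qed.

Lemma Im_le_cmod z : `|complex.Im z| <= cmod z.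
Proof.
by rewrite -(ler_pXn2r (ltn0Sn 1)) ?nnegrE// cmodK real_normK ?num_real// lerDr sqr_ge0.
Qed.

Lemma cmod_le_ReIm z : cmod z <= `|complex.Re z| + `|complex.Im z|.
Proof.
rewrite -(ler_pXn2r (ltn0Sn 1)) ?nnegrE ?addr_ge0// cmodK sqrrD !real_normK ?num_real//.
by rewrite lerD2r lerDl mulrn_wge0// mulr_ge0.
Qed.

(** A positive element of [Cplx R] is a positive real, so tolerances may be taken in [R]. *)
Lemma cvgC (u : nat -> Cplx R) (l : Cplx R) : u @ \oo --> l <->
  forall e : R, 0 < e -> exists n0, forall n, (n0 <= n)%N -> cmod (u n - l) < e.
Proof.
split=> [/cvgrPdist_lt ul e e0|ul].
  have /ul[n0 _ h] : 0 < rc e by rewrite -rc0 lt_rc.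
  by exists n0 => n /h; rewrite /= distrC cmodE lt_rc.
apply/cvgrPdist_lt => e e0.
have eE : e = rc (cmod e) by rewrite -cmodE gtr0_norm.
move: e0; rewrite eE -rc0 lt_rc => /ul[n0 h].
by exists n0 => // n /h; rewrite /= distrC cmodE lt_rc.
Qed.

Lemma cvgR (u : nat -> R) (l : R) : u @ \oo --> l <->
  forall e : R, 0 < e -> exists n0, forall n, (n0 <= n)%N -> `|u n - l| < e.
Proof.
split=> [/cvgrPdist_lt ul e e0|ul].
  have [n0 _ h] := ul _ e0.
  by exists n0 => n /h; rewrite /= distrC.
apply/cvgrPdist_lt => e /ul[n0 h].
by exists n0 => // n /h; rewrite /= distrC.
Qed.

Lemma cvgC_ReIm (u : nat -> Cplx R) (l : Cplx R) : u @ \oo --> l <->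
  ((fun n => complex.Re (u n)) @ \oo --> complex.Re l) /\
  ((fun n => complex.Im (u n)) @ \oo --> complex.Im l).
Proof.
rewrite cvgC !cvgR; split=> [h|[h1 h2] e e0].
  split=> e /h[n0 h0]; exists n0 => n /h0; apply: le_lt_trans.
    by rewrite -ReN -ReD Re_le_cmod.
  by rewrite -ImN -ImD Im_le_cmod.
have e20 : 0 < e / 2 by rewrite divr_gt0.
have [n1 {}h1] := h1 _ e20; have [n2 {}h2] := h2 _ e20.
exists (maxn n1 n2) => n; rewrite geq_max => /andP[/h1 {}h1 /h2 {}h2].
apply: le_lt_trans (cmod_le_ReIm _) _.
by rewrite ReD ReN ImD ImN [e]splitr ltrD.
Qed.

Lemma cvgC_ext (u v : nat -> Cplx R) (l : Cplx R) :
  u =1 v -> u @ \oo --> l -> v @ \oo --> l.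
Proof. by move=> /funext ->. Qed.

Lemma cauchyR (u : nat -> R) :
  (forall e : R, 0 < e -> exists n0, forall n, (n0 <= n)%N -> `|u n - u n0| < e) ->
  exists l : R, u @ \oo --> l.
Proof.
move=> h; suff : cvgn u by move=> /cvg_ex[l ul]; exists l.
apply/cauchy_cvgP/cauchy_exP => e /h[n0 un0]; exists (u n0), n0 => // n /un0.
by rewrite /ball/= distrC.
Qed.

Lemma cauchyC (u : nat -> Cplx R) :
  (forall e : R, 0 < e -> exists n0, forall n, (n0 <= n)%N -> cmod (u n - u n0) < e) ->
  exists l : Cplx R, u @ \oo --> l.
Proof.
move=> h.
have [a ha] : exists a : R, (fun n => complex.Re (u n)) @ \oo --> a.
  apply: cauchyR => e /h[n0 un0]; exists n0 => n /un0; apply: le_lt_trans.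
  by rewrite -ReN -ReD Re_le_cmod.
have [b hb] : exists b : R, (fun n => complex.Im (u n)) @ \oo --> b.
  apply: cauchyR => e /h[n0 un0]; exists n0 => n /un0; apply: le_lt_trans.
  by rewrite -ImN -ImD Im_le_cmod.
by exists (a +i* b)%C; apply/cvgC_ReIm.
Qed.

End cmod.
#[global] Hint Extern 0 (is_true (0 <= cmod _)) => exact: cmod_ge0 : core.

(** * Absolutely summable series *)

Definition summ (R : realType) (a : nat -> Cplx R) : Prop :=
  exists B : R, forall n, \sum_(i < n) cmod (a i) <= B.

(** The value is the limit of the partial sums whenever they converge, not only under [summ]; the
    default 0 is for divergent series. *)
Definition csum (R : realType) (a : nat -> Cplx R) : Cplx R :=
  xget 0 [set l : Cplx R | (fun n => \sum_(i < n) a i) @ \oo --> l].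

Section csum.
Variable R : realType.
Implicit Types (a b u : nat -> Cplx R) (l : Cplx R).

Lemma cvgC_le u l c (B : R) : u @ \oo --> l ->
  (exists n0, forall n, (n0 <= n)%N -> cmod (u n - c) <= B) -> cmod (l - c) <= B.
Proof.
move=> /cvgC ul [n0 h]; apply/ler_addgt0Pr => e /ul[n1 h1].
have /h {}h := leq_maxl n0 n1; have /h1 {}h1 := leq_maxr n0 n1.
rewrite (le_trans (cmod_distD (u (maxn n0 n1)) _ _))// addrC lerD//.
by rewrite cmodBC ltW.
Qed.

Lemma cvgC_bound u l (B : R) : u @ \oo --> l -> (forall n, cmod (u n) <= B) -> cmod l <= B.
Proof.
move=> ul h; rewrite -[l]subr0; apply: (cvgC_le ul); exists 0%N => n _.
by rewrite subr0.
Qed.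

Lemma cvgC_shift u l k : (fun n => u (n + k)%N) @ \oo --> l -> u @ \oo --> l.
Proof. by move=> ul; rewrite -(cvg_shiftn k). Qed.

Lemma cvgCD u (v : nat -> Cplx R) l (m : Cplx R) : u @ \oo --> l -> v @ \oo --> m ->
  (fun n => u n + v n) @ \oo --> l + m.
Proof. by move=> ul vm; exact: (cvgD ul vm). Qed.

Lemma cvgCMr u l c : u @ \oo --> l -> (fun n => c * u n) @ \oo --> c * l.
Proof. by move=> ul; exact: (cvgM (cvg_cst c) ul). Qed.

Lemma cvgC_unique u (l l' : Cplx R) : u @ \oo --> l -> u @ \oo --> l' -> l = l'.
Proof. exact: cvg_unique. Qed.

Lemma cvg_cmod u l : u @ \oo --> l -> (fun n => cmod (u n)) @ \oo --> cmod l.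
Proof.
move=> /cvgC ul; apply/cvgR => e /ul[n0 h]; exists n0 => n /h; apply: le_lt_trans.
have := cmod_leD (u n) l; have := cmod_leD l (u n); rewrite (cmodBC l).
by rewrite ler_norml => h1 h2; apply/andP; split; lra.
Qed.

Lemma cvgC_conj u l : u @ \oo --> l -> (fun n => (u n)^*) @ \oo --> l^*.
Proof.
move=> /cvgC ul; apply/cvgC => e /ul[n0 h]; exists n0 => n /h.
by rewrite -rmorphB cmodC.
Qed.

Lemma monotone_tail (S : nat -> R) (B : R) : {homo S : m n / (m <= n)%N >-> m <= n} ->
  (forall n, S n <= B) ->
  forall e : R, 0 < e -> exists n0, forall n, S n < S n0 + e.
Proof.
move=> nd SB e e0.
have hs : has_sup (range S) by split; [exists (S 0%N), 0%N | exists B => _ [n _ <-]].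
have [_ [n0 _ <-] h] := sup_adherent e0 hs; exists n0 => n.
by rewrite -ltrBlDr (le_lt_trans _ h)// lerB// ub_le_sup; [|exact: hs.2|exists n].
Qed.

Lemma sum_ord_mono (f : nat -> R) : (forall i, 0 <= f i) ->
  {homo (fun n => \sum_(i < n) f i) : m n / (m <= n)%N >-> m <= n}.
Proof.
move=> f0 m n mn; rewrite (big_ord_widen_cond _ xpredT (fun i => f i) mn).
by rewrite [leRHS](bigID (fun i : 'I_n => (i < m)%N))/= lerDl sumr_ge0.
Qed.

Lemma sum_ord_sub (V : zmodType) (f : nat -> V) m n : (m <= n)%N ->
  \sum_(i < n) f i - \sum_(i < m) f i = \sum_(i < n | (m <= i)%N) f i.
Proof.
move=> mn; rewrite (big_ord_widen_cond _ xpredT (fun i => f i) mn).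
rewrite [X in X - _](bigID (fun i : 'I_n => (i < m)%N))/= [X in X - _]addrC addrK.
by apply: eq_bigl => i; rewrite -leqNgt.
Qed.

Lemma summ_cvg a : summ a -> exists l : Cplx R, (fun n => \sum_(i < n) a i) @ \oo --> l.
Proof.
move=> [B aB]; apply: cauchyC => e e0.
have nd := sum_ord_mono (fun i => cmod_ge0 (a i)).
have [n0 h] := monotone_tail nd aB e0; exists n0 => n n0n.
rewrite (sum_ord_sub a n0n) (le_lt_trans (cmod_sum _ _ _))//.
by rewrite -(sum_ord_sub (fun i => cmod (a i)) n0n) ltrBlDl h.
Qed.

Lemma csum_cvg a l : (fun n => \sum_(i < n) a i) @ \oo --> l ->
  (fun n => \sum_(i < n) a i) @ \oo --> csum a.
Proof.
move=> al; have := @xgetPex _ (0 : Cplx R)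
  [set l : Cplx R | (fun n => \sum_(i < n) a i) @ \oo --> l].
by apply; exists l.
Qed.

Lemma csumP a : summ a -> (fun n => \sum_(i < n) a i) @ \oo --> csum a.
Proof. by move=> /summ_cvg[l]; exact: csum_cvg. Qed.

Lemma csum_unique a l : (fun n => \sum_(i < n) a i) @ \oo --> l -> csum a = l.
Proof.
by move=> al; apply: (cvgC_unique (csum_cvg al)).
Qed.

Lemma eq_csum a b : a =1 b -> csum a = csum b.
Proof. by move=> /funext ->. Qed.

Lemma csum_bound a (B : R) : (forall n, \sum_(i < n) cmod (a i) <= B) -> cmod (csum a) <= B.
Proof.
move=> aB; apply: (@cvgC_bound (fun n => \sum_(i < n) a i)).
  by apply: csumP; exists B.
by move=> n; rewrite (le_trans (cmod_sum _ _ _)).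
Qed.

Lemma summZ c a : summ a -> summ (fun n => c * a n).
Proof.
move=> [B aB]; exists (cmod c * B) => n; under eq_bigr do rewrite cmodM.
by rewrite -mulr_sumr; apply: ler_wpM2l; [exact: cmod_ge0 | exact: aB].
Qed.

Lemma csumZ c a : summ a -> csum (fun n => c * a n) = c * csum a.
Proof.
move=> sa; apply: csum_unique; under eq_fun do rewrite -mulr_sumr.
by apply: cvgCMr; exact: csumP.
Qed.

Lemma csumD a b : summ a -> summ b -> csum (fun n => a n + b n) = csum a + csum b.
Proof.
move=> sa sb; apply: csum_unique; under eq_fun do rewrite big_split.
by apply: cvgCD; exact: csumP.
Qed.

Lemma csum_conj a : summ a -> csum (fun n => (a n)^*) = (csum a)^*.
Proof.
move=> sa; apply: csum_unique; under eq_fun do rewrite -rmorph_sum.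
by apply: cvgC_conj; exact: csumP.
Qed.

Lemma csum_fin n a : (forall i, (n <= i)%N -> a i = 0) -> csum a = \sum_(i < n) a i.
Proof.
move=> a0; apply: csum_unique; apply/cvgC => e e0; exists n => m nm.
rewrite (sum_ord_sub a nm) big1 ?cmod0// => i; exact: a0.
Qed.

Lemma csum_recl a : summ a -> csum a = a 0%N + csum (fun n => a n.+1).
Proof.
move=> [B aB]; apply: csum_unique; apply: (@cvgC_shift _ _ 1).
under eq_fun do rewrite addn1 big_ord_recl.
apply: (@cvgCD (fun=> a 0%N) (fun n => \sum_(i < n) a i.+1)).
  exact: (cvg_cst (a 0%N)).
apply: csumP; exists B => n; apply: le_trans (aB n.+1).
by rewrite big_ord_recl lerDr.
Qed.

End csum.

(** * Iterated sums of absolutely summable double families *)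

Section double_sums.
Variable R : realType.
Implicit Types (a : nat -> nat -> Cplx R) (B : R).

Lemma cvgC_sum n (u : nat -> nat -> Cplx R) (l : nat -> Cplx R) :
  (forall i, (i < n)%N -> u i @ \oo --> l i) ->
  (fun m => \sum_(i < n) u i m) @ \oo --> \sum_(i < n) l i.
Proof.
elim: n => [|n IH] ul.
  under eq_fun do rewrite big_ord0; rewrite big_ord0; exact: (cvg_cst (0 : Cplx R)).
under eq_fun do rewrite big_ord_recr /=; rewrite big_ord_recr /=.
apply: (@cvgCD _ (fun m => \sum_(i < n) u i m) (u n)); last exact: ul.
by apply: IH => i ni; apply: ul; rewrite ltnW.
Qed.

Lemma sum_box (V : zmodType) (f : nat -> nat -> V) k n m : (k <= n)%N -> (k <= m)%N ->
  \sum_(i < n) \sum_(j < m) f i j - \sum_(i < k) \sum_(j < k) f i j =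
  \sum_(i < n) \sum_(j < m) (if (i < k)%N && (j < k)%N then 0 else f i j).
Proof.
move=> kn km; apply/eqP; rewrite subr_eq; apply/eqP.
rewrite (big_ord_widen_cond _ xpredT (fun i => \sum_(j < k) f i j) kn) [X in _ + X]big_mkcond -big_split/=.
apply: eq_bigr => i _; case: ifPn => ik; last first.
  by rewrite addr0.
rewrite (big_ord_widen_cond _ xpredT (fun j => f i j) km) [X in _ + X]big_mkcond -big_split/=.
apply: eq_bigr => j _ /=.
by case: ifPn => jk; rewrite ?add0r ?addr0.
Qed.

(** The square sums of moduli increase to a supremum; once the k x k square is within [e] of it, the
    moduli outside that square add up to at most [e] in any larger rectangle. *)
Lemma double_sum_approx a B :
  (forall n m, \sum_(i < n) \sum_(j < m) cmod (a i j) <= B) ->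
  forall e : R, 0 < e -> exists k, forall n m, (k <= n)%N -> (k <= m)%N ->
  cmod (\sum_(i < n) \sum_(j < m) a i j - \sum_(i < k) \sum_(j < k) a i j) <= e.
Proof.
move=> aB e e0.
pose S n := \sum_(i < n) \sum_(j < n) cmod (a i j).
have c0 n m (F : 'I_n -> 'I_m -> Cplx R) i : 0 <= \sum_(j < m) cmod (F i j).
  exact: sumr_ge0.
have S2 n m N : (n <= N)%N -> (m <= N)%N ->
    \sum_(i < n) \sum_(j < m) cmod (a i j) <= S N.
  move=> nN mN; apply: (@le_trans _ _ (\sum_(i < n) \sum_(j < N) cmod (a i j))).
    by apply: ler_sum => i _; apply: (sum_ord_mono (fun j => cmod_ge0 (a i j))).
  apply: (@sum_ord_mono _ (fun i => \sum_(j < N) cmod (a i j))) => // i.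
  exact: sumr_ge0.
have nd : {homo S : m n / (m <= n)%N >-> m <= n} by move=> m n mn; exact: S2.
have [k hk] := monotone_tail nd (fun n => aB n n) e0; exists k => n m kn km.
rewrite (sum_box a kn km) (le_trans (cmod_sum _ _ _))//.
rewrite (@le_trans _ _ (\sum_(i < n) \sum_(j < m)
    (if (i < k)%N && (j < k)%N then 0 else cmod (a i j))))//.
  apply: ler_sum => i _; rewrite (le_trans (cmod_sum _ _ _))//.
  by apply: ler_sum => j _; case: ifP => // _; rewrite cmod0.
rewrite -(sum_box (fun i j => cmod (a i j)) kn km) lerBlDl.
by rewrite (le_trans (S2 _ _ (maxn n m) _ _)) ?leq_maxl ?leq_maxr// ltW.
Qed.

Lemma double_row_summ a B :
  (forall n m, \sum_(i < n) \sum_(j < m) cmod (a i j) <= B) -> forall i, summ (a i).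
Proof.
move=> aB i; exists B => m; apply: le_trans (aB i.+1 m).
by rewrite big_ord_recr/= lerDr; apply: sumr_ge0 => j _; exact: sumr_ge0.
Qed.

(** Limit of the inequality for finite rows; the moduli are cast to [Cplx R] so that the limit
    lemmas for complex sequences apply. *)
Lemma double_summ a B :
  (forall n m, \sum_(i < n) \sum_(j < m) cmod (a i j) <= B) ->
  forall n, \sum_(i < n) cmod (csum (a i)) <= B.
Proof.
move=> aB n.
have h : (fun m => \sum_(i < n) rc (cmod (\sum_(j < m) a i j))) @ \oo -->
    \sum_(i < n) rc (cmod (csum (a i))).
  apply: (@cvgC_sum _ (fun i m => rc (cmod (\sum_(j < m) a i j)))
    (fun i => rc (cmod (csum (a i))))) => i _.
  have /cvg_cmod/cvgR hi := csumP (double_row_summ aB i).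
  apply/cvgC => e /hi[n0 hn]; exists n0 => k /hn.
  by rewrite -rcN -rcD cmod_rc.
have := cvgC_bound h; rewrite -(big_morph _ (@rcD R) (@rc0 R)) cmod_rc.
rewrite ger0_norm; last exact: sumr_ge0.
apply => m; rewrite -(big_morph _ (@rcD R) (@rc0 R)) cmod_rc.
rewrite ger0_norm; last exact: sumr_ge0.
by apply: le_trans (aB n m); apply: ler_sum => i _; exact: cmod_sum.
Qed.

Lemma double_csum_approx a B k e :
  (forall n m, \sum_(i < n) \sum_(j < m) cmod (a i j) <= B) ->
  (forall n m, (k <= n)%N -> (k <= m)%N ->
  cmod (\sum_(i < n) \sum_(j < m) a i j - \sum_(i < k) \sum_(j < k) a i j) <= e) ->
  cmod (csum (fun i => csum (a i)) - \sum_(i < k) \sum_(j < k) a i j) <= e.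
Proof.
move=> aB h.
apply: (@cvgC_le _ (fun n => \sum_(i < n) csum (a i))).
  by apply: csumP; exists B; exact: double_summ.
exists k => n kn; apply: (@cvgC_le _ (fun m => \sum_(i < n) \sum_(j < m) a i j)).
  apply: (@cvgC_sum _ (fun i m => \sum_(j < m) a i j) (fun i => csum (a i))) => i _.
    by apply: csumP; exact: double_row_summ aB i.
by exists k => m; exact: h.
Qed.

(** Both iterated sums lie within e / 2 of one and the same square partial sum. *)
Lemma csum_exchange a B :
  (forall n m, \sum_(i < n) \sum_(j < m) cmod (a i j) <= B) ->
  csum (fun i => csum (a i)) = csum (fun j => csum (fun i => a i j)).
Proof.
move=> aB; apply/eqP; rewrite -subr_eq0 -cmod_eq0 eq_le cmod_ge0 andbT.
apply/ler_addgt0Pr => e e0; rewrite add0r.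
have e20 : 0 < e / 2 by rewrite divr_gt0.
have [k hk] := double_sum_approx aB e20.
have h1 := double_csum_approx aB hk.
have aB' n m : \sum_(i < n) \sum_(j < m) cmod (a j i) <= B by rewrite exchange_big.
have h2 : cmod (csum (fun j => csum (fun i => a i j)) - \sum_(j < k) \sum_(i < k) a i j) <= e / 2.
  apply: (@double_csum_approx (fun j i => a i j) _ _ _ aB') => n m kn km.
  by rewrite exchange_big [X in _ - X]exchange_big; exact: hk.
rewrite exchange_big/= in h2.
by rewrite (le_trans (cmod_distD (\sum_(i < k) \sum_(j < k) a i j) _ _))// [leRHS]splitr lerD// cmodBC.
Qed.

End double_sums.

Lemma geom_small (R : realType) (K q e : R) : 0 <= q -> q < 1 -> 0 < e ->
  exists N, forall n, (N <= n)%N -> K * q ^+ n < e.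
Proof.
move=> q0 q1 e0.
have /cvgR : (fun n => K * q ^+ n) @ \oo --> (0 : R).
  rewrite -[X in _ --> X](mulr0 K); apply: cvgM; first exact: cvg_cst.
  by apply: cvg_expr; rewrite ger0_norm.
move=> /(_ _ e0)[N h]; exists N => n /h; rewrite subr0; apply: le_lt_trans.
exact: ler_norm.
Qed.

Lemma geom_sum_le (R : realType) (q : R) n : 0 <= q -> q < 1 ->
  \sum_(i < n) q ^+ i <= (1 - q)^-1.
Proof.
move=> q0 q1; have q'0 : 0 < 1 - q by rewrite subr_gt0.
rewrite -[leRHS]mul1r ler_pdivlMr// mulrC -opprB mulNr -subrX1 opprB.
by rewrite gerBl exprn_ge0.
Qed.

Lemma binom_term_le (R : realType) (s t : R) n k : 0 <= s -> 0 <= t ->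
  ('C(n + k, k))%:R * s ^+ n * t ^+ k <= (s + t) ^+ (n + k).
Proof.
move=> s0 t0; rewrite exprDn.
have kn : (k < (n + k).+1)%N by rewrite ltnS leq_addl.
rewrite (bigD1 (Ordinal kn))//= addnK -mulrA mulr_natl lerDl.
by apply: sumr_ge0 => i _; rewrite mulrn_wge0// mulr_ge0// exprn_ge0.
Qed.

(** * Power series *)

(** Radius of convergence at least [r], stated through bounded terms as in Abel's lemma; summability
    on smaller disks follows by a geometric comparison. *)
Definition pconv (R : realType) (a : nat -> Cplx R) (r : R) : Prop :=
  forall s : R, 0 <= s -> s < r -> exists B : R, forall n, cmod (a n) * s ^+ n <= B.

Definition psum (R : realType) (a : nat -> Cplx R) (z : Cplx R) : Cplx R :=
  csum (fun n => a n * z ^+ n).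

(** Coefficients of the [k]-th derivative divided by k!, so that [psum (dcoef k a) z] is the [k]-th
    Taylor coefficient at [z]. *)
Definition dcoef (R : realType) k (a : nat -> Cplx R) : nat -> Cplx R :=
  fun n => ('C(n + k, k))%:R * a (n + k)%N.

Section power_series.
Variable R : realType.
Implicit Types (a b : nat -> Cplx R) (z h : Cplx R) (r s t B : R).

Lemma pconv_le a r s : s <= r -> pconv a r -> pconv a s.
Proof. by move=> sr ar t t0 ts; apply: ar => //; exact: lt_le_trans sr. Qed.

Lemma geom_tail a t B s n m : (forall n, cmod (a n) * t ^+ n <= B) ->
  0 <= s -> s < t ->
  \sum_(i < m) cmod (a (n + i)%N) * s ^+ (n + i) <= B * (s / t) ^+ n / (1 - s / t).
Proof.
move=> aB s0 st; have t0 := le_lt_trans s0 st.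
have q0 : 0 <= s / t by rewrite divr_ge0// ltW.
have q1 : s / t < 1 by rewrite ltr_pdivrMr// mul1r.
have B0 : 0 <= B by apply: le_trans (aB 0%N); rewrite mulr_ge0// exprn_ge0// ltW.
apply: (@le_trans _ _ (\sum_(i < m) B * (s / t) ^+ n * (s / t) ^+ i)).
  apply: ler_sum => i _; rewrite -mulrA -exprD.
  rewrite expr_div_n mulrA ler_pdivlMr ?exprn_gt0// mulrAC.
  by rewrite ler_wpM2r ?exprn_ge0.
by rewrite -mulr_sumr ler_wpM2l ?geom_sum_le// mulr_ge0// exprn_ge0.
Qed.

Lemma pconv_sum a r s : pconv a r -> 0 <= s -> s < r ->
  exists B, forall n, \sum_(i < n) cmod (a i) * s ^+ i <= B.
Proof.
move=> ar s0 sr; have st : s < (s + r) / 2 by lra.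
have [||B aB] := ar ((s + r) / 2); [by lra | by lra |].
exists (B * (s / ((s + r) / 2)) ^+ 0 / (1 - s / ((s + r) / 2))) => n.
exact: (geom_tail 0 n aB s0 st).
Qed.

Lemma pconv_summ a r z : pconv a r -> cmod z < r -> summ (fun n => a n * z ^+ n).
Proof.
move=> ar zr; have [B aB] := pconv_sum ar (cmod_ge0 z) zr; exists B => n.
by under eq_bigr do rewrite cmodM cmodX.
Qed.

Lemma psum_tail a t B z n : (forall n, cmod (a n) * t ^+ n <= B) -> cmod z < t ->
  cmod (psum a z - \sum_(i < n) a i * z ^+ i) <=
  B * (cmod z / t) ^+ n / (1 - cmod z / t).
Proof.
move=> aB zt; apply: (@cvgC_le _ (fun m => \sum_(i < m) a i * z ^+ i)).
  apply: csumP; exists (B * (cmod z / t) ^+ 0 / (1 - cmod z / t)) => m.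
  under eq_bigr do rewrite cmodM cmodX.
  exact: (geom_tail 0 m aB (cmod_ge0 z) zt).
exists n => m nm; rewrite -(subnKC nm) big_split_ord/= [X in X - _]addrC addrK.
rewrite (le_trans (cmod_sum _ _ _))//; under eq_bigr do rewrite cmodM cmodX.
exact: geom_tail.
Qed.

Lemma csum_shiftn a k : (forall i, (i < k)%N -> a i = 0) ->
  summ a -> csum a = csum (fun n => a (n + k)%N).
Proof.
elim: k a => [|k IH] a a0 sa; first by apply: eq_csum => n; rewrite addn0.
rewrite (csum_recl sa) a0// add0r IH.
- by apply: eq_csum => n; rewrite addnS.
- by move=> i ik; rewrite a0.
- case: sa => B aB; exists B => n; apply: le_trans (aB n.+1).
  by rewrite big_ord_recl lerDr.
Qed.

(** For t between s and r, one term of the binomial expansion of (s + (t - s))^(n + k) bounds C(n +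
    k, k) s^n by t^(n + k) / (t - s)^k. *)
Lemma pconv_dcoef a r k : pconv a r -> pconv (dcoef k a) r.
Proof.
move=> ar s s0 sr; have st : s < (s + r) / 2 by lra.
have [||B aB] := ar ((s + r) / 2); [by lra | by lra |].
have t0 : 0 < (s + r) / 2 - s by lra.
exists (B / ((s + r) / 2 - s) ^+ k) => n.
rewrite ler_pdivlMr ?exprn_gt0// /dcoef cmodM cmod_nat.
apply: le_trans (aB (n + k)%N).
rewrite mulrAC [_%:R * _]mulrC -!mulrA ler_wpM2l//.
have := binom_term_le n k s0 (ltW t0); rewrite subrKC.
by rewrite -mulrA [s ^+ n * _]mulrC.
Qed.

(** The term of degree k in h of a_n (z + h)^n. For k > n the binomial coefficient is 0, which makes
    the truncated [n - k] harmless. *)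
Let recenter_term a z h (n k : nat) : Cplx R :=
  a n * (('C(n, k))%:R * z ^+ (n - k) * h ^+ k).

Let recenter_bound a r z h : pconv a r -> cmod z + cmod h < r ->
  exists B, forall n m, \sum_(i < n) \sum_(j < m) cmod (recenter_term a z h i j) <= B.
Proof.
move=> ar zh; have [|B aB] := pconv_sum ar _ zh; first by rewrite addr_ge0.
exists B => n m; apply: le_trans (aB n); apply: ler_sum => i _.
under eq_bigr do rewrite /recenter_term !cmodM !cmodX cmod_nat.
rewrite -mulr_sumr ler_wpM2l// exprDn.
pose F j : R := ('C(i, j))%:R * cmod z ^+ (i - j) * cmod h ^+ j.
have F0 j : 0 <= F j by rewrite !mulr_ge0// exprn_ge0.
apply: (@le_trans _ _ (\sum_(j < maxn m i.+1) F j)).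
  by apply: (sum_ord_mono F0); exact: leq_maxl.
rewrite [leRHS](_ : _ = \sum_(j < i.+1) F j); last first.
  by apply: eq_bigr => j _; rewrite /F -mulrA mulr_natl.
rewrite -subr_le0 (sum_ord_sub F (leq_maxr m i.+1)) big1// => j ij.
by rewrite /F bin_small// !mul0r.
Qed.

(** The double family of binomial terms is absolutely summable, its rows of moduli adding up to at
    most |a_n| (|z| + |h|)^n. Column k, whose first k entries vanish, sums to the new coefficient
    times h^k. *)
Lemma psum_recenter a r z h : pconv a r -> cmod z + cmod h < r ->
  psum a (z + h) = psum (fun k => psum (dcoef k a) z) h.
Proof.
move=> ar zh; have [B hB] := recenter_bound ar zh.
rewrite /psum; transitivity (csum (fun n => csum (recenter_term a z h n))).
  apply: eq_csum => n; rewrite (@csum_fin _ n.+1); last first.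
    by move=> i ni; rewrite /recenter_term bin_small// !mul0r mulr0.
  rewrite -mulr_sumr exprDn; congr (_ * _); apply: eq_bigr => i _.
  by rewrite -mulrA mulr_natl.
rewrite (csum_exchange hB); apply: eq_csum => k.
have zr : cmod z < r by apply: le_lt_trans zh; rewrite lerDl.
rewrite mulrC -csumZ; last exact: pconv_summ (pconv_dcoef k ar) zr.
rewrite (@csum_shiftn _ k).
- apply: eq_csum => n; rewrite /recenter_term /dcoef addnK; ring.
- by move=> i ik; rewrite /recenter_term bin_small// !mul0r mulr0.
- have hB' n m : \sum_(i < n) \sum_(j < m) cmod (recenter_term a z h j i) <= B.
    by rewrite exchange_big.
  exact: (@double_row_summ _ (fun k n => recenter_term a z h n k) _ hB').
Qed.

(** For h the real number s, the k-th column sum is the new coefficient times s^k, so the bound on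
    the whole double family bounds them all. *)
Lemma pconv_recenter a r z : pconv a r -> cmod z < r ->
  pconv (fun k => psum (dcoef k a) z) (r - cmod z).
Proof.
move=> ar zr s s0 sr.
have zs : cmod z + cmod (rc s) < r by rewrite cmod_rc ger0_norm//; lra.
have [B hB] := recenter_bound ar zs; exists B => k.
have hB' n m : \sum_(i < n) \sum_(j < m) cmod (recenter_term a z (rc s) j i) <= B.
  by rewrite exchange_big.
have := @double_summ _ (fun k n => recenter_term a z (rc s) n k) _ hB' k.+1; rewrite big_ord_recr/= => h.
apply: le_trans h; rewrite (_ : csum _ = psum (dcoef k a) z * rc s ^+ k).
  by rewrite cmodM cmodX cmod_rc ger0_norm// lerDr sumr_ge0.
rewrite mulrC -csumZ; last exact: pconv_summ (pconv_dcoef k ar) zr.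
rewrite (@csum_shiftn _ k).
- apply: eq_csum => n; rewrite /recenter_term /dcoef addnK; ring.
- by move=> i ik; rewrite /recenter_term bin_small// !mul0r mulr0.
- exact: (@double_row_summ _ (fun k n => recenter_term a z (rc s) n k) _ hB').
Qed.
End power_series.

(** * Cauchy estimates *)

Section roots_of_unity.
Variable R : realType.

(** X^n - 1 splits over the closed field and is separable in characteristic 0; its n distinct roots
    include a primitive one. *)
Lemma prim_root_exists n : (0 < n)%N -> exists w : Cplx R, n.-primitive_root w.
Proof.
move=> n0; have [rs def] := closed_field_poly_normal ('X^n - 1 : {poly Cplx R}).
have m1 : lead_coef ('X^n - 1 : {poly Cplx R}) = 1 by exact: lead_coefXnsubC.
rewrite m1 scale1r in def.
have szrs : size rs = n.
  by apply: succn_inj; rewrite -(size_prod_XsubC rs id) -def; exact: size_XnsubC.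
have : has n.-primitive_root rs.
  apply: has_prim_root => //.
  - by apply/allP => x xrs; rewrite /root_of_unity def root_prod_XsubC.
  - rewrite -separable_prod_XsubC -def; apply: separable_Xn_sub_1.
    by rewrite pnatr_eq0 -lt0n.
  - by rewrite szrs.
by move=> /hasP[w _ ?]; exists w.
Qed.

Lemma sum_prim_root n (w : Cplx R) i : n.-primitive_root w ->
  \sum_(j < n) w ^+ (i * j) = if (n %| i)%N then n%:R else 0.
Proof.
move=> pw; under eq_bigr do rewrite exprM.
case: ifPn => ni.
  have -> : w ^+ i = 1 by apply/eqP; rewrite -(prim_order_dvd pw).
  by under eq_bigr do rewrite expr1n; rewrite sumr_const card_ord.
have wi : w ^+ i - 1 != 0 by rewrite subr_eq0 -(prim_order_dvd pw).
apply: (mulfI wi); rewrite -subrX1 mulr0 -exprM mulnC exprM.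
by rewrite (prim_expr_order pw) expr1n subrr.
Qed.

Lemma cmod_prim_root n (w : Cplx R) : n.-primitive_root w -> cmod w = 1.
Proof.
move=> pw; apply/eqP; rewrite -(@pexpr_eq1 _ _ n) ?(prim_order_gt0 pw)//.
by rewrite -cmodX (prim_expr_order pw) cmod1.
Qed.

(* The discrete Cauchy integral for the n-th coefficient, over N points of
   the circle of radius s; the exponent N - n stands for - n. *)
Definition circle_avg (f : Cplx R -> Cplx R) (w : Cplx R) N n (s : R) : Cplx R :=
  N%:R^-1 * \sum_(j < N) w ^+ ((N - n) * j) * f (rc s * w ^+ j).

(** Orthogonality of characters: the monomial of degree i contributes only if N divides N - n + i,
    which for i and n below N means i = n. *)
Lemma circle_avg_poly (a : nat -> Cplx R) w N n s : N.-primitive_root w -> (n < N)%N ->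
  circle_avg (fun z => \sum_(i < N) a i * z ^+ i) w N n s = a n * rc s ^+ n.
Proof.
move=> pw nN; rewrite /circle_avg.
under eq_bigr => j _ do rewrite mulr_sumr.
rewrite exchange_big/= (bigD1 (Ordinal nN))//= [X in _ * (_ + X)]big1 => [|i iN].
  rewrite addr0 (eq_bigr (fun j : 'I_N => a n * rc s ^+ n * w ^+ (N * j)))/=; last first.
    move=> j _; rewrite exprMn -exprM mulrCA [X in _ * X]mulrCA -exprD.
    have -> : ((N - n) * j + j * n = N * j)%N by rewrite (mulnC j) -mulnDl subnK// ltnW.
    by rewrite mulrA.
  rewrite -mulr_sumr (sum_prim_root _ pw) dvdnn mulrCA mulVf ?mulr1//.
  by rewrite pnatr_eq0 -lt0n (leq_ltn_trans _ nN).
rewrite (eq_bigr (fun j : 'I_N => a i * rc s ^+ i * w ^+ ((N - n + i) * j)))/=; last first.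
  move=> j _; rewrite exprMn -exprM mulrCA [X in _ * X]mulrCA -exprD.
  have -> : ((N - n) * j + j * i = (N - n + i) * j)%N by rewrite (mulnC j) -mulnDl.
  by rewrite mulrA.
rewrite -mulr_sumr (sum_prim_root _ pw) ifN ?mulr0//; apply: contra iN => /dvdnP[q] Nq.
apply/eqP/val_inj => /=.
have {}Nq : (N + i = q * N + n)%N by rewrite -Nq addnAC subnK// ltnW.
have : ((N + i) %% N = (q * N + n) %% N)%N by rewrite Nq.
by rewrite modnDl modnMDl !modn_small.
Qed.

Lemma circle_avg_le f w N n s (M : R) : N.-primitive_root w -> 0 <= s ->
  (forall z, cmod z = s -> cmod (f z) <= M) -> cmod (circle_avg f w N n s) <= M.
Proof.
move=> pw s0 fM; have N0 := prim_order_gt0 pw.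
rewrite /circle_avg cmodM cmodV cmod_nat mulrC ler_pdivrMr ?ltr0n//.
rewrite (le_trans (cmod_sum _ _ _))// (@le_trans _ _ (\sum_(j < N) M))//.
  apply: ler_sum => j _; rewrite cmodM cmodX (cmod_prim_root pw) expr1n mul1r fM//.
  by rewrite cmodM cmodX (cmod_prim_root pw) expr1n mulr1 cmod_rc ger0_norm.
by rewrite sumr_const card_ord mulr_natr.
Qed.

Lemma circle_avgB f g w N n s :
  circle_avg (fun z => f z - g z) w N n s = circle_avg f w N n s - circle_avg g w N n s.
Proof.
rewrite /circle_avg -mulrBr -sumrB; congr (_ * _).
by apply: eq_bigr => j _; rewrite mulrBr.
Qed.

(** The average is exact on the truncation at degree N; what remains is the tail of the series on
    the circle, of order (s / t)^N. *)
Lemma circle_avg_approx (a : nat -> Cplx R) (t B s : R) w N n :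
  (forall n, cmod (a n) * t ^+ n <= B) -> 0 <= s -> s < t ->
  N.-primitive_root w -> (n < N)%N ->
  cmod (circle_avg (psum a) w N n s - a n * rc s ^+ n) <=
    B / (1 - s / t) * (s / t) ^+ N.
Proof.
move=> aB s0 st pw nN; rewrite -(circle_avg_poly a s pw nN) -circle_avgB.
apply: circle_avg_le => // z zs.
by have := psum_tail N aB; rewrite -zs => h; rewrite mulrAC h// zs.
Qed.

(** The averages are bounded by [M] and tend to a_n s^n as the number of points grows. *)
Lemma cauchy_estimate (a : nat -> Cplx R) r s (M : R) : pconv a r -> 0 <= s -> s < r ->
  (forall z, cmod z = s -> cmod (psum a z) <= M) -> forall n, cmod (a n) * s ^+ n <= M.
Proof.
move=> ar s0 sr aM n; have st : s < (s + r) / 2 by lra.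
have [||B aB] := ar ((s + r) / 2); [by lra | by lra |].
have t0 := le_lt_trans s0 st.
apply/ler_addgt0Pr => e e0.
have [||N hN] := @geom_small _ (B / (1 - s / ((s + r) / 2))) (s / ((s + r) / 2)) e _ _ e0.
- by rewrite divr_ge0// ltW.
- by rewrite ltr_pdivrMr// mul1r.
have [w pw] := @prim_root_exists (maxn N n.+1) (leq_trans (ltn0Sn n) (leq_maxr _ _)).
have nN : (n < maxn N n.+1)%N by exact: leq_maxr.
have h := circle_avg_approx aB s0 st pw nN.
have -> : cmod (a n) * s ^+ n = cmod (a n * rc s ^+ n).
  by rewrite cmodM cmodX cmod_rc ger0_norm.
have := cmod_leD (a n * rc s ^+ n) (circle_avg (psum a) w (maxn N n.+1) n s).
move=> /le_trans; apply; rewrite addrC lerD//; first exact: circle_avg_le.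
by rewrite cmodBC (le_trans h)// ltW// hN// leq_maxl.
Qed.

Lemma psumB (a b : nat -> Cplx R) r z : pconv a r -> pconv b r -> cmod z < r ->
  psum (fun n => a n - b n) z = psum a z - psum b z.
Proof.
move=> ar br zr; rewrite /psum -mulN1r -csumZ; last exact: pconv_summ br zr.
rewrite -csumD; first by apply: eq_csum => n; rewrite mulrBl mulN1r.
- exact: pconv_summ ar zr.
- by apply: summZ; exact: pconv_summ br zr.
Qed.

Lemma pconvD (a b : nat -> Cplx R) r : pconv a r -> pconv b r -> pconv (fun n => a n + b n) r.
Proof.
move=> ar br s s0 sr; have [B aB] := ar s s0 sr; have [B' bB] := br s s0 sr.
exists (B + B') => n; apply: le_trans (lerD (aB n) (bB n)).
by rewrite -mulrDl ler_wpM2r ?exprn_ge0// cmodD.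
Qed.

Lemma pconvZ c (a : nat -> Cplx R) r : pconv a r -> pconv (fun n => c * a n) r.
Proof.
move=> ar s s0 sr; have [B aB] := ar s s0 sr.
by exists (cmod c * B) => n; rewrite cmodM -mulrA ler_wpM2l.
Qed.

Lemma pconvN (a : nat -> Cplx R) r : pconv a r -> pconv (fun n => - a n) r.
Proof.
by move=> ar s s0 sr; have [B aB] := ar s s0 sr; exists B => n; rewrite cmodN.
Qed.

(** Cauchy's estimate for the difference of the two series, with bound 0. *)
Lemma psum_inj (a b : nat -> Cplx R) r : 0 < r -> pconv a r -> pconv b r ->
  (forall z, cmod z < r -> psum a z = psum b z) -> a = b.
Proof.
move=> r0 ar br ab; apply/funext => n; apply/eqP; rewrite -subr_eq0 -cmod_eq0.
have := @cauchy_estimate (fun n => a n - b n) r (r / 2) 0 (pconvD ar (pconvN br)).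
have r20 : 0 < r / 2 by lra.
move=> /(_ (ltW r20)) /(_ _)/(_ _)/(_ n) H.
have {H} : cmod (a n - b n) * (r / 2) ^+ n <= 0.
  apply: H => [|z zr]; first by lra.
  by rewrite (@psumB _ _ r)// ?ab ?subrr ?cmod0// zr; lra.
by rewrite pmulr_lle0 ?exprn_gt0// => h; rewrite eq_le h cmod_ge0.
Qed.

End roots_of_unity.

(** * Complex differentiation, local expansions and compactness of disks *)

Section complex_derivative.
Variable R : realType.
Implicit Types (a : nat -> Cplx R) (z : Cplx R) (f : Cplx R -> Cplx R) (r : R).

Lemma nearC z (P : Cplx R -> Prop) : (\forall u \near z, P u) <->
  exists2 e : R, 0 < e & forall u, cmod (u - z) < e -> P u.
Proof.
split=> [/nbhs_ballP[e /= e0 h]|[e e0 h]].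
  exists (cmod e) => [|u ue]; first by rewrite cmod_gt0 gt_eqF.
  apply: h; rewrite /ball/= distrC cmodE -(gtr0_norm e0) cmodE lt_rc; exact: ue.
apply/nbhs_ballP; exists (rc e) => [|u]; first by rewrite /= -rc0 lt_rc.
by rewrite /ball/= distrC cmodE lt_rc; exact: h.
Qed.

Lemma psum0 a : psum a 0 = a 0%N.
Proof.
rewrite /psum (@csum_fin _ 1) => [|i i0]; first by rewrite big_ord1 expr0 mulr1.
by rewrite expr0n gtn_eqF// mulr0.
Qed.

Lemma dcoef0 a : dcoef 0 a = a.
Proof. by apply/funext => n; rewrite /dcoef addn0 bin0 mul1r. Qed.

Lemma dcoef1 a n : dcoef 1 a n = n.+1%:R * a n.+1.
Proof. by rewrite /dcoef addn1 bin1. Qed.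

(** Recentred at [z], the value at z + h is b_0 + b_1 h plus a remainder of order |h|^2, and b_1 is
    the claimed derivative. *)
Lemma derive1_psum f a r z : pconv a r -> cmod z < r ->
  (forall u, cmod u < r -> f u = psum a u) -> derive1 f z = psum (dcoef 1 a) z.
Proof.
move=> ar zr fa; pose b k := psum (dcoef k a) z.
have br : pconv b (r - cmod z) := pconv_recenter ar zr.
pose t := (r - cmod z) / 2; have t0 : 0 < t by rewrite /t; lra.
have [||B bB] := br t; [by rewrite ltW | by rewrite /t; lra |].
have B0 : 0 <= B by apply: le_trans (bB 0%N); rewrite mulr_ge0// exprn_ge0// ltW.
rewrite /derive1; apply: cvg_lim => //; apply/cvgrPdist_lt => e e0.
(* [t / 2] keeps the geometric factor 1 - |h| / t at least 1/2; the second bound makes 2 B |h| / t^2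
   smaller than the tolerance, the + 1 covering B = 0. *)
pose d := Num.min (t / 2) (cmod e * t ^+ 2 / (2 * B + 1)).
have e0' : 0 < cmod e by rewrite cmod_gt0 gt_eqF.
have d0 : 0 < d.
  by rewrite lt_min !divr_gt0 ?mulr_gt0 ?exprn_gt0//; lra.
near=> h.
have h0 : h != 0 by near: h; exact: nbhs_dnbhs_neq.
have : `|h| < rc d by near: h; apply: dnbhs0_lt; rewrite -rc0 lt_rc.
rewrite cmodE lt_rc lt_min => /andP[ht he].
have zhr : cmod z + cmod h < r by move: ht; rewrite /t; lra.
have zr' : cmod (z + h) < r := le_lt_trans (cmodD _ _) zhr.
rewrite [h + z]addrC /= (fa _ zr') (fa _ zr) (psum_recenter ar zhr).
have -> : psum a z = b 0%N by rewrite /b dcoef0.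
rewrite -(gtr0_norm e0) !cmodE lt_rc -/b cmodBC.
have h0' : 0 < cmod h by rewrite cmod_gt0.
have := @psum_tail _ b t B h 2 bB (lt_trans ht _); rewrite !big_ord_recr big_ord0/=.
rewrite add0r expr0 mulr1 expr1 => H.
have {}H : cmod (psum b h - (b 0%N + b 1%N * h)) <= 2 * B / t ^+ 2 * cmod h ^+ 2.
  apply: le_trans (H _) _; first lra.
  have q : cmod h / t <= 1 / 2 by rewrite ler_pdivrMr//; lra.
  rewrite expr_div_n ler_pdivrMr; last lra.
  have -> : 2 * B / t ^+ 2 * cmod h ^+ 2 * (1 - cmod h / t) =
            B * (cmod h ^+ 2 / t ^+ 2) * (2 * (1 - cmod h / t)) by ring.
  rewrite -[leLHS]mulr1 ler_wpM2l//; last lra.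
  by rewrite mulr_ge0// divr_ge0// exprn_ge0// ltW.
have -> : h^-1 *: (psum b h - b 0%N) - b 1%N = h^-1 * (psum b h - (b 0%N + b 1%N * h)).
  by rewrite -[_ *: _]/(h^-1 * _) opprD addrA [in RHS]mulrBr [b 1%N * h]mulrC mulKf.
rewrite cmodM cmodV mulrC ltr_pdivrMr// (le_lt_trans H)// [cmod h ^+ 2]expr2 mulrA ltr_pM2r//.
move: he; rewrite ltr_pdivlMr; last lra.
move=> he; rewrite mulrAC ltr_pdivrMr ?exprn_gt0//; apply: le_lt_trans he.
by rewrite mulrC ler_wpM2l//; lra.
Unshelve. all: by end_near. Qed.

Lemma unit_diskE z : unit_disk z <-> cmod z < 1.
Proof. by rewrite /unit_disk /= cmodE -rc1 lt_rc. Qed.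

Lemma cvg_terms_bounded (a : nat -> Cplx R) (l : Cplx R) :
  (fun n => \sum_(i < n) a i) @ \oo --> l -> exists B : R, forall n, cmod (a n) <= B.
Proof.
move=> /cvgC/(_ 1 ltr01)[n0 h]; exists (2 + \sum_(i < n0) cmod (a i)) => n.
have [nn0|n0n] := ltnP n n0.
  rewrite (bigD1 (Ordinal nn0))//= addrCA lerDl addr_ge0//.
  by apply: sumr_ge0.
have -> : a n = (\sum_(i < n.+1) a i - l) - (\sum_(i < n) a i - l).
  by rewrite opprB addrA subrK big_ord_recr/= [X in X - _]addrC addrK.
rewrite (le_trans (cmodB _ _))// -[leLHS]addr0 lerD ?sumr_ge0//.
have := h _ n0n; have := h _ (leqW n0n); lra.
Qed.

Lemma local_power_series (U : set (Cplx R)) f z0 : analytic_on U f -> U z0 ->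
  exists a r, [/\ 0 < r, pconv a r & forall h, cmod h < r -> f (z0 + h) = psum a h].
Proof.
move=> fU Uz0; have [a /nearC[r r0 ar]] := fU _ Uz0.
have cv h : cmod h < r -> (fun n => \sum_(i < n) a i * h ^+ i) @ \oo --> f (z0 + h).
  move=> hr; have := ar (z0 + h); rewrite [z0 + h]addrC addrK => /(_ hr).
  by rewrite seriesEord.
exists a, r; split => //.
  move=> s s0 sr; have sr' : cmod (rc s) < r by rewrite cmod_rc ger0_norm.
  have [B hB] := @cvg_terms_bounded (fun n => a n * rc s ^+ n) _ (cv _ sr').
  by exists B => n; have := hB n; rewrite cmodM cmodX cmod_rc ger0_norm.
by move=> h /cv ch; rewrite /psum (@csum_unique _ (fun n => a n * h ^+ n) _ ch).
Qed.

Lemma psum_analytic f a : pconv a 1 -> (forall z, cmod z < 1 -> f z = psum a z) ->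
  analytic_on (@unit_disk R) f.
Proof.
move=> a1 fa z0 /unit_diskE z01; exists (fun k => psum (dcoef k a) z0).
apply/nearC; exists (1 - cmod z0) => [|u uz0]; first by rewrite subr_gt0.
have uz1 : cmod z0 + cmod (u - z0) < 1 by lra.
rewrite seriesEord fa; last first.
  by rewrite -(subrK z0 u) addrC (le_lt_trans (cmodD _ _)).
rewrite -{2}[u](subrKC z0) (psum_recenter a1 uz1); apply: csumP.
exact: pconv_summ (pconv_recenter a1 z01) uz0.
Qed.

(** Compactness is that of a square in [R * R]. Near a point of the square outside the closed disk
    the claim is vacuous, the complement of the disk being open. *)
Lemma closed_disk_uniform (rho : R) (P : nat -> Cplx R -> Prop) :
  (forall z, cmod z <= rho -> exists2 d : R, 0 < d & exists n0, forall n, (n0 <= n)%N ->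
    forall u, cmod (u - z) < d -> P n u) ->
  exists n, forall z, cmod z <= rho -> P n z.
Proof.
move=> h; pose K := `[- rho, rho] `*` `[- rho, rho].
have /compact_near_coveringP cK : compact K by apply: compact_setX; exact: segment_compact.
pose Q n (p : R * R) := cmod (pt p) <= rho -> P n (pt p).
have dist (p q : R * R) e : ball p e q -> cmod (pt q - pt p) < e + e.
  move=> [/= b1 b2]; apply: le_lt_trans (cmod_le_ReIm _) _.
  by rewrite ReD ReN ImD ImN /= ltrD// distrC.
have /(cK _ \oo Q _)[n0 _ /(_ n0 (leqnn _)) hn0] : forall p, K p ->
    \forall p' \near p & n \near \oo, Q n p'.
  move=> p _; have [pr|pr] := leP (cmod (pt p)) rho; last first.
    have d0 : 0 < (cmod (pt p) - rho) / 2 by lra.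
    exists (ball p ((cmod (pt p) - rho) / 2), setT) => [|[q n] [/= /dist qp _]].
      by split; [exact: nbhsx_ballx | exact: filterT].
    have := cmod_leD (pt p) (pt q); rewrite /Q cmodBC; lra.
  have [d d0 [n0 hn0]] := h _ pr.
  exists (ball p (d / 2), [set n | (n0 <= n)%N]) => [|[q n] [/= /dist qp n0n] _].
    by split; [apply: nbhsx_ballx; lra | exists n0].
  by apply: hn0 => //; rewrite [d]splitr.
exists n0 => z zr; have := hn0 (complex.Re z, complex.Im z).
rewrite /Q /pt /=; case: z zr => x y /= zr; apply => //.
by split; rewrite /= in_itv/= -ler_norml (le_trans _ zr)//
  ?(Re_le_cmod (x +i* y)%C) ?(Im_le_cmod (x +i* y)%C).
Qed.
End complex_derivative.

(** * Taylor expansion on the unit disk *)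

Section taylor.
Variable R : realType.
Implicit Types (a b : nat -> Cplx R) (z : Cplx R) (f : Cplx R -> Cplx R) (r : R).

Lemma psum_le a r s : pconv a r -> 0 <= s -> s < r ->
  exists2 B : R, 0 <= B & forall z, cmod z <= s -> cmod (psum a z) <= B.
Proof.
move=> ar s0 sr; have [B aB] := pconv_sum ar s0 sr; exists B.
  by have := aB 0%N; rewrite big_ord0.
move=> z zs; apply: csum_bound => n; apply: le_trans (aB n).
apply: ler_sum => i _; rewrite cmodM cmodX ler_wpM2l//.
by apply: lerXn2r => //; rewrite ?nnegrE.
Qed.

(** Each of the n + 1 terms of the geometric sum is at least q^n. *)
Lemma linear_geom_le (q : R) n : 0 <= q -> q < 1 -> n.+1%:R * q ^+ n <= (1 - q)^-1.
Proof.
move=> q0 q1; apply: le_trans (geom_sum_le n.+1 q0 q1).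
rewrite mulr_natl -[X in _ *+ X]card_ord -sumr_const; apply: ler_sum => i _.
by apply: ler_wiXn2l => //; [exact: ltW | rewrite -ltnS].
Qed.

(* The k-th Taylor coefficient at u is bounded by M / d ^ k uniformly on
   |u| < rho, and is itself a power series in u of radius rho; applying
   Cauchy's estimate a second time gives 'C(n + k, k) |a_(n + k)| t^n s^k <= M,
   hence a bound on |a_l| (t + s)^l, linear in l. *)
Lemma radius_extension a rho d (M : R) : 0 < rho -> 0 < d -> pconv a rho ->
  (forall z, cmod z < rho -> pconv (fun k => psum (dcoef k a) z) d /\
    forall h, cmod h < d -> cmod (psum (fun k => psum (dcoef k a) z) h) <= M) ->
  pconv a (rho + d).
Proof.
move=> rho0 d0 ar H.
have M0 : 0 <= M.
  have [|_ h] := H 0; first by rewrite cmod0.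
  by apply: le_trans (h 0 _); rewrite ?cmod0.
have key n k (s t : R) : 0 <= t -> t < rho -> 0 < s -> s < d ->
    ('C(n + k, k))%:R * cmod (a (n + k)%N) * t ^+ n * s ^+ k <= M.
  move=> t0 trho s0 sd.
  have h z : cmod z = t -> cmod (psum (dcoef k a) z) <= M / s ^+ k.
    move=> zt; have [|pc pM] := H z; first by rewrite zt.
    rewrite ler_pdivlMr ?exprn_gt0//.
    by apply: (cauchy_estimate pc (ltW s0) sd) => u us; apply: pM; rewrite us.
  have := cauchy_estimate (pconv_dcoef k ar) t0 trho h n.
  by rewrite ler_pdivlMr ?exprn_gt0// /dcoef cmodM cmod_nat.
have key2 l (s t : R) : 0 <= t -> t < rho -> 0 < s -> s < d ->
    cmod (a l) * (t + s) ^+ l <= l.+1%:R * M.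
  move=> t0 trho s0 sd; rewrite exprDn mulr_sumr mulr_natl.
  rewrite -[X in _ *+ X]card_ord -sumr_const; apply: ler_sum => i _.
  have il : (i <= l)%N by rewrite -ltnS.
  have := key (l - i)%N i s t t0 trho s0 sd; rewrite subnK//.
  by apply: le_trans; rewrite -[X in cmod _ * X]mulr_natl !mulrA [cmod _ * _]mulrC.
move=> x x0 xrd.
(* With 4 e <= rho + d - x the radius y = rho + d - 2 e still exceeds x, and (x / y)^l absorbs the
   factor l + 1. *)
pose e := Num.min rho (Num.min d ((rho + d - x) / 2)) / 2.
have [e0 e1 e2 e3] : [/\ 0 < e, e < rho, e < d & 4 * e <= rho + d - x].
  rewrite /e; set m1 := Num.min d _; set m := Num.min rho m1.
  have : m <= rho by rewrite ge_min lexx.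
  have : m <= m1 by rewrite ge_min lexx orbT.
  have : m1 <= d by rewrite ge_min lexx.
  have : m1 <= (rho + d - x) / 2 by rewrite ge_min lexx orbT.
  have : 0 < m by rewrite !lt_min rho0 d0/=; lra.
  by move=> ? ? ? ? ?; split; lra.
pose y := (rho - e) + (d - e).
have xy : x < y by rewrite /y; lra.
have y0 := le_lt_trans x0 xy.
exists (M / (1 - x / y)) => l.
have q0 : 0 <= x / y by rewrite divr_ge0// ltW.
have q1 : x / y < 1 by rewrite ltr_pdivrMr// mul1r.
have := key2 l (d - e) (rho - e) _ _ _ _; rewrite -/y => /(_ _ _ _ _)/le_trans h.
have -> : x ^+ l = y ^+ l * (x / y) ^+ l.
  by rewrite expr_div_n mulrC divfK// gt_eqF// exprn_gt0.
rewrite mulrA (@le_trans _ _ (l.+1%:R * M * (x / y) ^+ l))//.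
  by rewrite ler_wpM2r ?exprn_ge0//; apply: h; lra.
by rewrite mulrAC mulrC ler_wpM2l// linear_geom_le.
Qed.

(** One integer serves both as bound for [f] and, through 1 / (n + 1), as radius, so that the
    compactness argument runs over a single index. *)
Lemma local_uniform f (rho : R) : analytic_on (@unit_disk R) f -> rho < 1 ->
  exists n : nat, forall z, cmod z <= rho -> exists2 b, pconv b n.+1%:R^-1 &
    forall h, cmod h < n.+1%:R^-1 -> f (z + h) = psum b h /\ cmod (f (z + h)) <= n%:R.
Proof.
move=> fa rho1; apply: closed_disk_uniform => z zrho.
have /unit_diskE z1 : cmod z < 1 := le_lt_trans zrho rho1.
have [b [r [r0 br fb]]] := local_power_series fa z1.
exists (r / 4); first lra.
have [||B B0 hB] := @psum_le b r (r / 2) br; [lra | lra |].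
have B'0 : 0 <= 4 / r by rewrite divr_ge0// ltW.
exists (maxn (Num.bound B) (Num.bound (4 / r))) => n; rewrite geq_max => /andP[nB nr] u uz.
have {}nr : n.+1%:R^-1 < r / 4.
  rewrite -[r / 4]invrK ltf_pV2 ?posrE ?invr_gt0 ?divr_gt0// invf_div.
  apply: lt_le_trans (archi_boundP B'0) _.
  by rewrite ler_nat (leq_trans nr).
have {}nB : B <= n%:R.
  by rewrite ltW// (lt_le_trans (archi_boundP B0))// ler_nat.
exists (fun k => psum (dcoef k b) (u - z)).
  have ur : cmod (u - z) < r by lra.
  by apply: pconv_le (pconv_recenter br ur); apply: le_trans (ltW nr) _; lra.
move=> h hn.
have {}hn := lt_trans hn nr; have uzh : cmod (u - z) + cmod h < r by lra.
have e : u + h = z + (u - z + h) by rewrite addrA subrKC.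
rewrite e fb; last exact: le_lt_trans (cmodD _ _) uzh.
split; first exact: psum_recenter br uzh.
by apply: le_trans nB; apply: hB; apply: le_trans (cmodD _ _) _; lra.
Qed.

(** Let [rho] be the supremum of the radii, at most 1, on which the expansion at 0 converges to [f].
    If rho < 1, compactness of the closed disk of radius rho yields local expansions with a common
    radius d and a common bound, and [radius_extension] then pushes the radius to rho + d. *)
Theorem taylor_disk f : analytic_on (@unit_disk R) f ->
  exists2 a, pconv a 1 & forall z, cmod z < 1 -> f z = psum a z.
Proof.
move=> fa.
have [|a [r [r0 ar far]]] := local_power_series fa (_ : unit_disk 0).
  by apply/unit_diskE; rewrite cmod0.
have {}far h : cmod h < r -> f h = psum a h by move=> /far; rewrite add0r.
pose S := [set s : R | [/\ 0 < s, s <= 1, pconv a s & forall z, cmod z < s -> f z = psum a z]].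
have Sr : S (Num.min r 1).
  split; rewrite ?lt_min ?r0 ?ge_min ?lexx ?ltr01 ?orbT//.
    by apply: pconv_le ar; rewrite ge_min lexx.
  by move=> z; rewrite lt_min => /andP[/far].
have hs : has_sup S by split; [exists (Num.min r 1) | exists 1 => s []].
pose rho := sup S.
have below s : s < rho -> exists2 s', S s' & s < s'.
  by move=> srho; have [s' ? ?] := sup_gt hs.1 srho; exists s'.
have rho0 : 0 < rho.
  by have [? _ _ _] := Sr; apply: lt_le_trans (ub_le_sup hs.2 Sr).
have arho : pconv a rho.
  by move=> s s0 /below[s' [_ _ h _] /(h _ s0)].
have frho z : cmod z < rho -> f z = psum a z by move=> /below[s' [_ _ _ h] /h].
have [rho1|rho1] := leP 1 rho.
  exists a; first exact: pconv_le arho.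
  by move=> z z1; apply: frho; exact: lt_le_trans rho1.
exfalso.
have [n hn] := local_uniform fa rho1.
pose d : R := n.+1%:R^-1; have d0 : 0 < d by rewrite invr_gt0.
have loc z : cmod z < rho -> pconv (fun k => psum (dcoef k a) z) d /\
    forall h, cmod h < d -> f (z + h) = psum (fun k => psum (dcoef k a) z) h /\
      cmod (f (z + h)) <= n%:R.
  move=> zrho; have [b bd fb] := hn z (ltW zrho).
  (* Both series represent [f] near [z], so they agree by uniqueness on the smaller of the two
     disks. *)
  suff <- : b = fun k => psum (dcoef k a) z by [].
  apply: (@psum_inj _ _ _ (Num.min d (rho - cmod z))).
  - by rewrite lt_min d0 subr_gt0.
  - by apply: pconv_le bd; rewrite ge_min lexx.
  - by apply: pconv_le (pconv_recenter arho zrho); rewrite ge_min lexx orbT.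
  move=> h; rewrite lt_min => /andP[/fb[<- _] hr].
  have zh : cmod z + cmod h < rho by lra.
  by rewrite -(psum_recenter arho zh) frho// (le_lt_trans (cmodD _ _)).
have aext : pconv a (rho + d).
  apply: (radius_extension (M := n%:R) rho0 d0 arho) => z zrho.
  by have [? h] := loc z zrho; split=> // u /h[<- ].
have fext z : cmod z < rho + d -> f z = psum a z.
  move=> zrd; have rd0 : 0 < rho + d by lra.
  (* The point [tau z] divides the segment from 0 to z in the ratio rho : d; it is within rho of 0
     and within d of z, so the local expansion there reaches z. *)
  pose tau := rho / (rho + d).
  have tau0 : 0 < tau by rewrite divr_gt0.
  have tau1 : 1 - tau = d / (rho + d) by rewrite /tau; field; lra.
  have tau1' : 0 < 1 - tau by rewrite tau1 divr_gt0.
  have e1 : cmod (rc tau * z) = tau * cmod z by rewrite cmodM cmod_rc gtr0_norm.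
  have e2 : cmod (z - rc tau * z) = (1 - tau) * cmod z.
    rewrite -{1}[z]mul1r -mulrBl cmodM -rc1 -rcN -rcD cmod_rc gtr0_norm//.
  have l1 : cmod (rc tau * z) < rho by rewrite e1 mulrAC ltr_pdivrMr// ltr_pM2l.
  have l2 : cmod (z - rc tau * z) < d by rewrite e2 tau1 mulrAC ltr_pdivrMr// ltr_pM2l.
  have [_ /(_ _ l2)[]] := loc _ l1; rewrite subrKC => -> _.
  rewrite -[in RHS](subrKC (rc tau * z) z) -(@psum_recenter _ a (rho + d))//.
  by rewrite e1 e2 -mulrDl subrKC mul1r.
have : S (Num.min 1 (rho + d)).
  split; rewrite ?ge_min ?lexx ?lt_min ?ltr01 ?addr_gt0//.
    by apply: pconv_le aext; rewrite ge_min lexx orbT.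
  by move=> z; rewrite lt_min => /andP[_ /fext].
move=> /(ub_le_sup hs.2); rewrite leNgt lt_min rho1 ltrDl d0//.
Qed.

End taylor.

(** * Integrals over disks *)

Definition disk_of (R : realType) (r : R) : set (R * R) :=
  [set p | p.1 ^+ 2 + p.2 ^+ 2 < r ^+ 2].

Notation leb2 R := ((@lebesgue_measure R) \x (@lebesgue_measure R))%E.

Section disk_measure.
Variable R : realType.
Implicit Types (r x y : R).
Local Notation mu := (@lebesgue_measure R).

Lemma measurable_disk_of r : measurable (disk_of r).
Proof.
have mf : measurable_fun setT (fun p : R * R => p.1 ^+ 2 + p.2 ^+ 2).
  by apply: measurable_funD; apply: measurable_funX; [exact: measurable_fst | exact: measurable_snd].
have := mf measurableT _ (@measurable_itv R (Interval (BInfty _ true) (BLeft (r ^+ 2)))).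
by rewrite setTI; congr measurable; apply/seteqP; split => p /=; rewrite in_itv/=.
Qed.

(** [Num.sqrt] is 0 on negative numbers, so a line that misses the disk gets an empty open chord. *)
Definition half_chord r y : R := Num.sqrt (r ^+ 2 - y ^+ 2).

Lemma half_chordP r x y : (x ^+ 2 + y ^+ 2 < r ^+ 2) = (- half_chord r y < x < half_chord r y).
Proof.
rewrite -ltr_norml -ltrBrDr -sqrtr_sqr /half_chord.
have [h|h] := ltP 0 (r ^+ 2 - y ^+ 2); first by rewrite ltr_sqrt.
rewrite (ler0_sqrtr h) ltNge (le_trans h (sqr_ge0 x))/=.
by rewrite ltNge sqrtr_ge0.
Qed.

Lemma xsection_disk r x : xsection (disk_of r) x = `](- half_chord r x), (half_chord r x)[%classic.
Proof.
by apply/seteqP; split => y; rewrite /xsection/= inE /disk_of/= addrC half_chordP in_itv.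
Qed.

Lemma half_chord_out r x : r <= `|x| -> 0 <= r -> half_chord r x = 0.
Proof.
move=> rx r0; rewrite /half_chord ler0_sqrtr// subr_le0 -[x ^+ 2]real_normK ?num_real//.
by apply: lerXn2r; rewrite ?nnegrE.
Qed.

Lemma FTC_global (F f : R -> R) a b : (forall x : R, is_derive x 1 F (f x)) ->
  continuous f -> a < b -> (\int[mu]_(x in `[a, b]) (f x)%:E = (F b - F a)%:E)%E.
Proof.
move=> dF cf ab; have cF : continuous F.
  by move=> t; apply: differentiable_continuous; apply/derivable1_diffP.
rewrite (continuous_FTC2 ab (continuous_subspaceT cf) (F := F)) ?EFinB//.
  split; [by move=> t _; apply: ex_derive | exact: cvg_at_right_filter (cF _)
    | exact: cvg_at_left_filter (cF _)].
by move=> t _; rewrite derive1E derive_val.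
Qed.

(** The sections have length 2 [half_chord]; the substitution x = r sin t turns the integrand into 2
    r^2 cos^2 t, with primitive r^2 (t + sin t cos t). *)
Lemma lebesgue_disk r : 0 < r -> leb2 R (disk_of r) = (pi * r ^+ 2)%:E.
Proof.
move=> r0; rewrite /product_measure1.
transitivity (\int[mu]_(x in `[(- r)%R, r]) (2 * half_chord r x)%:E)%E.
  rewrite [RHS]integral_mkcond; apply: eq_integral => x _.
  rewrite /= xsection_disk lebesgue_measure_itv/= lte_fin patchE.
  case: ifPn; case: ifPn => //.
  - by move=> _ _; rewrite -EFinD; congr EFin; lra.
  - rewrite notin_setE/= in_itv/= -ler_norml => /negP; rewrite -ltNge => rx.
    by rewrite (half_chord_out (ltW rx) (ltW r0)) oppr0 ltxx.
  - rewrite -leNgt => _ h; have := sqrtr_ge0 (r ^+ 2 - x ^+ 2); rewrite -/(half_chord r x) => h'.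
    congr EFin; move: (half_chord r x : R) h h' => s h h'; lra.
have p2 : - (pi / 2) < pi / 2 :> R by have := @pi_gt0 R; lra.
pose F t := r * sin t.
have dF (t : R) : is_derive t 1 F (r * cos t).
  by rewrite /F; apply: is_derive_eq; rewrite /GRing.scale/=; ring.
have F'E : F^`() = fun t => r * cos t.
  by apply/funext => t; rewrite derive1E derive_val.
have cF' : continuous F^`().
  by rewrite F'E => t; apply: cvgM; [exact: cvg_cst | exact: continuous_cos].
have cF : continuous F.
  by move=> t; apply: differentiable_continuous; apply/derivable1_diffP.
have FE : F (pi / 2) = r by rewrite /F sin_pihalf mulr1.
have FNE : F (- (pi / 2)) = - r by rewrite /F sinN sin_pihalf mulrN1.
have := @integration_by_substitution_increasing _ F (fun x => 2 * half_chord r x) _ _ (ltW p2).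
rewrite FE FNE => ->.
- rewrite F'E; transitivity (\int[mu]_(t in `[(- (pi / 2))%R, (pi / 2)%R])
      (2 * r ^+ 2 * cos t ^+ 2)%:E)%E; last first.
    have dG (t : R) : is_derive t 1 (fun t => r ^+ 2 * (t + sin t * cos t)) (2 * r ^+ 2 * cos t ^+ 2).
      apply: is_derive_eq; rewrite /GRing.scale/=.
      have := cos2Dsin2 t; move: (cos t) (sin t) => c s cs; rewrite -[X in X + _]cs; ring.
    rewrite (FTC_global dG _ p2).
      rewrite sinN cosN cos_pihalf; congr EFin; by field.
    by move=> t; apply: cvgM; [exact: cvg_cst | apply: cvgM; exact: continuous_cos].
  apply: eq_integral => t; rewrite inE/= in_itv/= => /andP[t1 t2]; congr EFin.
  rewrite -[LHS]/(2 * half_chord r (r * sin t) * (r * cos t)).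
  rewrite /half_chord exprMn -{1}[r ^+ 2]mulr1 -mulrBr -cos2sin2.
  rewrite sqrtrM ?sqr_ge0// !sqrtr_sqr (gtr0_norm r0) ger0_norm; last first.
    by apply: cos_ge0_pihalf; rewrite t1 t2.
  by rewrite !expr2; ring.
- by move=> t u tI uI tu; rewrite /F ltr_pM2l// ltr_sin.
- by move=> t _; exact: cF'.
- by apply/cvg_ex; exists (F^`() (- (pi / 2))); apply: cvg_at_right_filter; exact: cF'.
- by apply/cvg_ex; exists (F^`() (pi / 2)); apply: cvg_at_left_filter; exact: cF'.
- split; [by move=> t _; apply: ex_derive | exact: cvg_at_right_filter (cF _)
    | exact: cvg_at_left_filter (cF _)].
- apply: continuous_subspaceT => x; apply: cvgM; first exact: cvg_cst.
  apply: (@continuous_comp _ _ _ (fun x => r ^+ 2 - x ^+ 2) (@Num.sqrt R)).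
    by apply: cvgB; [exact: cvg_cst | exact: exprn_continuous].
  exact: sqrt_continuous.
Qed.
End disk_measure.

(** * Complex functions of a real variable *)

Section complex_curves.
Variable R : realType.
Implicit Types (w v : R -> Cplx R) (t : R).

(** Componentwise, because the integrals that use it are those of the real and the imaginary
    part. *)
Definition cderiv w t (d : Cplx R) : Prop :=
  is_derive t 1 (fun u => complex.Re (w u)) (complex.Re d) /\
  is_derive t 1 (fun u => complex.Im (w u)) (complex.Im d).

Lemma cderiv_cst c t : cderiv (fun=> c) t 0.
Proof. by split; exact: is_derive_cst. Qed.

Lemma cderivD w v t d e : cderiv w t d -> cderiv v t e ->
  cderiv (fun u => w u + v u) t (d + e).
Proof.
move=> [d1 d2] [e1 e2]; split; [rewrite ReD|rewrite ImD].
- under eq_fun do rewrite ReD; exact: is_deriveD.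
- under eq_fun do rewrite ImD; exact: is_deriveD.
Qed.

Lemma cderivM w v t d e : cderiv w t d -> cderiv v t e ->
  cderiv (fun u => w u * v u) t (d * v t + w t * e).
Proof.
move=> [d1 d2] [e1 e2]; split.
- have -> : (fun u => complex.Re (w u * v u)) =
    (fun u => complex.Re (w u)) * (fun u => complex.Re (v u)) -
    (fun u => complex.Im (w u)) * (fun u => complex.Im (v u)).
    by apply/funext => u; rewrite ReM.
  apply: is_derive_eq; rewrite /GRing.scale/= ReD !ReM; ring.
- have -> : (fun u => complex.Im (w u * v u)) =
    (fun u => complex.Re (w u)) * (fun u => complex.Im (v u)) +
    (fun u => complex.Im (w u)) * (fun u => complex.Re (v u)).
    by apply/funext => u; rewrite ImM.
  apply: is_derive_eq; rewrite /GRing.scale/= ImD !ImM; ring.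
Qed.

Lemma cderivX w t d n : cderiv w t d ->
  cderiv (fun u => w u ^+ n) t (n%:R * w t ^+ n.-1 * d).
Proof.
move=> wd; elim: n => [|n IH].
  by rewrite !mul0r; under eq_fun do rewrite expr0; exact: cderiv_cst.
under eq_fun do rewrite exprS.
have := cderivM wd IH; congr cderiv; rewrite /=.
case: n {IH} => [|n]; first by rewrite /= !expr0; ring.
by rewrite /= -[n.+2%:R]natr1 exprS; ring.
Qed.

Lemma cderivZ c w t d : cderiv w t d -> cderiv (fun u => c * w u) t (c * d).
Proof.
by move=> wd; have := cderivM (cderiv_cst c t) wd; rewrite mul0r add0r.
Qed.

Lemma cderiv_conj w t d : cderiv w t d -> cderiv (fun u => (w u)^*) t d^*.
Proof.
move=> [d1 d2]; split.
- by rewrite Re_conj; under eq_fun do rewrite Re_conj.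
- by rewrite Im_conj; under eq_fun do rewrite Im_conj; exact: is_deriveN.
Qed.

Definition cdiff w := forall t, exists d, cderiv w t d.

Lemma cdiff_continuous w : cdiff w ->
  continuous (fun u => complex.Re (w u)) /\ continuous (fun u => complex.Im (w u)).
Proof.
by move=> wd; split=> t; have [d [d1 d2]] := wd t;
  apply: differentiable_continuous; apply/derivable1_diffP; apply: ex_derive.
Qed.

Lemma cdiff_cst c : cdiff (fun=> c).
Proof. by move=> t; exists 0; exact: cderiv_cst. Qed.

Lemma cdiffD w v : cdiff w -> cdiff v -> cdiff (fun t => w t + v t).
Proof.
move=> wd vd t; have [d hd] := wd t; have [e he] := vd t.
by exists (d + e); exact: cderivD hd he.
Qed.

Lemma cdiffM w v : cdiff w -> cdiff v -> cdiff (fun t => w t * v t).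
Proof.
move=> wd vd t; have [d hd] := wd t; have [e he] := vd t.
by exists (d * v t + w t * e); exact: cderivM hd he.
Qed.

Lemma cdiffX w n : cdiff w -> cdiff (fun t => w t ^+ n).
Proof. by move=> wd t; have [d hd] := wd t; exists (n%:R * w t ^+ n.-1 * d); exact: cderivX. Qed.

Lemma cdiff_conj w : cdiff w -> cdiff (fun t => (w t)^*).
Proof. by move=> wd t; have [d hd] := wd t; exists d^*; exact: cderiv_conj. Qed.

Lemma cderiv_ptx x y : cderiv (fun u => pt (u, y)) x 1.
Proof. by split; [exact: is_derive_id | exact: is_derive_cst]. Qed.

Lemma cderiv_pty x y : cderiv (fun u => pt (x, u)) y (pt (0, 1)).
Proof. by split; [exact: is_derive_cst | exact: is_derive_id]. Qed.
End complex_curves.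

(** * Bounded measurable complex functions on a disk *)

Section disk_integral.
Variable R : realType.
Local Notation mu := (@lebesgue_measure R).
Implicit Types (F G : R * R -> Cplx R) (f : R * R -> R) (r : R).

Definition cmeas (D : set (R * R)) F : Prop :=
  measurable_fun D (fun p => complex.Re (F p)) /\ measurable_fun D (fun p => complex.Im (F p)).

Lemma cmeas_cst D c : cmeas D (fun=> c).
Proof. by split; exact: measurable_cst. Qed.

Lemma cmeasD D F G : cmeas D F -> cmeas D G -> cmeas D (fun p => F p + G p).
Proof.
move=> [F1 F2] [G1 G2]; split.
- by under eq_fun do rewrite ReD; exact: measurable_funD.
- by under eq_fun do rewrite ImD; exact: measurable_funD.
Qed.

Lemma cmeasM D F G : cmeas D F -> cmeas D G -> cmeas D (fun p => F p * G p).
Proof.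
move=> [F1 F2] [G1 G2]; split.
- under eq_fun do rewrite ReM; apply: measurable_funB; exact: measurable_funM.
- under eq_fun do rewrite ImM; apply: measurable_funD; exact: measurable_funM.
Qed.

Lemma cmeasX D F n : cmeas D F -> cmeas D (fun p => F p ^+ n).
Proof.
move=> mF; elim: n => [|n IH].
  by under eq_fun do rewrite expr0; exact: cmeas_cst.
by under eq_fun do rewrite exprS; exact: cmeasM.
Qed.

Lemma cmeas_sum D n (F : nat -> R * R -> Cplx R) : (forall i, cmeas D (F i)) ->
  cmeas D (fun p => \sum_(i < n) F i p).
Proof.
move=> mF; elim: n => [|n IH].
  by under eq_fun do rewrite big_ord0; exact: cmeas_cst.
by under eq_fun do rewrite big_ord_recr/=; exact: cmeasD.
Qed.

Lemma cmeas_conj D F : cmeas D F -> cmeas D (fun p => (F p)^*).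
Proof.
move=> [F1 F2]; split; first by under eq_fun do rewrite Re_conj.
by under eq_fun do rewrite Im_conj; exact: measurable_funN.
Qed.

Lemma cmeas_pt D : cmeas D (@pt R).
Proof. by split; apply: measurable_funTS; [exact: measurable_fst | exact: measurable_snd]. Qed.

Definition bounded_on (D : set (R * R)) F := exists B : R, forall p, D p -> cmod (F p) <= B.

Lemma bounded_on_cst D c : bounded_on D (fun=> c).
Proof. by exists (cmod c). Qed.

Lemma bounded_onD D F G : bounded_on D F -> bounded_on D G -> bounded_on D (fun p => F p + G p).
Proof.
move=> [B hB] [B' hB']; exists (B + B') => p Dp.
by rewrite (le_trans (cmodD _ _))// lerD ?hB ?hB'.
Qed.

Lemma bounded_onM D F G : bounded_on D F -> bounded_on D G -> bounded_on D (fun p => F p * G p).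
Proof.
move=> [B hB] [B' hB']; exists (B * B') => p Dp.
by rewrite cmodM ler_pM ?hB ?hB'.
Qed.

Lemma bounded_onX D F n : bounded_on D F -> bounded_on D (fun p => F p ^+ n).
Proof.
move=> bF; elim: n => [|n IH].
  by under eq_fun do rewrite expr0; exact: bounded_on_cst.
by under eq_fun do rewrite exprS; exact: bounded_onM.
Qed.

Lemma bounded_on_sum D n (F : nat -> R * R -> Cplx R) : (forall i, bounded_on D (F i)) ->
  bounded_on D (fun p => \sum_(i < n) F i p).
Proof.
move=> mF; elim: n => [|n IH].
  by under eq_fun do rewrite big_ord0; exact: bounded_on_cst.
by under eq_fun do rewrite big_ord_recr/=; exact: bounded_onD.
Qed.

Lemma bounded_on_conj D F : bounded_on D F -> bounded_on D (fun p => (F p)^*).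
Proof. by move=> [B hB]; exists B => p /hB; rewrite cmodC. Qed.

Lemma cmod_pt (p : R * R) : cmod (pt p) ^+ 2 = p.1 ^+ 2 + p.2 ^+ 2.
Proof. by rewrite cmodK. Qed.

Lemma disk_ofP r p : 0 < r -> disk_of r p <-> cmod (pt p) < r.
Proof.
move=> r0; rewrite /disk_of/= -cmod_pt ltr_pXn2r// ?nnegrE//; exact: ltW.
Qed.

Lemma bounded_on_pt r : 0 < r -> bounded_on (disk_of r) (@pt R).
Proof. by move=> r0; exists r => p /(disk_ofP _ r0)/ltW. Qed.

Lemma integrable_disk r F : 0 < r -> cmeas (disk_of r) F -> bounded_on (disk_of r) F ->
  (leb2 R).-integrable (disk_of r) (EFin \o (fun p => complex.Re (F p))) /\
  (leb2 R).-integrable (disk_of r) (EFin \o (fun p => complex.Im (F p))).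
Proof.
move=> r0 [mF1 mF2] [B hB].
have fin : (leb2 R (disk_of r) < +oo)%E by rewrite lebesgue_disk// ltry.
split; apply: measurable_bounded_integrable => //; try exact: measurable_disk_of.
- exists B; split; first exact: num_real.
  by move=> M BM p /= /hB h; rewrite (le_trans (Re_le_cmod _))// (le_trans h)// ltW.
- exists B; split; first exact: num_real.
  by move=> M BM p /= /hB h; rewrite (le_trans (Im_le_cmod _))// (le_trans h)// ltW.
Qed.

End disk_integral.

(** * Green's identity along chords *)

Section green.
Variable R : realType.
Local Notation mu := (@lebesgue_measure R).
Implicit Types (F f : R * R -> R) (r : R).

Lemma integral_chord (g G : R -> R) (s : R) : 0 <= s ->
  (forall x : R, is_derive x 1 G (g x)) -> continuous g -> G s = G (- s) ->
  (\int[mu]_(x in `](- s)%R, s[) (g x)%:E = 0)%E.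
Proof.
rewrite le_eqVlt => /predU1P[<- _ _ _|s0 dG cg GE].
  by rewrite oppr0 set_itvoo0 integral_set0.
have mg : measurable_fun setT g by exact: continuous_measurable_fun.
rewrite (integral_itv_bndo_bndc (measurable_funTS _)); last exact/measurable_EFinP.
rewrite (integral_itv_obnd_cbnd (measurable_funTS _)); last exact/measurable_EFinP.
by rewrite (FTC_global dG cg) ?GE ?subrr//; lra.
Qed.

(** Fubini, then the fundamental theorem of calculus on each horizontal chord, at whose two ends [F]
    takes the same value. *)
Lemma green_x F f r : 0 < r ->
  (forall x y : R, is_derive x 1 (fun u => F (u, y)) (f (x, y))) ->
  (forall y, continuous (fun u => f (u, y))) ->
  (leb2 R).-integrable (disk_of r) (EFin \o f) ->
  (forall y, F (half_chord r y, y) = F (- half_chord r y, y)) ->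
  \int[leb2 R]_(p in disk_of r) f p = 0.
Proof.
move=> r0 dF cf intf FE; rewrite /Rintegral.
have mD := measurable_disk_of r.
rewrite integral_mkcond -integral21_prod_meas1; last first.
  by rewrite -integrable_mkcond.
rewrite integral0_eq// => y _; rewrite /fubini_G.
transitivity (\int[mu]_x (((fun x => (f (x, y))%:E) \_ `](- half_chord r y)%R, (half_chord r y)[) x))%E.
  apply: eq_integral => x _; rewrite !patchE.
  suff -> : ((x, y) \in disk_of r) = (x \in (`](- half_chord r y)%R, (half_chord r y)[ : set R)) by [].
  by apply/idP/idP; rewrite !inE /= in_itv/= -half_chordP.
rewrite -integral_mkcond; apply: (@integral_chord _ (fun u => F (u, y))) => //.
exact: sqrtr_ge0.
Qed.

Lemma green_y F f r : 0 < r ->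
  (forall x y : R, is_derive y 1 (fun u => F (x, u)) (f (x, y))) ->
  (forall x, continuous (fun u => f (x, u))) ->
  (leb2 R).-integrable (disk_of r) (EFin \o f) ->
  (forall x, F (x, half_chord r x) = F (x, - half_chord r x)) ->
  \int[leb2 R]_(p in disk_of r) f p = 0.
Proof.
move=> r0 dF cf intf FE; rewrite /Rintegral.
have mD := measurable_disk_of r.
rewrite integral_mkcond -integral12_prod_meas1; last first.
  by rewrite -integrable_mkcond.
rewrite integral0_eq// => x _; rewrite /fubini_F.
transitivity (\int[mu]_y (((fun y => (f (x, y))%:E) \_ `](- half_chord r x)%R, (half_chord r x)[) y))%E.
  apply: eq_integral => y _; rewrite !patchE.
  suff -> : ((x, y) \in disk_of r) = (y \in (`](- half_chord r x)%R, (half_chord r x)[ : set R)) by [].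
  by apply/idP/idP; rewrite !inE /= in_itv/= -half_chordP addrC.
rewrite -integral_mkcond; apply: (@integral_chord _ (fun u => F (x, u))) => //.
exact: sqrtr_ge0.
Qed.

End green.

(** * Integrals of z^m conj(z)^n *)

Section disk_monomials.
Variable R : realType.
Local Notation mu := (@lebesgue_measure R).
Implicit Types (F G : R * R -> Cplx R) (r : R).

(** On a disk, whose area is finite, these properties give integrability, and unlike integrability
    they are stable under products. *)
Definition nice r F := cmeas (disk_of r) F /\ bounded_on (disk_of r) F.

Definition cint r F : Cplx R :=
  ((\int[leb2 R]_(p in disk_of r) complex.Re (F p)) +i*
   (\int[leb2 R]_(p in disk_of r) complex.Im (F p)))%C.

Lemma nice_cst r c : nice r (fun=> c).
Proof. by split; [exact: cmeas_cst | exact: bounded_on_cst]. Qed.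

Lemma niceD r F G : nice r F -> nice r G -> nice r (fun p => F p + G p).
Proof. by move=> [? ?] [? ?]; split; [exact: cmeasD | exact: bounded_onD]. Qed.

Lemma niceM r F G : nice r F -> nice r G -> nice r (fun p => F p * G p).
Proof. by move=> [? ?] [? ?]; split; [exact: cmeasM | exact: bounded_onM]. Qed.

Lemma niceX r F n : nice r F -> nice r (fun p => F p ^+ n).
Proof. by move=> [? ?]; split; [exact: cmeasX | exact: bounded_onX]. Qed.

Lemma nice_conj r F : nice r F -> nice r (fun p => (F p)^*).
Proof. by move=> [? ?]; split; [exact: cmeas_conj | exact: bounded_on_conj]. Qed.

Lemma nice_sum r n (F : nat -> R * R -> Cplx R) : (forall i, nice r (F i)) ->
  nice r (fun p => \sum_(i < n) F i p).
Proof.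
move=> nF; split; first by apply: cmeas_sum => i; case: (nF i).
by apply: bounded_on_sum => i; case: (nF i).
Qed.

Lemma nice_pt r : 0 < r -> nice r (@pt R).
Proof. by move=> r0; split; [exact: cmeas_pt | exact: bounded_on_pt]. Qed.

Lemma nice_integrable r F : 0 < r -> nice r F ->
  (leb2 R).-integrable (disk_of r) (EFin \o (fun p => complex.Re (F p))) /\
  (leb2 R).-integrable (disk_of r) (EFin \o (fun p => complex.Im (F p))).
Proof. by move=> r0 []; exact: integrable_disk. Qed.

Lemma cintD r F G : 0 < r -> nice r F -> nice r G ->
  cint r (fun p => F p + G p) = cint r F + cint r G.
Proof.
move=> r0 /(nice_integrable r0)[F1 F2] /(nice_integrable r0)[G1 G2].
have mD := measurable_disk_of r; apply: Cplx_eq; rewrite ?ReD ?ImD /=.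
- by under eq_Rintegral do rewrite ReD; rewrite RintegralD.
- by under eq_Rintegral do rewrite ImD; rewrite RintegralD.
Qed.

Lemma cintZ r c F : 0 < r -> nice r F -> cint r (fun p => c * F p) = c * cint r F.
Proof.
move=> r0 nF; have [F1 F2] := nice_integrable r0 nF.
have iZ1 x : (leb2 R).-integrable (disk_of r) (EFin \o (fun p => x * complex.Re (F p))).
  have := (nice_integrable r0 (niceM (nice_cst r (rc x)) nF)).1.
  by under eq_fun do rewrite ReM /= mul0r subr0.
have iZ2 x : (leb2 R).-integrable (disk_of r) (EFin \o (fun p => x * complex.Im (F p))).
  have := (nice_integrable r0 (niceM (nice_cst r (rc x)) nF)).2.
  by under eq_fun do rewrite ImM /= mul0r addr0.
have mD := measurable_disk_of r; apply: Cplx_eq; rewrite ?ReM ?ImM /=.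
- by under eq_Rintegral do rewrite ReM; rewrite RintegralB// !RintegralZl.
- by under eq_Rintegral do rewrite ImM; rewrite RintegralD// !RintegralZl.
Qed.

Lemma cint_sum r n (F : nat -> R * R -> Cplx R) : 0 < r -> (forall i, nice r (F i)) ->
  cint r (fun p => \sum_(i < n) F i p) = \sum_(i < n) cint r (F i).
Proof.
move=> r0 nF; elim: n => [|n IH].
  rewrite big_ord0; under eq_fun do rewrite big_ord0.
  by have := cintZ 0 r0 (nice_cst r 0); rewrite !mul0r.
rewrite big_ord_recr/= -IH; under eq_fun do rewrite big_ord_recr/=.
by rewrite cintD//; exact: nice_sum.
Qed.

Lemma cint_green r (F Fx Fy : R * R -> Cplx R) : 0 < r -> nice r Fx -> nice r Fy ->
  (forall x y, cderiv (fun u => F (u, y)) x (Fx (x, y))) ->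
  (forall x y, cderiv (fun u => F (x, u)) y (Fy (x, y))) ->
  (forall y, cdiff (fun u => Fx (u, y))) -> (forall x, cdiff (fun u => Fy (x, u))) ->
  (forall p, p.1 ^+ 2 + p.2 ^+ 2 = r ^+ 2 -> F p = 0) ->
  cint r Fx = 0 /\ cint r Fy = 0.
Proof.
move=> r0 nx ny dx dy cx cy F0.
have [ix1 ix2] := nice_integrable r0 nx; have [iy1 iy2] := nice_integrable r0 ny.
have sq y : half_chord r y != 0 -> half_chord r y ^+ 2 = r ^+ 2 - y ^+ 2.
  move=> h; apply: sqr_sqrtr; rewrite leNgt; apply: contra h => h.
  by rewrite /half_chord ler0_sqrtr// ltW.
(* Either the chord is degenerate and its ends coincide, or they lie on the circle, where [F] is
   0. *)
have Ex y : F (half_chord r y, y) = F (- half_chord r y, y).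
  have [->|/sq h] := eqVneq (half_chord r y) 0; first by rewrite oppr0.
  by rewrite !F0//= ?sqrrN h subrK.
have Ey x : F (x, half_chord r x) = F (x, - half_chord r x).
  have [->|/sq h] := eqVneq (half_chord r x) 0; first by rewrite oppr0.
  by rewrite !F0//= ?sqrrN h subrKC.
split; apply: Cplx_eq => /=.
- apply: (@green_x _ (fun p => complex.Re (F p))) => //.
  + by move=> x y; exact: (dx x y).1.
  + by move=> y; exact: (cdiff_continuous (cx y)).1.
  + by move=> y; rewrite Ex.
- apply: (@green_x _ (fun p => complex.Im (F p))) => //.
  + by move=> x y; exact: (dx x y).2.
  + by move=> y; exact: (cdiff_continuous (cx y)).2.
  + by move=> y; rewrite Ex.
- apply: (@green_y _ (fun p => complex.Re (F p))) => //.
  + by move=> x y; exact: (dy x y).1.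
  + by move=> y; exact: (cdiff_continuous (cy y)).1.
  + by move=> y; rewrite Ey.
- apply: (@green_y _ (fun p => complex.Im (F p))) => //.
  + by move=> x y; exact: (dy x y).2.
  + by move=> y; exact: (cdiff_continuous (cy y)).2.
  + by move=> y; rewrite Ey.
Qed.

Definition zmon m n (p : R * R) : Cplx R := pt p ^+ m * (pt p)^* ^+ n.

Lemma nice_zmon r m n : 0 < r -> nice r (zmon m n).
Proof.
by move=> r0; apply: niceM; apply: niceX; [|apply: nice_conj]; exact: nice_pt.
Qed.

Let bump (r : R) a b (z : Cplx R) : Cplx R :=
  (rc (r ^+ 2) + (- 1) * (z * z^*)) * (z ^+ a * z^* ^+ b).

(** Derivative of [bump] in the direction [d], in the very shape that [cderivD], [cderivZ] and
    [cderivM] produce; the directions 1 and i are those of the coordinates. *)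
Let dbump (r : R) a b (z d : Cplx R) : Cplx R :=
  (0 + (- 1) * (d * z^* + z * d^*)) * (z ^+ a * z^* ^+ b) +
  (rc (r ^+ 2) + (- 1) * (z * z^*)) *
    ((a%:R * z ^+ a.-1 * d) * z^* ^+ b + z ^+ a * (b%:R * z^* ^+ b.-1 * d^*)).

Let cderiv_bump r a b (w : R -> Cplx R) t d : cderiv w t d ->
  cderiv (fun u => bump r a b (w u)) t (dbump r a b (w t) d).
Proof.
move=> wd; have wcd := cderiv_conj wd.
apply: (@cderivM _ (fun u => rc (r ^+ 2) + (- 1) * (w u * (w u)^*))
  (fun u => w u ^+ a * (w u)^* ^+ b)).
- apply: (cderivD (cderiv_cst _ _)); apply: (@cderivZ _ _ (fun u => w u * (w u)^*)).
  exact: cderivM wd wcd.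
- apply: (@cderivM _ (fun u => w u ^+ a) (fun u => (w u)^* ^+ b)); exact: cderivX.
Qed.

Let cdiff_dbump r a b (w : R -> Cplx R) d : cdiff w -> cdiff (fun u => dbump r a b (w u) d).
Proof.
move=> wd; have wcd := cdiff_conj wd.
have X n := cdiffX n wd; have XC n := cdiffX n wcd.
rewrite /dbump.
by do ! match goal with
  | |- cdiff (fun u => @?F u + @?G u) => apply: (@cdiffD _ F G)
  | |- cdiff (fun u => @?F u * @?G u) => apply: (@cdiffM _ F G)
  | |- _ => first [exact: cdiff_cst | exact: X | exact: XC | exact: wd | exact: wcd]
  end.
Qed.

Let nice_dbump r a b d : 0 < r -> nice r (fun p => dbump r a b (pt p) d).
Proof.
move=> r0; have N := nice_pt r0; have NC := nice_conj N.
have X n := niceX n N; have XC n := niceX n NC.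
rewrite /dbump.
by do ! match goal with
  | |- nice _ (fun u => @?F u + @?G u) => apply: (@niceD _ F G)
  | |- nice _ (fun u => @?F u * @?G u) => apply: (@niceM _ F G)
  | |- _ => first [exact: nice_cst | exact: X | exact: XC | exact: N | exact: NC]
  end.
Qed.

Let green_bump r a b : 0 < r ->
  cint r (fun p => dbump r a b (pt p) 1) = 0 /\
  cint r (fun p => dbump r a b (pt p) (pt (0, 1))) = 0.
Proof.
move=> r0; apply: (@cint_green _ (fun p => bump r a b (pt p))) => //.
- exact: nice_dbump.
- exact: nice_dbump.
- by move=> x y; apply: cderiv_bump; exact: cderiv_ptx.
- by move=> x y; apply: cderiv_bump; exact: cderiv_pty.
- by move=> y; apply: cdiff_dbump => t; exists 1; exact: cderiv_ptx.
- by move=> x; apply: cdiff_dbump => t; exists (pt (0, 1)); exact: cderiv_pty.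
- by move=> p pr; rewrite /bump cmodJ cmod_pt pr mulN1r subrr mul0r.
Qed.

(** Since d/dx - i d/dy = 2 d/dz, the bump with a = m + 1 and b = n gives 2 ((m + 1) r^2 z^m
    conj(z)^n - (m + 2) z^(m + 1) conj(z)^(n + 1)), of integral 0. The second relation comes from
    d/dx + i d/dy and the bump with a = m and b = n + 1. *)
Lemma cint_zmon_rec r m n : 0 < r ->
  m.+2%:R * cint r (zmon m.+1 n.+1) = m.+1%:R * rc (r ^+ 2) * cint r (zmon m n) /\
  n.+2%:R * cint r (zmon m.+1 n.+1) = n.+1%:R * rc (r ^+ 2) * cint r (zmon m n).
Proof.
move=> r0; have nz m' n' := @nice_zmon r m' n' r0.
have i2 : (pt (0, 1) : Cplx R) ^+ 2 = -1.
  by apply: Cplx_eq; rewrite expr2 ?ReM ?ImM /=; ring.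
have ic : (pt (0, 1) : Cplx R)^* = - pt (0, 1).
  by apply: Cplx_eq; rewrite ?Re_conj ?Im_conj ?ReN ?ImN /= ?oppr0.
have two : (2 : Cplx R) != 0 by rewrite pnatr_eq0.
have lin (c d : Cplx R) : cint r (fun p => c * zmon m n p + d * zmon m.+1 n.+1 p) =
    c * cint r (zmon m n) + d * cint r (zmon m.+1 n.+1).
  rewrite cintD ?cintZ//; first exact: niceM (nice_cst r c) (nz m n).
  exact: niceM (nice_cst r d) (nz m.+1 n.+1).
have comb (e : Cplx R) a b : cint r (fun p => dbump r a b (pt p) 1 + e * dbump r a b (pt p) (pt (0, 1))) = 0.
  have [h1 h2] := green_bump a b r0.
  rewrite cintD ?cintZ//; [by rewrite h1 h2 mulr0 addr0 | exact: nice_dbump.. | ].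
  exact: niceM (nice_cst r e) (nice_dbump a b _ r0).
split.
- have := comb (- pt (0, 1)) m.+1 n.
  have -> : (fun p => dbump r m.+1 n (pt p) 1 + - pt (0, 1) * dbump r m.+1 n (pt p) (pt (0, 1))) =
      (fun p => (2 * (m.+1%:R * rc (r ^+ 2))) * zmon m n p + (- (2 * m.+2%:R)) * zmon m.+1 n.+1 p).
    apply/funext => p; rewrite /dbump /zmon ic rmorph1 /= -[m.+2%:R]natr1 ![_ ^+ m.+1]exprS ![_ ^+ n.+1]exprS.
    move: i2; rewrite expr2; move: (pt (0, 1)) (pt p) (n%:R : Cplx R) ((pt p)^* ^+ n.-1) => j z n' q.
    move: (z^*) (rc _) => zc r2 jj.
    move: (z ^+ m) (zc ^+ n) (m.+1%:R : Cplx R) => zm zcn m'.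
    (* The two sides differ by a multiple of j^2 + 1; adding that multiple, which is 0, leaves an
       identity of polynomials. *)
    have jj1 : j * j + 1 = 0 by rewrite jj addNr.
    rewrite -[RHS]addr0 -[X in _ = _ + X](mul0r ((zc - z) * (z * zm * zcn) -
      (r2 - z * zc) * (m' * zm * zcn - z * zm * (n' * q)))) -[X in _ = _ + X * _]jj1; ring.
  rewrite lin => /eqP; rewrite addr_eq0 mulNr opprK -!mulrA (inj_eq (mulfI two)) => /eqP <-.
  by rewrite mulrA.
- have := comb (pt (0, 1)) m n.+1.
  have -> : (fun p => dbump r m n.+1 (pt p) 1 + pt (0, 1) * dbump r m n.+1 (pt p) (pt (0, 1))) =
      (fun p => (2 * (n.+1%:R * rc (r ^+ 2))) * zmon m n p + (- (2 * n.+2%:R)) * zmon m.+1 n.+1 p).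
    apply/funext => p; rewrite /dbump /zmon ic rmorph1 /= -[n.+2%:R]natr1 ![_ ^+ m.+1]exprS ![_ ^+ n.+1]exprS.
    move: i2; rewrite expr2; move: (pt (0, 1)) (pt p) (m%:R : Cplx R) (pt p ^+ m.-1) => j z m' q.
    move: (z^*) (rc _) => zc r2 jj.
    move: (z ^+ m) (zc ^+ n) (n.+1%:R : Cplx R) => zm zcn n'.
    have jj1 : j * j + 1 = 0 by rewrite jj addNr.
    rewrite -[RHS]addr0 -[X in _ = _ + X](mul0r (- ((zc - z) * (zm * (zc * zcn)) -
      (r2 - z * zc) * (m' * q * (zc * zcn) - zm * (n' * zcn))))) -[X in _ = _ + X * _]jj1; ring.
  rewrite lin => /eqP; rewrite addr_eq0 mulNr opprK -!mulrA (inj_eq (mulfI two)) => /eqP <-.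
  by rewrite mulrA.
Qed.

(** On the diagonal the recursion starts from the area of the disk. Off it the two recurrences force
    (m - n) r^2 times the integral to vanish. *)
Lemma cint_zmon r m n : 0 < r ->
  cint r (zmon m n) = if m == n then rc (pi * (r ^+ 2) ^+ n.+1 / n.+1%:R) else 0.
Proof.
move=> r0; have nz k : (k.+1%:R : Cplx R) != 0 by rewrite pnatr_eq0.
have r20 : rc (r ^+ 2) != 0 by rewrite -cmod_gt0 cmod_rc ger0_norm ?sqr_ge0// exprn_gt0.
case: eqVneq => [<-{n}|mn].
  elim: m => [|m IH].
    have mD := measurable_disk_of r.
    apply: Cplx_eq; rewrite /= /zmon.
    + by rewrite Rintegral_cst// [X in fine X](lebesgue_disk r0)/= mulr1 mulr0 subr0 mul1r expr1 divr1.
    + by rewrite Rintegral_cst// mulr0 mul0r addr0 mul0r.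
  have [+ _] := cint_zmon_rec m m r0; rewrite IH => h.
  apply: (mulfI (nz m.+1)); rewrite h -!rc_nat -!rcM; congr rc.
  have : (m.+1%:R : R) != 0 by rewrite pnatr_eq0.
  have : (m.+2%:R : R) != 0 by rewrite pnatr_eq0.
  rewrite [in RHS]exprS; move: (m.+1%:R : R) (m.+2%:R : R) (_ ^+ m.+1) => M K X K0 M0.
  by field; rewrite M0 K0.
have [h1 h2] := cint_zmon_rec m n r0.
have : (m.+1%:R * n.+2%:R - n.+1%:R * m.+2%:R) * (rc (r ^+ 2) * cint r (zmon m n)) = 0.
  transitivity (n.+2%:R * (m.+1%:R * rc (r ^+ 2) * cint r (zmon m n)) -
                m.+2%:R * (n.+1%:R * rc (r ^+ 2) * cint r (zmon m n))); first ring.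
  by rewrite -h1 -h2 mulrCA subrr.
move=> /eqP; rewrite !mulf_eq0 (negbTE r20) /= => /orP[|/eqP//].
rewrite -[m.+2%:R]natr1 -[n.+2%:R]natr1.
have -> : m.+1%:R * (n.+1%:R + 1) - n.+1%:R * (m.+1%:R + 1) = m.+1%:R - n.+1%:R :> Cplx R by ring.
by rewrite subr_eq0 eqr_nat eqSS (negbTE mn).
Qed.

End disk_monomials.

(** * Area integrals of the squared modulus of a power series *)

Section energy.
Variable R : realType.
Implicit Types (b : nat -> Cplx R) (r B : R) (p : R * R).

Let part b n p : Cplx R := \sum_(i < n) b i * pt p ^+ i.

Lemma nice_part r b n : 0 < r -> nice r (part b n).
Proof.
move=> r0; apply: (@nice_sum _ r n (fun i p => b i * pt p ^+ i)) => i.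
by apply: niceM; [exact: nice_cst | apply: niceX; exact: nice_pt].
Qed.

Lemma cint_part r b n : 0 < r ->
  cint r (fun p => part b n p * (part b n p)^*) =
  rc (pi * \sum_(i < n) cmod (b i) ^+ 2 * (r ^+ 2) ^+ i.+1 / i.+1%:R).
Proof.
move=> r0; have nz i j := @nice_zmon R r i j r0.
have nc i j : nice r (fun p => b i * (b j)^* * zmon i j p).
  by apply: niceM => //; exact: nice_cst.
transitivity (cint r (fun p => \sum_(i < n) \sum_(j < n) b i * (b j)^* * zmon i j p)).
  congr cint; apply/funext => p; rewrite /part rmorph_sum mulr_suml.
  apply: eq_bigr => i _; rewrite mulr_sumr; apply: eq_bigr => j _.
  by rewrite /zmon rmorphM rmorphXn /=; ring.
rewrite (@cint_sum _ r n (fun i p => \sum_(j < n) b i * (b j)^* * zmon i j p))//; last first.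
  by move=> i; apply: (@nice_sum _ r n (fun j p => b i * (b j)^* * zmon i j p)).
rewrite mulr_sumr (big_morph _ (@rcD R) (@rc0 R)); apply: eq_bigr => i _.
rewrite (@cint_sum _ r n (fun j p => b i * (b j)^* * zmon i j p))//.
rewrite (bigD1 i)//= big1 => [|j ji]; last first.
  by rewrite cintZ// cint_zmon// eq_sym ifN ?mulr0// ; rewrite (inj_eq val_inj).
rewrite addr0 cintZ// cint_zmon// eqxx cmodJ -rcM; congr rc.
by move: (i.+1%:R^-1 : R) => x; ring.
Qed.

Lemma integral_part r b n : 0 < r ->
  (\int[leb2 R]_(p in disk_of r) (cmod (part b n p) ^+ 2)%:E =
  (pi * \sum_(i < n) cmod (b i) ^+ 2 * (r ^+ 2) ^+ i.+1 / i.+1%:R)%:E)%E.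
Proof.
move=> r0; have np := nice_part b n r0.
have [ip _] := nice_integrable r0 (niceM np (nice_conj np)).
have := cint_part b n r0 => /(congr1 (@complex.Re R)) /=; rewrite /Rintegral => h.
have E p : cmod (part b n p) ^+ 2 = complex.Re (part b n p * (part b n p)^*) by rewrite cmodJ.
under eq_integral => p _ do rewrite E.
rewrite -h fineK//; apply: integrable_fin_num ip => //; exact: measurable_disk_of.
Qed.

Lemma part_cvg b p : pconv b 1 -> cmod (pt p) < 1 -> (fun n => part b n p) @ \oo --> psum b (pt p).
Proof. by move=> b1 p1; apply: csumP; exact: pconv_summ b1 p1. Qed.

Lemma cmeas_psum b : pconv b 1 -> cmeas (disk_of 1) (fun p => psum b (pt p)).
Proof.
move=> b1; have np n := (nice_part b n (@ltr01 R)).1.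
have D1 p : disk_of 1 p -> cmod (pt p) < 1 by move/disk_ofP; exact.
split.
- apply: (@measurable_fun_cvg _ _ _ _ (fun n p => complex.Re (part b n p))).
    by move=> n; exact: (np n).1.
  by move=> p /D1 /(part_cvg b1)/cvgC_ReIm[].
- apply: (@measurable_fun_cvg _ _ _ _ (fun n p => complex.Im (part b n p))).
    by move=> n; exact: (np n).2.
  by move=> p /D1 /(part_cvg b1)/cvgC_ReIm[].
Qed.

Lemma measurable_cmod2 D (F : R * R -> Cplx R) : cmeas D F ->
  measurable_fun D (fun p => (cmod (F p) ^+ 2)%:E).
Proof.
move=> [m1 m2]; apply/measurable_EFinP; under eq_fun do rewrite cmodK.
by apply: measurable_funD; exact: measurable_funX.
Qed.

(** Fatou's lemma for the partial sums, whose integrals over the unit disk are known exactly by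
    orthogonality. *)
Lemma energy_le b B : pconv b 1 ->
  (forall n, \sum_(i < n) cmod (b i) ^+ 2 / i.+1%:R <= B) ->
  (\int[leb2 R]_(p in disk_of 1) (cmod (psum b (pt p)) ^+ 2)%:E <= (pi * B)%:E)%E.
Proof.
move=> b1 hB; have mD := @measurable_disk_of R 1.
have np n := (nice_part b n (@ltr01 R)).1.
have -> : (\int[leb2 R]_(p in disk_of 1) (cmod (psum b (pt p)) ^+ 2)%:E =
    \int[leb2 R]_(p in disk_of 1) limn_einf (fun n => (cmod (part b n p) ^+ 2)%:E))%E.
  apply: eq_integral => p; rewrite inE => /(disk_ofP _ ltr01) p1.
  have /cvg_cmod c := part_cvg b1 p1.
  have c2 : (fun n => (cmod (part b n p) ^+ 2)%:E) @ \oo --> (cmod (psum b (pt p)) ^+ 2)%:E.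
    by apply: cvg_EFin; [exact: nearW | rewrite expr2; apply: cvgM].
  by rewrite (cvg_limn_einf_sup c2).1.
have F := @fatou _ _ R (leb2 R) (disk_of 1) mD (fun n p => (cmod (part b n p) ^+ 2)%:E).
apply: (le_trans (F _ _)).
- by move=> n; apply: measurable_cmod2.
- by move=> n p _; rewrite lee_fin sqr_ge0.
rewrite limn_einf_lim; apply: lime_le; first exact: is_cvg_einfs.
apply: nearW => n; apply: (@le_trans _ _ (\int[leb2 R]_(p in disk_of 1) (cmod (part b n p) ^+ 2)%:E)%E).
  by apply: ereal_inf_lbound; exists n => /=.
rewrite integral_part// lee_fin ler_wpM2l ?pi_ge0//; apply: le_trans (hB n).
by apply: ler_sum => i _; rewrite expr1n expr1n mulr1.
Qed.

Lemma bernoulli_le (x : R) n : 0 <= x -> x <= 1 -> 1 - n%:R * (1 - x) <= x ^+ n.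
Proof.
move=> x0 x1; elim: n => [|n IH]; first by rewrite mul0r subr0 expr0.
rewrite exprS; apply: (@le_trans _ _ (x * (1 - n%:R * (1 - x)))); last by rewrite ler_wpM2l.
rewrite -natr1 -subr_ge0.
have -> : x * (1 - n%:R * (1 - x)) - (1 - (n%:R + 1) * (1 - x)) = n%:R * (1 - x) ^+ 2 by ring.
by rewrite mulr_ge0// sqr_ge0.
Qed.

(** On a disk of radius r < 1 the partial sums converge uniformly, so for large [m] the integral of
    |part|^2 over it exceeds that of |psum|^2 by arbitrarily little; raising [n] to such an [m] only
    increases the sum. *)
Lemma le_energy_radius b B r n : 0 < r -> r < 1 -> pconv b 1 ->
  (\int[leb2 R]_(p in disk_of 1) (cmod (psum b (pt p)) ^+ 2)%:E <= (pi * B)%:E)%E ->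
  \sum_(i < n) cmod (b i) ^+ 2 * (r ^+ 2) ^+ i.+1 / i.+1%:R <= B.
Proof.
move=> r0 r1 b1 hB; have mD := @measurable_disk_of R 1; have mDr := @measurable_disk_of R r.
have sub : disk_of r `<=` disk_of (1 : R).
  by move=> p /(disk_ofP _ r0) pr; apply/disk_ofP => //; exact: lt_trans r1.
have [M M0 hM] := psum_le b1 (ltW r0) r1.
have [||K hK] := b1 ((1 + r) / 2); [lra | lra |].
have t0 : 0 < (1 + r) / 2 :> R by lra.
have rt : r < (1 + r) / 2 by lra.
have q0 : 0 <= r / ((1 + r) / 2) by rewrite divr_ge0// ltW.
have q1 : r / ((1 + r) / 2) < 1 by rewrite ltr_pdivrMr// mul1r.
have mg := cmeas_psum b1.
have mgr : cmeas (disk_of r) (fun p => psum b (pt p)).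
  by case: mg => ? ?; split; apply: (measurable_funS mD sub).
apply/ler_addgt0Pr => e e0.
(* If |part - psum| <= d <= 1 and |psum| <= M, then |part|^2 exceeds |psum|^2 by at most 2 M d + d^2
   <= (2 M + 1) d, to be integrated over an area pi r^2. *)
pose d := Num.min 1 (e / ((2 * M + 1) * r ^+ 2)).
have M1 : 0 < 2 * M + 1 by lra.
have r2 : 0 < r ^+ 2 by rewrite exprn_gt0.
have d0 : 0 < d by rewrite lt_min ltr01 divr_gt0// mulr_gt0.
have de : d * (2 * M + 1) * r ^+ 2 <= e.
  by rewrite -mulrA -ler_pdivlMr ?mulr_gt0// /d ge_min lexx orbT.
have d1 : d <= 1 by rewrite /d ge_min lexx.
have [N hN] := @geom_small R (K / (1 - r / ((1 + r) / 2))) _ d q0 q1 d0.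
set m := maxn n N; apply: (@le_trans _ _ (\sum_(i < m) cmod (b i) ^+ 2 * (r ^+ 2) ^+ i.+1 / i.+1%:R)).
  apply: (@sum_ord_mono _ (fun i => cmod (b i) ^+ 2 * (r ^+ 2) ^+ i.+1 / i.+1%:R)); last exact: leq_maxl.
  by move=> i; rewrite divr_ge0// mulr_ge0// exprn_ge0// ltW.
have pt_le p : disk_of r p ->
    cmod (part b m p) ^+ 2 <= cmod (psum b (pt p)) ^+ 2 + d * (2 * M + 1).
  move=> /(disk_ofP _ r0) pr; have prt := lt_trans pr rt.
  have h1 : cmod (part b m p - psum b (pt p)) <= d.
    rewrite cmodBC (le_trans (psum_tail m hK prt))//.
    apply: le_trans (ltW (hN m (leq_maxr _ _))); rewrite mulrAC.
    have K0 : 0 <= K by apply: le_trans (hK 0%N); rewrite mulr_ge0.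
    have qq : cmod (pt p) / ((1 + r) / 2) <= r / ((1 + r) / 2).
      by rewrite ler_wpM2r ?invr_ge0// ltW.
    have qp : 0 <= cmod (pt p) / ((1 + r) / 2) by rewrite divr_ge0// ltW.
    apply: ler_pM.
    - by rewrite divr_ge0// subr_ge0 (le_trans qq)// ltW.
    - by rewrite exprn_ge0.
    - by rewrite ler_wpM2l// lef_pV2 ?posrE ?subr_gt0 ?lerB// (le_lt_trans qq).
    - by apply: lerXn2r; rewrite ?nnegrE.
  have h2 : cmod (psum b (pt p)) <= M by apply: hM; exact: ltW.
  have h3 : cmod (part b m p) <= cmod (psum b (pt p)) + d.
    by rewrite (le_trans (cmod_leD _ (psum b (pt p))))// addrC lerD2l.
  apply: (@le_trans _ _ ((cmod (psum b (pt p)) + d) ^+ 2)).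
    by apply: lerXn2r => //; rewrite ?nnegrE// addr_ge0// ltW.
  rewrite sqrrD -addrA lerD2l mulrDr mulr1.
  apply: lerD; last by rewrite expr2 ler_piMr// ltW.
  by rewrite -mulr_natr; have := ler_wpM2l (ltW d0) h2; lra.
rewrite -(ler_pM2l (@pi_gt0 R)) -lee_fin -integral_part// mulrDr.
apply: (@le_trans _ _ (\int[leb2 R]_(p in disk_of r)
  ((cmod (psum b (pt p)) ^+ 2)%:E + (d * (2 * M + 1))%:E))%E).
  apply: ge0_le_integral => //.
  - by move=> p _; rewrite lee_fin sqr_ge0.
  - by apply: measurable_cmod2; exact: (nice_part b m r0).1.
  - apply: emeasurable_funD; last exact: measurable_cst.
    exact: measurable_cmod2.
rewrite ge0_integralD//=; first last.
- by move=> p _; rewrite lee_fin; apply/ltW/mulr_gt0.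
- exact: measurable_cmod2.
- by move=> p _; rewrite lee_fin sqr_ge0.
rewrite integral_cst// EFinD leeD//.
  apply: le_trans hB; apply: ge0_subset_integral => //; first exact: measurable_cmod2.
  by move=> p _; rewrite lee_fin sqr_ge0.
rewrite [X in (_ * X)%E](lebesgue_disk r0) -EFinM lee_fin mulrCA.
by rewrite ler_wpM2l ?pi_ge0.
Qed.

(** Let r = 1 - d tend to 1: for i < n the weight r^(2 (i + 1)) is at least r^(2 n), and Bernoulli's
    inequality gives (1 - d)^(2 n) >= 1 - 2 n d. *)
Lemma le_energy b B : pconv b 1 ->
  (\int[leb2 R]_(p in disk_of 1) (cmod (psum b (pt p)) ^+ 2)%:E <= (pi * B)%:E)%E ->
  forall n, \sum_(i < n) cmod (b i) ^+ 2 / i.+1%:R <= B.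
Proof.
move=> b1 hB n; apply/ler_addgt0Pr => e e0.
set S := \sum_(i < n) _.
have S0 : 0 <= S by apply: sumr_ge0 => i _; rewrite divr_ge0// sqr_ge0.
pose d := Num.min (1 / 2) (e / (2 * n%:R * S + 1)).
have den : 0 < 2 * n%:R * S + 1 by rewrite ltr_wpDl// !mulr_ge0.
have d0 : 0 < d by rewrite lt_min divr_gt0// divr_gt0.
have d1 : d <= 1 / 2 by rewrite /d ge_min lexx.
have de : d * (2 * n%:R * S + 1) <= e by rewrite -ler_pdivlMr// /d ge_min lexx orbT.
have [r0 r1] : 0 < 1 - d /\ 1 - d < 1 by split; lra.
have h := le_energy_radius n r0 r1 b1 hB.
rewrite -lerBlDr; apply: le_trans h.
apply: (@le_trans _ _ ((1 - d) ^+ (2 * n) * S)).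
  have b2 := @bernoulli_le (1 - d) (2 * n) (ltW r0) (ltW r1).
  apply: le_trans (ler_wpM2r S0 b2); rewrite natrM subKr.
  by move: (n%:R) (S) de => n' S' de; lra.
rewrite mulr_sumr; apply: ler_sum => i _.
rewrite mulrA ler_wpM2r ?invr_ge0// mulrC ler_wpM2l ?sqr_ge0// -exprM.
by apply: ler_wiXn2l; rewrite ?leq_mul2l ?ltn_ord ?orbT// ltW.
Qed.

End energy.

(** * The Dirichlet space as a weighted sequence space *)

(** The weight 0 at n = 0 leaves a_0 free, so this is a seminorm; [a 0%N = 0] accompanies it
    wherever the Dirichlet space is described. *)
Definition l2 (R : realType) (a : nat -> Cplx R) : Prop :=
  exists B : R, forall n, \sum_(i < n) i%:R * cmod (a i) ^+ 2 <= B.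

Definition l2ip (R : realType) (a b : nat -> Cplx R) : Cplx R :=
  csum (fun n => n%:R * (a n * (b n)^*)).

Definition disk_repr (R : realType) (f : Cplx R -> Cplx R) (a : nat -> Cplx R) : Prop :=
  pconv a 1 /\ forall z, cmod z < 1 -> f z = psum a z.

Section l2.
Variable R : realType.
Implicit Types (a b : nat -> Cplx R) (x : nat -> R) (f g : Cplx R -> Cplx R).

Lemma summ_rc x : (forall n, 0 <= x n) -> (exists B, forall n, \sum_(i < n) x i <= B) ->
  summ (fun n => rc (x n)).
Proof.
move=> x0 [B hB]; exists B => n; under eq_bigr do rewrite cmod_rc ger0_norm//.
exact: hB.
Qed.

Lemma csum_rc_ub x n : (forall n, 0 <= x n) -> summ (fun n => rc (x n)) ->
  \sum_(i < n) x i <= complex.Re (csum (fun n => rc (x n))).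
Proof.
move=> x0 /csumP/cvgC_ReIm[/cvgR h _]; apply/ler_addgt0Pr => e /h[n0 hn0].
have := hn0 _ (leq_maxr n n0); rewrite Re_sum /= => h1.
have h2 := sum_ord_mono x0 (leq_maxl n n0).
by apply: le_trans h2 _; rewrite -lerBlDl (le_trans (ler_norm _))// ltW.
Qed.

Lemma csum_rc_le x B : (forall n, 0 <= x n) -> (forall n, \sum_(i < n) x i <= B) ->
  complex.Re (csum (fun n => rc (x n))) <= B.
Proof.
move=> x0 hB; apply: le_trans (ler_norm _) _; apply: le_trans (Re_le_cmod _) _.
by apply: csum_bound => n; under eq_bigr do rewrite cmod_rc ger0_norm//; exact: hB.
Qed.

Lemma csum_rc_Im x : summ (fun n => rc (x n)) -> complex.Im (csum (fun n => rc (x n))) = 0.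
Proof.
move=> /csum_conj; rewrite (eq_csum (b := fun n => rc (x n))); last by move=> n; exact: conj_rc.
move=> /(congr1 (@complex.Im R)); rewrite Im_conj; lra.
Qed.

Lemma l2ip_diag a : l2ip a a = csum (fun n => rc (n%:R * cmod (a n) ^+ 2)).
Proof. by apply: eq_csum => n; rewrite cmodJ rcM rc_nat. Qed.

Lemma l2_term_ge0 a n : 0 <= n%:R * cmod (a n) ^+ 2.
Proof. by rewrite mulr_ge0// sqr_ge0. Qed.

Lemma l2_summ a : l2 a -> summ (fun n => rc (n%:R * cmod (a n) ^+ 2)).
Proof. by apply: summ_rc => n; exact: l2_term_ge0. Qed.

Lemma l2ip_diag_ub a n : l2 a ->
  \sum_(i < n) i%:R * cmod (a i) ^+ 2 <= complex.Re (l2ip a a).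
Proof.
move=> la; rewrite l2ip_diag; apply: (@csum_rc_ub (fun i => i%:R * cmod (a i) ^+ 2)).
  by move=> i; exact: l2_term_ge0.
exact: l2_summ.
Qed.

Lemma l2ip_diag_le a B : (forall n, \sum_(i < n) i%:R * cmod (a i) ^+ 2 <= B) ->
  complex.Re (l2ip a a) <= B.
Proof.
by move=> hB; rewrite l2ip_diag; apply: csum_rc_le => // n; exact: l2_term_ge0.
Qed.

Lemma l2ip_diag_Im a : l2 a -> complex.Im (l2ip a a) = 0.
Proof. by move=> /l2_summ/csum_rc_Im; rewrite l2ip_diag. Qed.

(** For n > 0 the squares |a_n|^2 are bounded, and x <= 1 + x^2; a_0 has weight 0 and enters the
    bound separately. *)
Lemma l2_pconv a : l2 a -> pconv a 1.
Proof.
move=> [B hB] s s0 s1; exists (cmod (a 0%N) + (1 + B)) => n.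
have B0 : 0 <= B by have := hB 0%N; rewrite big_ord0.
apply: (@le_trans _ _ (cmod (a n))).
  by rewrite ler_piMr// exprn_ile1// ltW.
case: n => [|n]; first by rewrite lerDl addr_ge0.
have : cmod (a n.+1) ^+ 2 <= B.
  apply: le_trans (hB n.+2); rewrite big_ord_recr/=.
  apply: (@le_trans _ _ (n.+1%:R * cmod (a n.+1) ^+ 2)).
    by rewrite ler_peMl ?sqr_ge0// ler1n.
  by rewrite lerDr; apply: sumr_ge0 => i _; exact: l2_term_ge0.
move=> h; apply: (@le_trans _ _ (1 + B)); last by rewrite lerDr.
apply: le_trans (lerD (lexx 1) h); rewrite -subr_ge0.
have -> : 1 + cmod (a n.+1) ^+ 2 - cmod (a n.+1) =
  (cmod (a n.+1) - 1 / 2) ^+ 2 + 3 / 4 by field.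
by rewrite addr_ge0 ?sqr_ge0.
Qed.

Lemma cmodD2 (z w : Cplx R) : cmod (z + w) ^+ 2 <= 2 * cmod z ^+ 2 + 2 * cmod w ^+ 2.
Proof.
apply: (@le_trans _ _ ((cmod z + cmod w) ^+ 2)).
  by apply: lerXn2r; rewrite ?nnegrE ?addr_ge0// cmodD.
rewrite -subr_ge0 (_ : _ - _ = (cmod z - cmod w) ^+ 2) ?sqr_ge0//; ring.
Qed.

Lemma l2D a b : l2 a -> l2 b -> l2 (fun n => a n + b n).
Proof.
move=> [B hB] [B' hB']; exists (2 * B + 2 * B') => n.
apply: (@le_trans _ _ (\sum_(i < n) (2 * (i%:R * cmod (a i) ^+ 2) + 2 * (i%:R * cmod (b i) ^+ 2)))).
  apply: ler_sum => i _; apply: le_trans (ler_wpM2l _ (cmodD2 (a i) (b i))) _ => //.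
  by rewrite mulrDr ![i%:R * (2 * _)]mulrCA.
by rewrite big_split -!mulr_sumr lerD// ler_wpM2l.
Qed.

Lemma l2Z c a : l2 a -> l2 (fun n => c * a n).
Proof.
move=> [B hB]; exists (cmod c ^+ 2 * B) => n.
under eq_bigr do rewrite cmodM exprMn mulrCA.
by rewrite -mulr_sumr ler_wpM2l ?sqr_ge0.
Qed.

Lemma l2ip_summ a b : l2 a -> l2 b -> summ (fun n => n%:R * (a n * (b n)^*)).
Proof.
move=> [B hB] [B' hB']; exists (B + B') => n.
apply: (@le_trans _ _ (\sum_(i < n) (i%:R * cmod (a i) ^+ 2 + i%:R * cmod (b i) ^+ 2))).
  apply: ler_sum => i _; rewrite cmodM cmod_nat -mulrDr ler_wpM2l// cmodM cmodC.
  have := sqr_ge0 (cmod (a i) - cmod (b i)).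
  have := mulr_ge0 (cmod_ge0 (a i)) (cmod_ge0 (b i)); nra.
by rewrite big_split lerD.
Qed.

Lemma l2ip_lin c a b d : l2 a -> l2 b -> l2 d ->
  l2ip (fun n => c * a n + b n) d = c * l2ip a d + l2ip b d.
Proof.
move=> la lb ld; have s1 := l2ip_summ la ld; have s2 := l2ip_summ lb ld.
rewrite /l2ip -csumZ// -csumD//; first by apply: eq_csum => n; ring.
exact: summZ.
Qed.

Lemma l2ip_conj a b : l2 a -> l2 b -> l2ip b a = (l2ip a b)^*.
Proof.
move=> la lb; rewrite /l2ip -csum_conj; last exact: l2ip_summ.
by apply: eq_csum => n; rewrite !rmorphM /= conjCK -rc_nat conj_rc [X in _ * X]mulrC.
Qed.

Lemma disk_reprD c f g a b : disk_repr f a -> disk_repr g b ->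
  disk_repr (fun z => c * f z + g z) (fun n => c * a n + b n).
Proof.
move=> [a1 fa] [b1 gb]; split; first exact: pconvD (pconvZ c a1) b1.
move=> z z1; rewrite fa// gb// /psum -csumZ -?csumD.
- by apply: eq_csum => n; ring.
- by apply: summZ; exact: pconv_summ a1 z1.
- exact: pconv_summ b1 z1.
- exact: pconv_summ a1 z1.
Qed.

Lemma disk_repr_inj f a b : disk_repr f a -> disk_repr f b -> a = b.
Proof.
move=> [a1 fa] [b1 fb]; apply: (psum_inj ltr01 a1 b1) => z z1.
by rewrite -fa// fb.
Qed.

Lemma derive1_repr f a z : disk_repr f a -> cmod z < 1 -> derive1 f z = psum (dcoef 1 a) z.
Proof. by move=> [a1 fa] z1; exact: derive1_psum a1 z1 fa. Qed.

Lemma disk2E : @disk2 R = disk_of 1.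
Proof.
by apply/seteqP; split => p; rewrite /disk2/= unit_diskE => /(disk_ofP _ ltr01).
Qed.

Lemma sum_dcoef1 a n : \sum_(i < n) cmod (dcoef 1 a i) ^+ 2 / i.+1%:R =
  \sum_(i < n.+1) i%:R * cmod (a i) ^+ 2.
Proof.
rewrite big_ord_recl mul0r add0r; apply: eq_bigr => i _.
rewrite dcoef1 cmodM cmod_nat exprMn /= /bump /= add1n.
have : (i.+1%:R : R) != 0 by rewrite pnatr_eq0.
by move: (i.+1%:R : R) => x x0; field.
Qed.

Let U a (p : R * R) : R := cmod (psum (dcoef 1 a) (pt p)) ^+ 2.

(** [energy_le] and [le_energy] give the two inequalities; the first also supplies the finiteness
    that lets the second be applied to the integral itself. *)
Lemma integral_U a : l2 a ->
  (\int[leb2 R]_(p in disk_of 1) (U a p)%:E = (pi * complex.Re (l2ip a a))%:E)%E.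
Proof.
move=> la; have a1 := l2_pconv la; have b1 := pconv_dcoef 1 a1.
have le : (\int[leb2 R]_(p in disk_of 1) (U a p)%:E <= (pi * complex.Re (l2ip a a))%:E)%E.
  by apply: energy_le => // n; rewrite sum_dcoef1; exact: l2ip_diag_ub.
apply/eqP; rewrite eq_le le/=.
have ge0 : (0 <= \int[leb2 R]_(p in disk_of 1) (U a p)%:E)%E.
  by apply: integral_ge0 => p _; rewrite lee_fin sqr_ge0.
have fin : (\int[leb2 R]_(p in disk_of 1) (U a p)%:E)%E \is a fin_num.
  by rewrite ge0_fin_numE// (le_lt_trans le)// ltry.
rewrite -(fineK fin) lee_fin -ler_pdivlMl ?pi_gt0//; apply: l2ip_diag_le => n.
have pos : (pi : R) != 0 by rewrite gt_eqF// pi_gt0.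
have := @le_energy _ _ (pi^-1 * fine (\int[leb2 R]_(p in disk_of 1) (U a p)%:E)%E) b1.
rewrite mulVKf// fineK// => /(_ (lexx _) n); rewrite sum_dcoef1; apply: le_trans.
by apply: (@sum_ord_mono _ (fun i => i%:R * cmod (a i) ^+ 2)) => // i; exact: l2_term_ge0.
Qed.

Lemma integrable_U a : l2 a -> (leb2 R).-integrable (disk_of 1) (EFin \o U a).
Proof.
move=> la; apply/integrableP; split.
  by apply: measurable_cmod2; apply: cmeas_psum; apply: pconv_dcoef; exact: l2_pconv.
have -> : (\int[leb2 R]_(x in disk_of 1) `|(EFin \o U a) x| =
  \int[leb2 R]_(p in disk_of 1) (U a p)%:E)%E.
  by apply: eq_integral => p _; rewrite /= ger0_norm// sqr_ge0.
by rewrite integral_U// ltry.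
Qed.

Lemma Rintegral_U a : l2 a ->
  \int[leb2 R]_(p in disk_of 1) U a p = pi * complex.Re (l2ip a a).
Proof. by move=> la; rewrite /Rintegral integral_U. Qed.

Lemma dirichlet_energyE f a : disk_repr f a ->
  dirichlet_energy f = ((pi^-1)%:E * \int[leb2 R]_(p in disk_of 1) (U a p)%:E)%E.
Proof.
move=> fa; rewrite /dirichlet_energy disk2E; congr (_ * _)%E.
apply: eq_integral => p; rewrite inE => /(disk_ofP _ ltr01) p1.
by rewrite (derive1_repr fa p1) -cmodK.
Qed.

Lemma dirichlet_spaceP f : dirichlet_space f <->
  (forall z, ~ unit_disk z -> f z = 0) /\
  exists a, [/\ disk_repr f a, a 0%N = 0 & l2 a].
Proof.
split=> [[fan foff f0 fin]|[foff [a [fa a0 la]]]].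
- split=> //; have [a a1 fE] := taylor_disk fan.
  have fa : disk_repr f a by [].
  exists a; split => //; first by rewrite -psum0 -fE ?f0// cmod0.
  rewrite (dirichlet_energyE fa) in fin.
  have ge0 : (0 <= \int[leb2 R]_(p in disk_of 1) (U a p)%:E)%E.
    by apply: integral_ge0 => p _; rewrite lee_fin sqr_ge0.
  have finn : (\int[leb2 R]_(p in disk_of 1) (U a p)%:E)%E \is a fin_num.
    (* An infinite integral would make the energy infinite, the factor 1 / pi being positive. *)
    rewrite ge0_fin_numE//; move: fin.
    case: (\int[leb2 R]_(p in disk_of 1) (U a p)%:E)%E ge0 => [r| |]//.
      by move=> _ _; exact: ltry.
    by move=> _; rewrite gt0_muley ?ltxx// lte_fin invr_gt0 pi_gt0.
  exists (pi^-1 * fine (\int[leb2 R]_(p in disk_of 1) (U a p)%:E)%E) => n.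
  have pos : (pi : R) != 0 by rewrite gt_eqF// pi_gt0.
  have := @le_energy _ _ (pi^-1 * fine (\int[leb2 R]_(p in disk_of 1) (U a p)%:E)%E)
    (pconv_dcoef 1 a1).
  rewrite mulVKf// fineK// => /(_ (lexx _) n); rewrite sum_dcoef1; apply: le_trans.
  by apply: (@sum_ord_mono _ (fun i => i%:R * cmod (a i) ^+ 2)) => // i; exact: l2_term_ge0.
- split => //.
  + by case: fa => a1 fE; exact: psum_analytic a1 fE.
  + by case: fa => a1 ->; rewrite ?cmod0// psum0.
  + by rewrite (dirichlet_energyE fa) integral_U// -EFinM ltry.
Qed.

Lemma polar_Re (z w : Cplx R) : complex.Re (z * w^*) =
  1 / 4 * (cmod (z + 1 * w) ^+ 2 - cmod (z + - 1 * w) ^+ 2).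
Proof.
rewrite !cmodK !(ReD, ImD, ReM, ImM, Re_conj, Im_conj, ReN, ImN) /=.
by case: z w => [x y] [u v] /=; field.
Qed.

Lemma polar_Im (z w : Cplx R) : complex.Im (z * w^*) =
  1 / 4 * (cmod (z + pt (0, 1) * w) ^+ 2 - cmod (z + - pt (0, 1) * w) ^+ 2).
Proof.
rewrite !cmodK !(ReD, ImD, ReM, ImM, Re_conj, Im_conj, ReN, ImN) /=.
by case: z w => [x y] [u v] /=; field.
Qed.

(** [Rintegral_U] gives the integrals of squares. Polarization, with c = 1 and -1 for the real part
    and c = i and -i for the imaginary part, reduces both forms to its values at the sequences c b +
    a. *)
Lemma dirichlet_ipE f g a b : disk_repr f a -> disk_repr g b -> l2 a -> l2 b ->
  dirichlet_ip f g = l2ip a b.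
Proof.
move=> fa gb la lb; rewrite /dirichlet_ip disk2E.
have mD := @measurable_disk_of R 1.
have pos : (pi : R) != 0 by rewrite gt_eqF// pi_gt0.
have comb c : l2 (fun n => c * b n + a n) by apply: l2D => //; exact: l2Z.
have drv c p : disk_of 1 p ->
    psum (dcoef 1 (fun n => c * b n + a n)) (pt p) = derive1 f (pt p) + c * derive1 g (pt p).
  move=> /(disk_ofP _ ltr01) p1; rewrite -(derive1_repr (disk_reprD c gb fa) p1).
  rewrite (derive1_repr (disk_reprD c gb fa) p1) (derive1_repr fa p1) (derive1_repr gb p1).
  have sa := pconv_summ (pconv_dcoef 1 fa.1) p1.
  have sb := pconv_summ (pconv_dcoef 1 gb.1) p1.
  rewrite addrC /psum -csumZ// -csumD//; last exact: summZ.
  by apply: eq_csum => n; rewrite !dcoef1; ring.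
have polar (c : Cplx R) : l2ip (fun n => c * b n + a n) (fun n => c * b n + a n) =
    c * c^* * l2ip b b + c * l2ip b a + c^* * l2ip a b + l2ip a a.
  rewrite l2ip_lin// [X in c * X]l2ip_conj// ?[X in _ + X]l2ip_conj// !l2ip_lin//.
  rewrite !rmorphD !rmorphM /= -!l2ip_conj//; ring.
have key (h : R * R -> R) c d : (forall p, disk_of 1 p ->
    h p = 1 / 4 * (U (fun n => c * b n + a n) p - U (fun n => d * b n + a n) p)) ->
    pi^-1 * \int[leb2 R]_(p in disk_of 1) h p =
    1 / 4 * (complex.Re (l2ip (fun n => c * b n + a n) (fun n => c * b n + a n)) -
             complex.Re (l2ip (fun n => d * b n + a n) (fun n => d * b n + a n))).
  move=> hE.
  transitivity (pi^-1 * \int[leb2 R]_(p in disk_of 1)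
     (1 / 4 * (U (fun n => c * b n + a n) p - U (fun n => d * b n + a n) p))).
    by congr (_ * _); apply: eq_Rintegral => p; rewrite inE; exact: hE.
  have i1 := integrable_U (comb c); have i2 := integrable_U (comb d).
  have i3 : (leb2 R).-integrable (disk_of 1)
      (EFin \o (fun p => U (fun n => c * b n + a n) p - U (fun n => d * b n + a n) p)).
    by apply: (integrableB _ i1 i2); exact: measurable_disk_of.
  rewrite RintegralZl//.
  by rewrite RintegralB// !Rintegral_U// -mulrBr mulrCA mulKf.
have cba := l2ip_conj la lb.
apply: Cplx_eq => /=.
- rewrite (key _ 1 (- 1)) => [|p Dp].
    by rewrite !polar !(ReD, ReM) cba !(Re_conj, Im_conj, ReN, ImN) /=; field.
  by rewrite /U !drv// -polar_Re.
- rewrite (key _ (pt (0, 1)) (- pt (0, 1))) => [|p Dp].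
    by rewrite !polar !(ReD, ReM, ImM) cba !(Re_conj, Im_conj, ReN, ImN) /=; field.
  by rewrite /U !drv// -polar_Im.
Qed.

End l2.

(** * Reproducing kernel Hilbert spaces *)

Section rkhs.
Variables (R : realType) (Omega : set (Cplx R)) (H : set (Cplx R -> Cplx R)).
Variables (ip : (Cplx R -> Cplx R) -> (Cplx R -> Cplx R) -> Cplx R).
Variable k : Cplx R -> Cplx R -> Cplx R.
Hypothesis K : is_rkhs Omega H ip k.
Implicit Types (f g : Cplx R -> Cplx R).

Lemma rkhs_scale c f : H f -> H (fun z => c * f z).
Proof.
move=> Hf; have := rkhs_lin K c Hf (rkhs_zero K).
by rewrite (_ : (fun z => c * f z + 0) = fun z => c * f z)//; apply/funext => z; rewrite addr0.
Qed.

Lemma rkhs_sub f g : H f -> H g -> H (fun z => f z - g z).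
Proof.
move=> Hf Hg; have := rkhs_lin K (- 1) Hg Hf.
by rewrite (_ : (fun z => - 1 * g z + f z) = fun z => f z - g z)//; apply/funext => z; ring.
Qed.

Lemma rkhs_sum n (c : nat -> Cplx R) (g : nat -> Cplx R -> Cplx R) : (forall i, H (g i)) ->
  H (fun z => \sum_(i < n) c i * g i z).
Proof.
move=> Hg; elim: n => [|n IH].
  rewrite (_ : (fun z => _) = fun=> 0); first exact: rkhs_zero K.
  by apply/funext => z; rewrite big_ord0.
have := rkhs_lin K (c n) (Hg n) IH; congr H; apply/funext => z.
by rewrite big_ord_recr/= addrC.
Qed.

Lemma rkhs_ip0 f : H f -> ip (fun=> 0) f = 0.
Proof.
move=> Hf; have H0 := rkhs_zero K.
have := rkhs_ip_lin K 1 H0 H0 Hf.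
rewrite (_ : (fun z : Cplx R => 1 * 0 + 0) = fun=> 0); last first.
  by apply/funext => z; rewrite mulr0 addr0.
by rewrite mul1r => /eqP; rewrite -subr_eq subrr eq_sym => /eqP.
Qed.

Lemma rkhs_ip_scale c f g : H f -> H g -> ip (fun z => c * f z) g = c * ip f g.
Proof.
move=> Hf Hg; have := rkhs_ip_lin K c Hf (rkhs_zero K) Hg.
by rewrite rkhs_ip0// addr0 => <-; congr ip; apply/funext => z; rewrite addr0.
Qed.

Lemma rkhs_ip_sub f g h : H f -> H g -> H h ->
  ip (fun z => f z - g z) h = ip f h - ip g h.
Proof.
move=> Hf Hg Hh; have := rkhs_ip_lin K (- 1) Hg Hf Hh.
by rewrite mulN1r addrC => <-; congr ip; apply/funext => z; ring.
Qed.

Lemma rkhs_ip_subr f g h : H f -> H g -> H h ->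
  ip h (fun z => f z - g z) = ip h f - ip h g.
Proof.
move=> Hf Hg Hh; rewrite (rkhs_ip_conj K (rkhs_sub Hf Hg) Hh) rkhs_ip_sub// rmorphB /=.
by rewrite -(rkhs_ip_conj K Hf Hh) -(rkhs_ip_conj K Hg Hh).
Qed.

Lemma rkhs_ip_scaler c f g : H f -> H g -> ip f (fun z => c * g z) = c^* * ip f g.
Proof.
move=> Hf Hg; rewrite (rkhs_ip_conj K (rkhs_scale c Hg) Hf) rkhs_ip_scale// rmorphM /=.
by rewrite -(rkhs_ip_conj K Hg Hf).
Qed.

Lemma rkhs_ip_sum n (c : nat -> Cplx R) (g : nat -> Cplx R -> Cplx R) f :
  (forall i, H (g i)) -> H f ->
  ip (fun z => \sum_(i < n) c i * g i z) f = \sum_(i < n) c i * ip (g i) f.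
Proof.
move=> Hg Hf; elim: n => [|n IH].
  rewrite big_ord0 (_ : (fun z => _) = fun=> 0) ?rkhs_ip0//.
  by apply/funext => z; rewrite big_ord0.
rewrite big_ord_recr/= -IH addrC -(rkhs_ip_lin K (c n) (Hg n) (rkhs_sum n c Hg) Hf).
by congr ip; apply/funext => z; rewrite big_ord_recr/= addrC.
Qed.

Lemma rkhs_ip_sumr n (c : nat -> Cplx R) (g : nat -> Cplx R -> Cplx R) f :
  (forall i, H (g i)) -> H f ->
  ip f (fun z => \sum_(i < n) c i * g i z) = \sum_(i < n) (c i)^* * ip f (g i).
Proof.
move=> Hg Hf; rewrite (rkhs_ip_conj K (rkhs_sum n c Hg) Hf) rkhs_ip_sum// rmorph_sum.
by apply: eq_bigr => i _; rewrite rmorphM /= -(rkhs_ip_conj K (Hg i) Hf).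
Qed.

Local Notation nrm := (hnorm ip).

Lemma nrm_ge0 f : 0 <= nrm f.
Proof. exact: sqrtr_ge0. Qed.

Lemma nrm2 f : H f -> ip f f = rc (nrm f ^+ 2).
Proof.
move=> Hf; have h := rkhs_ip_ge0 K Hf.
have E : ip f f = rc (cmod (ip f f)) by rewrite -cmodE ger0_norm.
by rewrite /hnorm E /= sqr_sqrtr.
Qed.

Lemma nrm_eq0 f : H f -> nrm f = 0 -> f = fun=> 0.
Proof.
move=> Hf f0; apply: (rkhs_ip_eq0 K Hf); rewrite nrm2// f0 expr0n /=; exact: rc0.
Qed.

Lemma cauchy_schwarz f g : H f -> H g -> cmod (ip f g) <= nrm f * nrm g.
Proof.
move=> Hf Hg; have [g0|g0] := eqVneq (nrm g) 0.
  rewrite (nrm_eq0 Hg g0) (rkhs_ip_conj K (rkhs_zero K) Hf) rkhs_ip0// conjC0 cmod0.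
  by rewrite mulr_ge0// nrm_ge0.
have g0' : 0 < nrm g by rewrite lt0r g0 nrm_ge0.
have G0 : rc (nrm g ^+ 2) != 0 by rewrite -cmod_gt0 cmod_rc ger0_norm ?sqr_ge0// exprn_gt0.
pose t := ip f g / rc (nrm g ^+ 2).
have tc : t^* * rc (nrm g ^+ 2) = (ip f g)^*.
  by rewrite /t rmorphM fmorphV /= conj_rc divfK.
have Htg := rkhs_scale t Hg; have Hd := rkhs_sub Hf Htg.
have : 0 <= ip (fun z => f z - t * g z) (fun z => f z - t * g z) := rkhs_ip_ge0 K Hd.
have -> : ip (fun z => f z - t * g z) (fun z => f z - t * g z) =
    rc (nrm f ^+ 2 - cmod (ip f g) ^+ 2 / nrm g ^+ 2).
  rewrite rkhs_ip_sub// rkhs_ip_scale// !rkhs_ip_subr// !rkhs_ip_scaler//.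
  rewrite (nrm2 Hg) [t * (_ - _)](_ : _ = 0) ?subr0; last first.
    by rewrite (rkhs_ip_conj K Hf Hg) tc subrr mulr0.
  rewrite nrm2// rcD rcN rcM -cmodJ rcV /t rmorphM fmorphV /= conj_rc.
  by congr (_ - _); ring.
rewrite -rc0 le_rc subr_ge0 ler_pdivrMr ?exprn_gt0// -exprMn ler_pXn2r// nnegrE//.
by rewrite mulr_ge0// nrm_ge0.
Qed.

Lemma nrm_triangle f g h : H f -> H g -> H h ->
  nrm (fun z => f z - g z) <= nrm (fun z => f z - h z) + nrm (fun z => h z - g z).
Proof.
move=> Hf Hg Hh; set u := fun z => f z - h z; set v := fun z => h z - g z.
have Hu : H u by exact: rkhs_sub. have Hv : H v by exact: rkhs_sub.
have Hw : H (fun z => f z - g z) by exact: rkhs_sub.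
rewrite -(@ler_pXn2r _ 2)// ?nnegrE ?addr_ge0 ?nrm_ge0//.
rewrite -le_rc -nrm2//.
have -> : (fun z => f z - g z) = (fun z => 1 * u z + v z).
  by apply/funext => z; rewrite /u /v; ring.
have Huv : H (fun z => 1 * u z + v z) := rkhs_lin K 1 Hu Hv.
rewrite nrm2// le_rc.
have -> : nrm (fun z => 1 * u z + v z) ^+ 2 =
    nrm u ^+ 2 + nrm v ^+ 2 + 2 * complex.Re (ip u v).
  apply: rc_inj; rewrite -nrm2// (rkhs_ip_lin K)// (rkhs_ip_conj K Huv Hu) (rkhs_ip_conj K Huv Hv).
  rewrite !(rkhs_ip_lin K)// !rmorphD !rmorphM /= conjC1 -!(rkhs_ip_conj K)// !mul1r.
  rewrite !nrm2// (rkhs_ip_conj K Hu Hv).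
  apply: Cplx_eq; rewrite ?(ReD, ImD, Re_conj, Im_conj) /=; ring.
rewrite sqrrD; have := Re_le_cmod (ip u v); have := cauchy_schwarz Hu Hv.
have := ler_norm (complex.Re (ip u v)); rewrite -mulr_natl; lra.
Qed.

Lemma nrm_scale c f : H f -> nrm (fun z => c * f z) = cmod c * nrm f.
Proof.
move=> Hf; apply/eqP; rewrite -(@eqrXn2 _ 2)// ?mulr_ge0// ?nrm_ge0//.
have Hc := rkhs_scale c Hf.
apply/eqP/rc_inj; rewrite -(nrm2 Hc) rkhs_ip_scale// rkhs_ip_scaler//.
by rewrite (nrm2 Hf) mulrA cmodJ -rcM exprMn.
Qed.

Lemma nrm_subC f g : H f -> H g -> nrm (fun z => f z - g z) = nrm (fun z => g z - f z).
Proof.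
move=> Hf Hg; have -> : (fun z => f z - g z) = (fun z => - 1 * (g z - f z)).
  by apply/funext => z; ring.
by rewrite nrm_scale ?cmodN ?cmod1 ?mul1r//; exact: rkhs_sub.
Qed.

Lemma rkhs_ip_cvg (u : nat -> Cplx R -> Cplx R) f g : (forall n, H (u n)) -> H f -> H g ->
  (fun n => nrm (fun z => u n z - f z)) @ \oo --> (0 : R) ->
  (fun n => ip g (u n)) @ \oo --> ip g f.
Proof.
move=> Hu Hf Hg /cvgR uf; apply/cvgC => e e0.
have e1 : 0 < e / (nrm g + 1) by rewrite divr_gt0// ltr_wpDl// nrm_ge0.
have [n0 h] := uf _ e1; exists n0 => n /h; rewrite subr0 ger0_norm ?nrm_ge0// => {}h.
rewrite -rkhs_ip_subr// (le_lt_trans (cauchy_schwarz Hg (rkhs_sub (Hu n) Hf)))//.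
rewrite ltr_pdivlMr ?ltr_wpDl ?nrm_ge0// in h.
apply: le_lt_trans h; rewrite mulrC ler_wpM2l ?nrm_ge0//; lra.
Qed.

(** Evaluation at [w] is the inner product with a kernel, hence continuous for the norm. *)
Lemma rkhs_eval_cvg (u : nat -> Cplx R -> Cplx R) f w : (forall n, H (u n)) -> H f -> Omega w ->
  (fun n => nrm (fun z => u n z - f z)) @ \oo --> (0 : R) ->
  (fun n => u n w) @ \oo --> f w.
Proof.
move=> Hu Hf Ow uf; have Hk := rkhs_kernel K Ow.
have := cvgC_conj (rkhs_ip_cvg Hu Hf Hk uf).
rewrite -(rkhs_ip_conj K Hk Hf) (rkhs_repro K Hf Ow).
by under eq_fun do rewrite -(rkhs_ip_conj K Hk (Hu _)) (rkhs_repro K (Hu _) Ow).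
Qed.

End rkhs.

(** * Uniform boundedness principle *)

Section uniform_boundedness.
Variables (R : realType) (Omega : set (Cplx R)) (H : set (Cplx R -> Cplx R)).
Variables (ip : (Cplx R -> Cplx R) -> (Cplx R -> Cplx R) -> Cplx R).
Variable k : Cplx R -> Cplx R -> Cplx R.
Hypothesis K : is_rkhs Omega H ip k.
Implicit Types (f : Cplx R -> Cplx R) (g u : nat -> Cplx R -> Cplx R).
Local Notation nrm := (hnorm ip).

Lemma nrm_limit u f v (A : R) : (forall n, H (u n)) -> H f -> H v ->
  (fun n => nrm (fun z => u n z - f z)) @ \oo --> (0 : R) ->
  (exists n0, forall n, (n0 <= n)%N -> nrm (fun z => u n z - v z) <= A) ->
  nrm (fun z => f z - v z) <= A.
Proof.
move=> Hu Hf Hv /cvgR uf [n0 hA]; apply/ler_addgt0Pr => e /uf[n1 hn1].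
have := hn1 _ (leq_maxr n0 n1); rewrite subr0 ger0_norm ?nrm_ge0// => h1.
have h2 := hA _ (leq_maxl n0 n1).
have := nrm_triangle K Hf Hv (Hu (maxn n0 n1)).
rewrite (nrm_subC K Hf (Hu _)); lra.
Qed.

Lemma geometric_cauchy u (q : R) : 0 <= q -> q < 1 -> (forall n, H (u n)) ->
  (forall n, nrm (fun z => u n.+1 z - u n z) <= q ^+ n) ->
  exists2 f, H f & forall n, nrm (fun z => f z - u n z) <= q ^+ n / (1 - q).
Proof.
move=> q0 q1 Hu hu; have q'0 : 0 < 1 - q by rewrite subr_gt0.
have est n i : nrm (fun z => u (n + i)%N z - u n z) <= q ^+ n * \sum_(j < i) q ^+ j.
  elim: i => [|i IH].
    rewrite big_ord0 mulr0 addn0 (_ : (fun z => _) = fun z => 0 * u n z).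
      by rewrite (nrm_scale K)// cmod0 mul0r.
    by apply/funext => z; rewrite subrr mul0r.
  apply: le_trans (nrm_triangle K (Hu _) (Hu _) (Hu (n + i)%N)) _.
  by rewrite big_ord_recr/= mulrDr addrC lerD// addnS -exprD.
have est2 n i : nrm (fun z => u (n + i)%N z - u n z) <= q ^+ n / (1 - q).
  by apply: le_trans (est n i) _; rewrite ler_wpM2l ?exprn_ge0// geom_sum_le.
have [|f Hf uf] := rkhs_complete K Hu.
  move=> e e0; have e20 : 0 < e / 2 by rewrite divr_gt0.
  have [N hN] := @geom_small R (1 - q)^-1 q (e / 2) q0 q1 e20.
  exists N => m n Nm Nn; apply: le_lt_trans (nrm_triangle K (Hu m) (Hu n) (Hu N)) _.
  have h1 := est2 N (m - N)%N; have h2 := est2 N (n - N)%N.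
  rewrite !subnKC// in h1 h2; have := hN N (leqnn _).
  rewrite (nrm_subC K (Hu N) (Hu n)) mulrC; lra.
exists f => // n; apply: (nrm_limit Hu Hf (Hu n) uf); exists n => m nm.
by have := est2 n (m - n)%N; rewrite subnKC.
Qed.

(* Gliding hump (after Sokal): x_(j+1) differs from x_j by at most 5^-j, in the
   direction of h_j and only if needed to have |<x_(j+1), h_j>| >= 5^-j |h_j| / 2;
   the later corrections, of total norm at most 5^-j / 4, do not spoil this. *)
Lemma uniform_boundedness g : (forall n, H (g n)) ->
  (forall f, H f -> exists B : R, forall n, cmod (ip f (g n)) <= B) ->
  exists B : R, forall n, nrm (g n) <= B.
Proof.
move=> Hg ptw; apply: contrapT => unb.
have big (B : R) : exists n, B < nrm (g n).
  apply: contrapT => h; apply: unb; exists B => n; rewrite leNgt; apply/negP => hn.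
  by apply: h; exists n.
(* The threshold makes 5^-j |h_j| / 4, which remains of |<f, h_j>| after the later corrections,
   exceed j + 1. *)
have [s hs] := choice (fun j : nat => big (4 * 5 ^+ j * j.+1%:R)).
pose h j := g (s j); pose q : R := 5^-1.
have Hh j : H (h j) by exact: Hg.
have h0 j : 0 < nrm (h j).
  by apply: le_lt_trans (hs j); rewrite !mulr_ge0// exprn_ge0.
pose fix x j : Cplx R -> Cplx R := match j with
  | 0%N => fun=> 0
  | j.+1 => if q ^+ j * nrm (h j) / 2 <= cmod (ip (x j) (h j)) then x j
            else fun z => rc (q ^+ j / nrm (h j)) * h j z + x j z
  end.
have q0 : 0 <= q by rewrite invr_ge0.
have qj j : 0 <= q ^+ j by rewrite exprn_ge0.
have q1 : q < 1 by rewrite /q; lra.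
have Hx j : H (x j).
  elim: j => [|j IH]; first exact: rkhs_zero K.
  by rewrite /=; case: ifP => // _; exact: rkhs_lin K _ _ _ (Hh j) IH.
have dx j : nrm (fun z => x j.+1 z - x j z) <= q ^+ j.
  rewrite /=; case: ifP => _.
    rewrite (_ : (fun z => _) = fun z => 0 * x j z).
      by rewrite (nrm_scale K)// cmod0 mul0r.
    by apply/funext => z; rewrite subrr mul0r.
  rewrite (_ : (fun z => _) = fun z => rc (q ^+ j / nrm (h j)) * h j z).
    rewrite (nrm_scale K)// cmod_rc ger0_norm; last by rewrite divr_ge0// ltW.
    by rewrite divfK// gt_eqF.
  by apply/funext => z; rewrite addrK.
(* A correction adds exactly 5^-j |h_j| to an inner product of modulus below half of that. *)
have lx j : q ^+ j * nrm (h j) / 2 <= cmod (ip (x j.+1) (h j)).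
  rewrite /=; case: ifP => // /negbT; rewrite -ltNge => hj.
  rewrite (rkhs_ip_lin K)// (nrm2 K)// -rcM.
  have e : q ^+ j / nrm (h j) * nrm (h j) ^+ 2 = q ^+ j * nrm (h j).
    by rewrite expr2 mulrA divfK// gt_eqF.
  have := cmod_leD (rc (q ^+ j * nrm (h j))) (- ip (x j) (h j)).
  rewrite e opprK cmodN cmod_rc ger0_norm; last by rewrite mulr_ge0// ltW.
  lra.
have [f Hf fx] := geometric_cauchy q0 q1 Hx dx.
have [B hB] := ptw f Hf.
have lower j : j.+1%:R <= B.
  apply: le_trans (hB (s j)); rewrite -/(h j).
  have h1 := lx j; have h2 := cauchy_schwarz K (rkhs_sub K Hf (Hx j.+1)) (Hh j).
  rewrite (rkhs_ip_sub K)// in h2.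
  have h3 : nrm (fun z => f z - x j.+1 z) * nrm (h j) <= q ^+ j * nrm (h j) / 4.
    apply: le_trans (ler_wpM2r (ltW (h0 j)) (fx j.+1)) _.
    rewrite exprS (_ : q * q ^+ j / (1 - q) * nrm (h j) = q ^+ j * nrm (h j) * (q / (1 - q))); last by ring.
    by rewrite (_ : q / (1 - q) = 1 / 4) ?mul1r// /q; field.
  have h4 : j.+1%:R <= q ^+ j * nrm (h j) / 4.
    have := hs j; rewrite -/(h j) => h5.
    have p5 : 0 < 5 ^+ j :> R by rewrite exprn_gt0.
    rewrite ler_pdivlMr// /q exprVn ler_pdivlMl//; apply: le_trans (ltW h5).
    by rewrite [leRHS]mulrAC [leRHS]mulrC [_ * 4]mulrC !mulrA.
  have := cmod_leD (ip (x j.+1) (h j)) (ip f (h j)); rewrite cmodBC; lra.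
have B0 : 0 <= B by apply: le_trans (lower 0%N).
have := lower (Num.bound B); rewrite leNgt (lt_trans (archi_boundP B0))//.
by rewrite ltr_nat.
Qed.

End uniform_boundedness.

Definition tcoef (R : realType) (f : Cplx R -> Cplx R) : nat -> Cplx R :=
  xget (fun=> 0) [set a | disk_repr f a].

(** * The Gram matrix of the coefficient functionals *)

Section analytic_rkhs.
Variables (R : realType) (H : set (Cplx R -> Cplx R)).
Variables (ip : (Cplx R -> Cplx R) -> (Cplx R -> Cplx R) -> Cplx R).
Variable k : Cplx R -> Cplx R -> Cplx R.
Hypothesis K : is_rkhs (@unit_disk R) H ip k.
Hypothesis H_analytic : forall f, H f -> analytic_on (@unit_disk R) f.
Implicit Types (f : Cplx R -> Cplx R) (u : nat -> Cplx R -> Cplx R) (w z : Cplx R).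
Local Notation nrm := (hnorm ip).
Local Notation kw w := (fun z => k z w).

Lemma tcoefP f : H f -> disk_repr f (tcoef f).
Proof.
move=> /H_analytic/taylor_disk[a a1 fa].
by apply: (@xgetPex _ (fun=> 0) [set a | disk_repr f a]); exists a.
Qed.

Lemma H_kernel w : cmod w < 1 -> H (kw w).
Proof. by move=> /unit_diskE w1; exact: (rkhs_kernel K w1). Qed.

Lemma reproducing f w : H f -> cmod w < 1 -> ip f (kw w) = f w.
Proof. by move=> Hf /unit_diskE w1; exact: (rkhs_repro K Hf w1). Qed.

(** The inner products of a fixed [f] with the kernels k_w are the values f(w), bounded for |w| <=
    r; kernels of unbounded norm would contradict uniform boundedness. *)
Lemma kernel_bound (r : R) : 0 <= r -> r < 1 ->
  exists2 B : R, 0 <= B & forall w, cmod w <= r -> nrm (kw w) <= B.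
Proof.
move=> r0 r1; apply: contrapT => unb.
have big (n : nat) : exists w, cmod w <= r /\ n%:R < nrm (kw w).
  apply: contrapT => h; apply: unb; exists n%:R => // w wr.
  by rewrite leNgt; apply/negP => hw; apply: h; exists w.
have [w hw] := choice big.
have w1 n : cmod (w n) < 1 by apply: le_lt_trans (hw n).1 r1.
have [|B hB] := uniform_boundedness K (fun n => H_kernel (w1 n)).
  move=> f Hf; have [f1 fE] := tcoefP Hf.
  have [B B0 hB] := psum_le f1 r0 r1; exists B => n.
  by rewrite reproducing// fE//; apply: hB; exact: (hw n).1.
have B0 : 0 <= B by apply: le_trans (hB 0%N); exact: nrm_ge0.
have := le_lt_trans (hB (Num.bound B)) (archi_boundP B0).
by rewrite ltNge ltW// (hw _).2.
Qed.

(** Cauchy's estimate, where |f(z)| = |<f, k_z>| is controlled by Cauchy-Schwarz and the bound on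
    the kernels. *)
Lemma tcoef_bound (t : R) : 0 < t -> t < 1 ->
  exists2 B : R, 0 <= B & forall f n, H f -> cmod (tcoef f n) * t ^+ n <= B * nrm f.
Proof.
move=> t0 t1; have [B B0 hB] := kernel_bound (ltW t0) t1; exists B => // f n Hf.
have [f1 fE] := tcoefP Hf.
apply: (cauchy_estimate f1 (ltW t0) t1) => z zt.
have z1 : cmod z < 1 by rewrite zt.
rewrite -fE// -reproducing// mulrC; apply: le_trans (cauchy_schwarz K Hf (H_kernel z1)) _.
by rewrite ler_wpM2l ?nrm_ge0// hB// zt.
Qed.

(* The coefficient functional is the limit in H of the combinations of
   kernels obtained by discretizing Cauchy's integral formula. *)
Lemma coef_functional_exists m : exists E, H E /\ forall f, H f -> ip f E = tcoef f m.
Proof.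
have [||B B0 hB] := @tcoef_bound (1 / 2); [lra | lra |].
(* The averages run over the circle of radius 1/4, inside the radius 1/2 at which the coefficients
   are controlled, so the error decays like (1/2)^n. *)
pose s : R := 1 / 4; pose q : R := s / (1 / 2).
have [s0 s1] : 0 < s /\ s < 1 / 2 by rewrite /s; split; lra.
have qE : q = 1 / 2 by rewrite /q /s; field.
have [q0 q1] : 0 <= q /\ q < 1 by rewrite qE; split; lra.
pose N n := (n + m).+1.
have [w pw] := choice (fun n => @prim_root_exists R (N n) (ltn0Sn _)).
pose pnt n j : Cplx R := rc s * w n ^+ j.
have pnt1 n j : cmod (pnt n j) < 1.
  rewrite cmodM cmodX (cmod_prim_root (pw n)) expr1n mulr1 cmod_rc ger0_norm ?ltW//.
  by apply: lt_trans s1 _; lra.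
(* Conjugated because [ip] is conjugate linear on the right: <f, u_n> is then the circle average of
   [f] divided by s^m. *)
pose c n j : Cplx R := ((N n)%:R^-1 * (rc s ^+ m)^-1 * w n ^+ ((N n - m) * j))^*.
pose u n := fun z => \sum_(j < N n) c n j * kw (pnt n j) z.
have Hk n j : H (kw (pnt n j)) by apply: H_kernel.
have Hu n : H (u n) by apply: (rkhs_sum K _ _ (Hk n)).
have sm0 : rc s ^+ m != 0 :> Cplx R.
  by rewrite -cmod_gt0 cmodX cmod_rc ger0_norm ?exprn_gt0// ltW.
pose C := B / (1 - q) / s ^+ m.
have C0 : 0 <= C by rewrite divr_ge0 ?divr_ge0 ?subr_ge0 ?exprn_ge0// ltW.
have approx f n : H f -> cmod (ip f (u n) - tcoef f m) <= C * q ^+ n * nrm f.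
  move=> Hf; have [f1 fE] := tcoefP Hf.
  have nN : (m < N n)%N by rewrite ltnS leq_addl.
  have := circle_avg_approx (fun j => hB f j Hf) (ltW s0) s1 (pw n) nN.
  rewrite -/q => h.
  have -> : ip f (u n) - tcoef f m =
      (rc s ^+ m)^-1 * (circle_avg (psum (tcoef f)) (w n) (N n) m s - tcoef f m * rc s ^+ m).
    rewrite mulrBr [X in _ = _ - X]mulrC mulfK//; congr (_ - _).
    rewrite (rkhs_ip_sumr K _ _ (Hk n))// /circle_avg mulrA mulr_sumr.
    apply: eq_bigr => j _; rewrite /c conjCK reproducing// fE// mulrA.
    by congr (_ * _ * _); rewrite mulrC.
  rewrite cmodM cmodV cmodX cmod_rc (ger0_norm (ltW s0)) mulrC ler_pdivrMr ?exprn_gt0//.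
  apply: le_trans h _.
  have -> : C * q ^+ n * nrm f * s ^+ m = B * nrm f / (1 - q) * q ^+ n.
    by rewrite /C; field; rewrite ?gt_eqF// ?exprn_gt0// ?subr_gt0.
  rewrite ler_wpM2l//; last by apply: ler_wiXn2l => //; [exact: ltW | rewrite leqW// leq_addr].
  by rewrite divr_ge0 ?mulr_ge0 ?nrm_ge0// subr_ge0 ltW.
(* The error in [approx] is proportional to |f|; used for f = d = u_n - u_n' itself, it bounds |d|^2
   by a multiple of |d|. *)
have cau n n' : nrm (fun z => u n z - u n' z) <= C * q ^+ n + C * q ^+ n'.
  set d := fun z => u n z - u n' z; have Hd : H d by exact: (rkhs_sub K).
  have [d0|d0] := eqVneq (nrm d) 0; first by rewrite d0 addr_ge0// mulr_ge0// exprn_ge0.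
  have d0' : 0 < nrm d by rewrite lt0r d0 nrm_ge0.
  rewrite -(ler_pM2r d0') -expr2 mulrDl.
  have <- : cmod (ip d d) = nrm d ^+ 2 by rewrite (nrm2 K Hd) cmod_rc ger0_norm ?sqr_ge0.
  rewrite {2}/d (rkhs_ip_subr K)//.
  apply: le_trans (cmod_distD (tcoef d m) _ _) _.
  by apply: lerD; [exact: approx | rewrite cmodBC; exact: approx].
have [|E HE uE] := rkhs_complete K Hu.
  move=> e e0; have e20 : 0 < e / 2 by rewrite divr_gt0.
  have [n0 hn0] := @geom_small R C q (e / 2) q0 q1 e20.
  exists n0 => i j /hn0 hi /hn0 hj; apply: le_lt_trans (cau i j) _; lra.
exists E; split=> // f Hf.
apply: (cvgC_unique (rkhs_ip_cvg K Hu HE Hf uE)); apply/cvgC => e e0.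
have [n0 hn0] := @geom_small R (C * nrm f) q e q0 q1 e0; exists n0 => n /hn0.
by apply: le_lt_trans; rewrite mulrAC; exact: approx.
Qed.

Definition coef_functional : nat -> Cplx R -> Cplx R :=
  projT1 (choice coef_functional_exists).
Local Notation E := coef_functional.

Lemma H_E m : H (E m).
Proof. by rewrite /E; case: (choice _) => e he /=; case: (he m). Qed.
Hint Resolve H_E : core.

Lemma ip_E f m : H f -> ip f (E m) = tcoef f m.
Proof. by rewrite /E; case: (choice _) => e he /=; case: (he m) => _; apply. Qed.

Lemma tcoef_E m n : tcoef (E m) n = ip (E m) (E n).
Proof. by rewrite ip_E. Qed.

Lemma tcoef_kernel w n : cmod w < 1 -> tcoef (kw w) n = (E n w)^*.
Proof.
move=> w1; have Hk := H_kernel w1.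
by rewrite -ip_E// (rkhs_ip_conj K (H_E n) Hk) reproducing.
Qed.

(** |E_n|^2 is the n-th coefficient of E_n itself, at most B |E_n| / t^n; dividing by |E_n| leaves B
    / t^n, for any t < 1. *)
Lemma nrm_E_pconv : pconv (fun n => rc (nrm (E n))) 1.
Proof.
move=> s s0 s1.
have [||B B0 hB] := @tcoef_bound ((1 + s) / 2); [lra | lra |].
exists B => n; rewrite cmod_rc ger0_norm ?nrm_ge0//.
have [e0|e0] := eqVneq (nrm (E n)) 0; first by rewrite e0 mul0r.
have e0' : 0 < nrm (E n) by rewrite lt0r e0 nrm_ge0.
rewrite -(ler_pM2l e0') mulrA -expr2 [leRHS]mulrC.
apply: le_trans (hB (E n) n (H_E n)).
rewrite tcoef_E (nrm2 K)// cmod_rc ger0_norm ?sqr_ge0//.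
by rewrite ler_wpM2l ?sqr_ge0//; apply: lerXn2r; rewrite ?nnegrE; lra.
Qed.

Lemma abs_series_cvg (g : nat -> Cplx R -> Cplx R) (B : R) : (forall n, H (g n)) ->
  (forall n, \sum_(i < n) nrm (g i) <= B) ->
  exists2 F, H F & (fun n => nrm (fun z => \sum_(i < n) g i z - F z)) @ \oo --> (0 : R).
Proof.
move=> Hg gB; pose u n := fun z => \sum_(i < n) g i z.
have Hu n : H (u n).
  have := rkhs_sum K n (fun=> 1) Hg; congr H; apply/funext => z.
  by apply: eq_bigr => i _; rewrite mul1r.
have est n i : nrm (fun z => u (n + i)%N z - u n z) <=
    \sum_(j < n + i) nrm (g j) - \sum_(j < n) nrm (g j).
  elim: i => [|i IH].
    rewrite addn0 subrr (_ : (fun z => _) = fun z => 0 * u n z).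
      by rewrite (nrm_scale K)// cmod0 mul0r.
    by apply/funext => z; rewrite subrr mul0r.
  apply: le_trans (nrm_triangle K (Hu _) (Hu _) (Hu (n + i)%N)) _.
  rewrite addnS big_ord_recr/= [leRHS]addrAC [leRHS]addrC lerD//.
  rewrite (_ : (fun z => u (n + i).+1 z - u (n + i)%N z) = g (n + i)%N)//.
  by apply/funext => z; rewrite /u big_ord_recr/= [X in X - _]addrC addrK.
apply: (rkhs_complete K Hu) => e e0; have e20 : 0 < e / 2 by rewrite divr_gt0.
have [N hN] := monotone_tail (sum_ord_mono (fun i => nrm_ge0 ip (g i))) gB e20.
exists N => m n Nm Nn; apply: le_lt_trans (nrm_triangle K (Hu m) (Hu n) (Hu N)) _.
rewrite (nrm_subC K (Hu N) (Hu n)).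
have := est N (m - N)%N; have := est N (n - N)%N; rewrite !subnKC//.
have := hN m; have := hN n; lra.
Qed.

Lemma disk_repr_ext f (g : Cplx R -> Cplx R) a : (forall z, cmod z < 1 -> f z = g z) ->
  disk_repr f a -> disk_repr g a.
Proof. by move=> fg [a1 fa]; split=> // z z1; rewrite -fg// fa. Qed.

Lemma disk_repr_conj f a : disk_repr f a ->
  disk_repr (fun v => (f v^*)^*) (fun n => (a n)^*).
Proof.
move=> [a1 fa]; split.
  by move=> s s0 /(a1 s s0)[B hB]; exists B => n; rewrite cmodC.
move=> z z1; have zc : cmod z^* < 1 by rewrite cmodC.
rewrite fa// /psum -csum_conj; last exact: pconv_summ a1 zc.
by apply: eq_csum => n; rewrite rmorphM rmorphXn /= conjCK.
Qed.

Lemma kernel_conj z w : cmod z < 1 -> cmod w < 1 -> k z w = (k w z)^*.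
Proof.
move=> z1 w1; have Hz := H_kernel z1; have Hw := H_kernel w1.
by rewrite -(reproducing Hw z1) -(reproducing Hz w1) (rkhs_ip_conj K Hz Hw).
Qed.

(** By Hermitian symmetry k(z, conj v) is the conjugate of k_z(conj v), and the n-th coefficient of
    k_z is the conjugate of E_n(z). *)
Lemma kernel_wbar_repr z : cmod z < 1 -> disk_repr (fun v => k z v^*) (fun n => E n z).
Proof.
move=> z1; have := disk_repr_conj (tcoefP (H_kernel z1)).
rewrite (_ : (fun n => _) = fun n => E n z); last first.
  by apply/funext => n; rewrite tcoef_kernel// conjCK.
by apply: disk_repr_ext => v v1; rewrite [RHS]kernel_conj// cmodC.
Qed.

Lemma d_wbarE z w : cmod z < 1 -> cmod w < 1 ->
  d_wbar k z w = psum (dcoef 1 (fun n => E n z)) w^*.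
Proof.
move=> z1 w1; rewrite /d_wbar (derive1_repr (kernel_wbar_repr z1))// cmodC//.
Qed.

(** The series of (n + 1) conj(w)^n E_(n+1) converges in norm by [nrm_E_pconv]. Its sum is analytic
    in z as a member of [H], has the termwise derivative as its values, and its coefficients come
    from pairing with E_n. *)
Lemma d_wbar_in_H w : cmod w < 1 -> exists G, [/\ H G,
  forall z, cmod z < 1 -> G z = d_wbar k z w &
  forall n, tcoef G n = psum (dcoef 1 (fun j => ip (E j) (E n))) w^*].
Proof.
move=> w1; have wc1 : cmod w^* < 1 by rewrite cmodC.
pose c n : Cplx R := n.+1%:R * w^* ^+ n.
have Hg n : H (fun z => c n * E n.+1 z) by exact: (rkhs_scale K).
have [B hB] := pconv_sum (pconv_dcoef 1 nrm_E_pconv) (cmod_ge0 w^*) wc1.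
have [n|G HG hG] := @abs_series_cvg (fun n z => c n * E n.+1 z) B Hg.
  apply: le_trans (hB n); apply: ler_sum => i _.
  rewrite (nrm_scale K)// /c dcoef1 !cmodM cmodX cmod_rc cmod_nat (ger0_norm (nrm_ge0 _ _)).
  by rewrite mulrAC.
have Hu n : H (fun z => \sum_(i < n) c i * E i.+1 z) by exact: (rkhs_sum K n c (fun i => H_E i.+1)).
exists G; split=> // [z z1|n].
  rewrite d_wbarE//; apply/esym/csum_unique.
  apply: cvgC_ext (rkhs_eval_cvg K Hu HG ((unit_diskE z).2 z1) hG) => n.
  apply: eq_bigr => i _.
  by rewrite dcoef1 /c mulrAC.
rewrite -ip_E//; apply/esym/csum_unique.
have := cvgC_conj (rkhs_ip_cvg K Hu HG (H_E n) hG).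
rewrite -(rkhs_ip_conj K (H_E n) HG); apply: cvgC_ext => m.
rewrite -(rkhs_ip_conj K (H_E n) (Hu m)) (rkhs_ip_sum K m c (fun i => H_E i.+1))//.
by apply: eq_bigr => i _; rewrite dcoef1 /c mulrAC.
Qed.

Definition shift2 a : nat -> Cplx R := fun j => if j is j'.+2 then a j' else 0.

Lemma pconv_shift2 a : pconv a 1 -> pconv (shift2 a) 1.
Proof.
move=> a1 s s0 s1; have [B hB] := a1 s s0 s1; have B0 : 0 <= B.
  by apply: le_trans (hB 0%N); rewrite mulr_ge0.
exists B => -[|[|n]]; rewrite /= ?cmod0 ?mul0r//; apply: le_trans (hB n).
by rewrite ler_wpM2l//; apply: ler_wiXn2l => //; [exact: ltW | rewrite -addn2 leq_addr].
Qed.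

Lemma psum_shift2 a z : pconv a 1 -> cmod z < 1 -> psum (shift2 a) z = z ^+ 2 * psum a z.
Proof.
move=> a1 z1; rewrite /psum (@csum_shiftn _ _ 2).
- rewrite -csumZ; last exact: pconv_summ a1 z1.
  by apply: eq_csum => n; rewrite exprD addn2 /=; ring.
- by move=> [|[|//]] _; rewrite mul0r.
- exact: pconv_summ (pconv_shift2 a1) z1.
Qed.

(** * Consequences of the kernel equation *)

Hypothesis k_eq : kernel_equation k.
Hypothesis H_vanish : forall f, H f -> f 0 = 0.

Local Notation M j n := (ip (E j) (E n)).

Lemma gram_conj j n : M n j = (M j n)^*.
Proof. exact: (rkhs_ip_conj K). Qed.

Lemma gram_repr n : disk_repr (fun v => (E n v^*)^*) (fun j => M j n).
Proof.
have := disk_repr_conj (tcoefP (H_E n)); congr disk_repr; apply/funext => j.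
by rewrite tcoef_E -gram_conj.
Qed.

(** The left side has z^n-coefficient (n + 2)(n + 1) conj(E_(n+2)(w)), the right side conj(w)^2 (n +
    1) times the coefficient of index n + 1 of [d_wbar k]; the common factor n + 1 cancels. *)
Lemma kernel_eq_coef w n : cmod w < 1 ->
  n.+2%:R * (E n.+2 w)^* = w^* ^+ 2 * psum (dcoef 1 (fun j => M j n.+1)) w^*.
Proof.
move=> w1; have [G [HG GE Gn]] := d_wbar_in_H w1.
have Hk := H_kernel w1; have kr := tcoefP Hk; have Gr := tcoefP HG.
have k1 z : cmod z < 1 -> d_z k z w = psum (dcoef 1 (tcoef (kw w))) z.
  exact: derive1_repr kr.
have kr1 : disk_repr (fun z => d_z k z w) (dcoef 1 (tcoef (kw w))).
  by split=> //; exact: pconv_dcoef kr.1.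
have k2 z : cmod z < 1 -> d_z (d_z k) z w = psum (dcoef 1 (dcoef 1 (tcoef (kw w)))) z.
  exact: derive1_repr kr1.
have G1 z : cmod z < 1 -> d_z (d_wbar k) z w = psum (dcoef 1 (tcoef G)) z.
  exact: derive1_repr (disk_repr_ext GE Gr).
have key : dcoef 1 (dcoef 1 (tcoef (kw w))) = fun n => w^* ^+ 2 * dcoef 1 (tcoef G) n.
  apply: (psum_inj ltr01).
  - exact: pconv_dcoef kr1.1.
  - exact: pconvZ (pconv_dcoef 1 Gr.1).
  move=> z z1; rewrite -k2// k_eq; [|exact/unit_diskE..].
  rewrite G1// /psum -csumZ; last exact: pconv_summ (pconv_dcoef 1 Gr.1) z1.
  by apply: eq_csum => i; rewrite mulrA.
have := congr1 (fun a => a n) key; rewrite /= !dcoef1 tcoef_kernel// Gn => h.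
have n1 : n.+1%:R != 0 :> Cplx R by rewrite pnatr_eq0.
by apply: (mulfI n1); rewrite h mulrCA.
Qed.

(* Equate the coefficients of z^n, then those of conj(w)^j, in the kernel equation. *)
Lemma gram_rec n : (fun j => n.+2%:R * M j n.+2) = shift2 (dcoef 1 (fun j => M j n.+1)).
Proof.
have p1 := pconv_dcoef 1 (gram_repr n.+1).1.
apply: (psum_inj ltr01).
- exact: pconvZ (gram_repr n.+2).1.
- exact: pconv_shift2 p1.
move=> v v1; have vc1 : cmod v^* < 1 by rewrite cmodC.
rewrite psum_shift2// -{2 3}[v]conjCK -kernel_eq_coef// (gram_repr n.+2).2//.
rewrite /psum -csumZ; last exact: pconv_summ (gram_repr n.+2).1 v1.
by apply: eq_csum => i; rewrite mulrA.
Qed.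

Lemma tcoef0 f : H f -> tcoef f 0%N = 0.
Proof.
by move=> Hf; have [_ h] := tcoefP Hf; rewrite -psum0 -h ?cmod0// H_vanish.
Qed.

Lemma gram0 j : M j 0%N = 0.
Proof. by rewrite ip_E// tcoef0. Qed.

Definition gram_const : R := nrm (E 1%N) ^+ 2.
Local Notation C := gram_const.

(** Entries of index 0 vanish because functions of [H] are 0 at 0. Row 1 vanishes beyond column 1
    because [shift2] has a 0 at index 1, and column 1 follows by symmetry. The recursion carries the
    zeros, and from |E_1|^2 = C the values C / n, down the diagonals; at n = 0 the formula reads C /
    0 = 0. *)
Lemma gramE j n : M j n = if j == n then rc C / n%:R else 0.
Proof.
have M1 m : M 1%N m.+2 = 0.
  have := congr1 (fun a => a 1%N) (gram_rec m); rewrite /= => /eqP.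
  by rewrite mulf_eq0 pnatr_eq0 => /eqP.
elim: n j => [|n IH] j; first by rewrite gram0 invr0 mulr0 if_same.
case: n IH => [_|n IH].
  case: j => [|[|j]]; first by rewrite gram_conj gram0 conjC0.
    by rewrite (nrm2 K)// divr1.
  by rewrite gram_conj M1 conjC0.
case: j => [|[|j]]; first by rewrite gram_conj gram0 conjC0.
  by rewrite M1.
have := congr1 (fun a => a j.+2) (gram_rec n); rewrite /= dcoef1 IH !eqSS.
have n2 : n.+2%:R != 0 :> Cplx R by rewrite pnatr_eq0.
have n1 : n.+1%:R != 0 :> Cplx R by rewrite pnatr_eq0.
case: eqP => [->|_] h; last by apply: (mulfI n2); rewrite h !mulr0.
by apply: (mulfI n2); rewrite h ![_ * (rc C / _)]mulrC !divfK.
Qed.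

(** If C = 0, every E_n has norm 0, and then all Taylor coefficients of all functions of [H]
    vanish. *)
Lemma gram_const_gt0 : (exists2 f, H f & f <> (fun=> 0)) -> 0 < C.
Proof.
move=> [f Hf f0]; rewrite lt0r sqr_ge0 andbT; apply/negP => /eqP C0; apply: f0.
have E0 n : E n = fun=> 0.
  apply: (rkhs_ip_eq0 K) => //; rewrite gramE eqxx C0; by rewrite rc0 mul0r.
apply/funext => z; have [z1|z1] := ltP (cmod z) 1; last first.
  by apply: (rkhs_off K Hf); move/unit_diskE; rewrite ltNge z1.
have [_ ->//] := tcoefP Hf; rewrite /psum (@csum_fin _ 0) ?big_ord0// => i _.
rewrite -ip_E// E0 (rkhs_ip_conj K (rkhs_zero K) Hf) (rkhs_ip0 K)//.
by rewrite conjC0 mul0r.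
Qed.

(** * Identification of [H] with the Dirichlet space *)

Hypothesis C_gt0 : 0 < C.

Let C_neq0 : rc C != 0 :> Cplx R.
Proof. by rewrite -cmod_gt0 cmod_rc gtr0_norm. Qed.

(** By [gramE], E_i is the monomial (C / i) z^i on the disk for i > 0, and E_0 is 0; when a_0 = 0
    this is the truncation of the series of [a], written as an element of [H]. *)
Let P (a : nat -> Cplx R) N : Cplx R -> Cplx R := fun z => \sum_(i < N) (i%:R * a i / rc C) * E i z.

Let H_P a N : H (P a N).
Proof. exact: (rkhs_sum K N (fun i => i%:R * a i / rc C) H_E). Qed.

Let ip_PE a N n : a 0%N = 0 -> ip (P a N) (E n) = if (n < N)%N then a n else 0.
Proof.
move=> a0; rewrite (rkhs_ip_sum K N (fun i => i%:R * a i / rc C) H_E)//.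
case: ltnP => [nN|Nn].
  rewrite (bigD1 (Ordinal nN))//= big1 ?addr0 => [|i /negP ni]; last first.
    by rewrite gramE ifN ?mulr0//; apply/negP => /eqP h; apply: ni; apply/eqP/val_inj.
  rewrite gramE eqxx; case: n nN => [|n] nN; first by rewrite a0 !mulr0 !mul0r.
  have n1 : n.+1%:R != 0 :> Cplx R by rewrite pnatr_eq0.
  by rewrite mulrA divfK// [_ * a _]mulrC mulfK.
rewrite big1// => i _; rewrite gramE ifN ?mulr0//.
by apply/negP => /eqP h; move: (ltn_ord i); rewrite h ltnNge Nn.
Qed.

Let ip_sum_P f a N : H f -> ip f (P a N) = \sum_(i < N) (i%:R * a i / rc C)^* * tcoef f i.
Proof.
move=> Hf; rewrite (rkhs_ip_sumr K N (fun i => i%:R * a i / rc C) H_E)//.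
by apply: eq_bigr => i _; rewrite ip_E.
Qed.

Let coef_sqr a i : (i%:R * a i / rc C)^* * a i = rc (i%:R * cmod (a i) ^+ 2 / C).
Proof.
rewrite !rmorphM fmorphV /= conj_rc -rc_nat conj_rc (rcM _ C^-1) (rcM i%:R) -cmodJ rcV.
by move: (rc C)^-1 => x; ring.
Qed.

Let nrm_P a N : a 0%N = 0 -> nrm (P a N) ^+ 2 = \sum_(i < N) i%:R * cmod (a i) ^+ 2 / C.
Proof.
move=> a0; apply: rc_inj; rewrite -(nrm2 K)// ip_sum_P//.
rewrite (big_morph _ (@rcD R) (@rc0 R)); apply: eq_bigr => i _.
by rewrite -ip_E// ip_PE// ltn_ord coef_sqr.
Qed.

(** Bessel's inequality: <f, P> = |P|^2, hence 0 <= |f - P|^2 = |f|^2 - |P|^2. *)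
Lemma H_l2 f : H f -> l2 (tcoef f).
Proof.
move=> Hf; exists (C * nrm f ^+ 2) => N; set a := tcoef f.
have a0 : a 0%N = 0 by exact: tcoef0.
have Hd : H (fun z => f z - P a N z) by exact: (rkhs_sub K).
have h : ip f (P a N) = rc (nrm (P a N) ^+ 2).
  rewrite ip_sum_P// nrm_P// (big_morph _ (@rcD R) (@rc0 R)).
  by apply: eq_bigr => i _; rewrite coef_sqr.
have := rkhs_ip_ge0 K Hd; rewrite (rkhs_ip_sub K)// !(rkhs_ip_subr K)//.
rewrite (rkhs_ip_conj K Hf (H_P a N)) h conj_rc !(nrm2 K)// subrr subr0 -rcN -rcD.
rewrite -rc0 le_rc subr_ge0 nrm_P// -mulr_suml ler_pdivrMr//.
by rewrite mulrC.
Qed.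

(** Riesz-Fischer: |P_m - P_N|^2 is the weighted sum from N to m divided by C, so the truncations
    are Cauchy. The limit has the right coefficients since <P_N, E_n> = a_n as soon as N > n. *)
Lemma l2_H a : a 0%N = 0 -> l2 a -> exists2 F, H F &
  tcoef F = a /\ (fun N => nrm (fun z => P a N z - F z)) @ \oo --> (0 : R).
Proof.
move=> a0 [B hB].
pose S N := \sum_(i < N) i%:R * cmod (a i) ^+ 2.
have nd := sum_ord_mono (fun i => l2_term_ge0 a i).
have dist m N : (N <= m)%N -> nrm (fun z => P a m z - P a N z) ^+ 2 = (S m - S N) / C.
  move=> Nm; pose b i := if (i < N)%N then 0 else a i.
  have -> : (fun z => P a m z - P a N z) = P b m.
    apply/funext => z; rewrite /P (sum_ord_sub (fun i => i%:R * a i / rc C * E i z) Nm).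
    rewrite big_mkcond; apply: eq_bigr => i _; rewrite /b ltnNge.
    by case: (N <= i)%N; rewrite //= mulr0 !mul0r.
  rewrite nrm_P; last by rewrite /b a0 if_same.
  rewrite -mulr_suml; congr (_ / _).
  rewrite /S (sum_ord_sub (fun i => i%:R * cmod (a i) ^+ 2) Nm) [RHS]big_mkcond.
  apply: eq_bigr => i _; rewrite /b ltnNge.
  by case: (N <= i)%N; rewrite //= cmod0 expr0n mulr0.
have [|F HF PF] := rkhs_complete K (H_P a).
  move=> e e0; have e20 : 0 < (e / 2) ^+ 2 * C by rewrite mulr_gt0// exprn_gt0// divr_gt0.
  have [N hN] := monotone_tail nd hB e20.
  have half m : (N <= m)%N -> nrm (fun z => P a m z - P a N z) < e / 2.
    move=> Nm; rewrite -(@ltr_pXn2r _ 2)// ?nnegrE ?nrm_ge0 ?divr_ge0 ?(ltW e0)//.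
    by rewrite dist// ltr_pdivrMr// ltrBlDl; exact: hN.
  exists N => m n Nm Nn; apply: le_lt_trans (nrm_triangle K (H_P a m) (H_P a n) (H_P a N)) _.
  rewrite (nrm_subC K (H_P a N)) ?H_P//; have := half m Nm; have := half n Nn; lra.
exists F => //; split=> //; apply/funext => n; rewrite -ip_E//.
have := cvgC_conj (rkhs_ip_cvg K (H_P a) HF (H_E n) PF).
rewrite -(rkhs_ip_conj K (H_E n) HF) => h; apply: (cvgC_unique h).
apply/cvgC => e e0; exists n.+1 => N nN.
by rewrite -(rkhs_ip_conj K (H_E n) (H_P a N)) ip_PE// nN subrr cmod0.
Qed.

Lemma H_dirichlet : H = @dirichlet_space R.
Proof.
apply/seteqP; split => f.
  move=> Hf; apply/dirichlet_spaceP; split; first exact: rkhs_off K f Hf.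
  exists (tcoef f); split; [exact: tcoefP | exact: tcoef0 | exact: H_l2].
move=> /dirichlet_spaceP[foff [a [fa a0 la]]]; have [F HF [Fa _]] := l2_H a0 la.
suff -> : f = F by [].
apply/funext => z; have [z1|z1] := ltP (cmod z) 1.
  by rewrite fa.2// (tcoefP HF).2// Fa.
have zD : ~ unit_disk z by move/unit_diskE; rewrite ltNge z1.
by rewrite foff// (rkhs_off K HF).
Qed.

(** [f] is the norm limit of its truncations, being determined by its coefficients; the products
    <P_N, g> are partial sums of [l2ip] divided by C. *)
Lemma ip_dirichlet f g : H f -> H g -> ip f g = rc C^-1 * dirichlet_ip f g.
Proof.
move=> Hf Hg; have lf := H_l2 Hf; have lg := H_l2 Hg.
rewrite (dirichlet_ipE (tcoefP Hf) (tcoefP Hg) lf lg).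
have a0 := tcoef0 Hf.
have [F HF [Fa PF]] := l2_H a0 lf.
have Ff : F = f.
  apply/funext => z; have [z1|z1] := ltP (cmod z) 1.
    by rewrite (tcoefP Hf).2// (tcoefP HF).2// Fa.
  have zD : ~ unit_disk z by move/unit_diskE; rewrite ltNge z1.
  by rewrite (rkhs_off K Hf)// (rkhs_off K HF).
have := cvgC_conj (rkhs_ip_cvg K (H_P (tcoef f)) HF Hg PF).
rewrite Ff -(rkhs_ip_conj K Hg Hf) => h; apply: (cvgC_unique h).
rewrite /l2ip -csumZ; last exact: l2ip_summ.
apply: cvgC_ext (csumP (summZ (rc C^-1) (l2ip_summ lf lg))) => N; apply/esym.
rewrite ip_sum_P// rmorph_sum; apply: eq_bigr => i _.
by rewrite rmorphM /= conjCK rcV; ring.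
Qed.

End analytic_rkhs.

Definition disk_fun (R : realType) (a : nat -> Cplx R) (z : Cplx R) : Cplx R :=
  if cmod z < 1 then psum a z else 0.

(** * The Dirichlet kernel *)

Section dirichlet_rkhs.
Variable R : realType.
Implicit Types (a b : nat -> Cplx R) (f g : Cplx R -> Cplx R) (w z : Cplx R).
Local Notation D := (@dirichlet_space R).

Lemma disk_fun_repr a : pconv a 1 -> disk_repr (disk_fun a) a.
Proof. by move=> a1; split=> // z z1; rewrite /disk_fun z1. Qed.

Lemma disk_fun_off a z : ~ unit_disk z -> disk_fun a z = 0.
Proof. by move=> zD; rewrite /disk_fun; case: ifP => // /unit_diskE. Qed.

Lemma disk_fun_dirichlet a : a 0%N = 0 -> l2 a -> D (disk_fun a).
Proof.
move=> a0 la; apply/dirichlet_spaceP; split; first by move=> z; exact: disk_fun_off.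
by exists a; split=> //; apply: disk_fun_repr; exact: l2_pconv.
Qed.

Lemma dirichlet_disk_fun f : D f -> exists a, [/\ a 0%N = 0, l2 a & f = disk_fun a].
Proof.
move=> /dirichlet_spaceP[foff [a [fa a0 la]]]; exists a; split=> //.
apply/funext => z; rewrite /disk_fun; case: ltP => [z1|z1]; first exact: fa.2.
by apply: foff => /unit_diskE; rewrite ltNge z1.
Qed.

Lemma disk_fun_lin x a b : l2 a -> l2 b ->
  (fun z => x * disk_fun a z + disk_fun b z) = disk_fun (fun n => x * a n + b n).
Proof.
move=> /l2_pconv/disk_fun_repr ra /l2_pconv/disk_fun_repr rb; apply/funext => z.
rewrite [RHS]/disk_fun; case: ifP => z1; first exact: (disk_reprD x ra rb).2.
by rewrite /disk_fun z1 mulr0 addr0.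
Qed.

Lemma disk_fun_sub a b : l2 a -> l2 b ->
  (fun z => disk_fun a z - disk_fun b z) = disk_fun (fun n => a n - b n).
Proof.
move=> la lb.
have -> : (fun n => a n - b n) = fun n => - 1 * b n + a n by apply/funext => n; ring.
by rewrite -disk_fun_lin//; apply/funext => z; ring.
Qed.

Lemma l2B a b : l2 a -> l2 b -> l2 (fun n => a n - b n).
Proof.
move=> la lb; have := l2D (l2Z (- 1) lb) la; congr l2; apply/funext => n; ring.
Qed.

Lemma cvg_cmod2_dist (u : nat -> Cplx R) l x : u @ \oo --> l ->
  (fun n => cmod (x - u n) ^+ 2) @ \oo --> cmod (x - l) ^+ 2.
Proof.
move=> /cvgC_ReIm[ure uim]; rewrite cmodK !(ReD, ImD, ReN, ImN).
under eq_fun do rewrite cmodK !(ReD, ImD, ReN, ImN).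
by apply: cvgD; apply: cvgM; apply: cvgB => //; exact: cvg_cst.
Qed.

Lemma csum_eq0 a : (forall n, a n = 0) -> csum a = 0.
Proof. by move=> a0; rewrite (@csum_fin _ 0) ?big_ord0. Qed.

Lemma l2_0 : l2 (fun=> 0 : Cplx R).
Proof. by exists 0 => n; rewrite big1// => i _; rewrite cmod0 expr0n mulr0. Qed.

(** The limit is taken coordinatewise, and a bound on a_m - a_n passes to n at infinity in each
    finite partial sum. Coordinate 0 has weight 0 and converges because it is 0 throughout. *)
Lemma l2_complete (a : nat -> nat -> Cplx R) :
  (forall m, a m 0%N = 0) -> (forall m, l2 (a m)) ->
  (forall e : R, 0 < e -> exists N, forall m n, (N <= m)%N -> (N <= n)%N ->
    complex.Re (l2ip (fun i => a m i - a n i) (fun i => a m i - a n i)) <= e) ->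
  exists b, [/\ b 0%N = 0, l2 b & forall e : R, 0 < e -> exists N, forall m, (N <= m)%N ->
    complex.Re (l2ip (fun i => a m i - b i) (fun i => a m i - b i)) <= e].
Proof.
move=> a0 la cau.
have coord i : exists l : Cplx R, (fun m => a m i) @ \oo --> l.
  apply: cauchyC => e e0; case: i => [|i].
    by exists 0%N => n _; rewrite !a0 subrr cmod0.
  have e20 : 0 < (e / 2) ^+ 2 by rewrite exprn_gt0// divr_gt0.
  have [N hN] := cau _ e20; exists N => n Nn.
  have e2 : 0 <= e / 2 by lra.
  apply: (@le_lt_trans _ _ (e / 2)); last by lra.
  rewrite -(@ler_pXn2r _ 2)// ?nnegrE//.
  apply: le_trans (hN n N Nn (leqnn _)).
  apply: le_trans (l2ip_diag_ub i.+2 (l2B (la n) (la N))).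
  rewrite big_ord_recr /= -[leLHS]add0r lerD//; last first.
    by rewrite ler_peMl ?sqr_ge0// ler1n.
  by apply: sumr_ge0 => j _; exact: (l2_term_ge0 (fun i => a n i - a N i)).
have [b hb] := choice coord.
have tail e m N : (forall n, (N <= n)%N ->
      complex.Re (l2ip (fun i => a m i - a n i) (fun i => a m i - a n i)) <= e) ->
    forall K, \sum_(i < K) i%:R * cmod (a m i - b i) ^+ 2 <= e.
  move=> h K.
  have cv : (fun n => \sum_(i < K) i%:R * cmod (a m i - a n i) ^+ 2) @ \oo -->
      \sum_(i < K) i%:R * cmod (a m i - b i) ^+ 2.
    apply: cvg_big => [|i _]; first exact: add_continuous.
    by apply: cvgM; [exact: cvg_cst | apply: cvg_cmod2_dist; exact: hb].
  rewrite -(cvg_lim (@Rhausdorff R) cv); apply: limr_le; first by apply/cvg_ex; eexists; exact: cv.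
  exists N => // n /= Nn; apply: le_trans (h n Nn).
  exact: (l2ip_diag_ub K (l2B (la m) (la n))).
exists b; split.
- by apply: (cvgC_unique (hb 0%N)); under eq_fun do rewrite a0; exact: cvg_cst.
- have [N hN] := cau 1 ltr01.
  have lN : l2 (fun i => a N i - b i).
    by exists 1; apply: (tail 1 N N) => n; exact: hN.
  by have := l2B (la N) lN; congr l2; apply/funext => i; ring.
- move=> e /cau[N hN]; exists N => m Nm; apply: l2ip_diag_le.
  by apply: (tail e m N) => n; exact: hN.
Qed.

(** * Reproducing kernel of the Dirichlet space with its form scaled by [c] *)

Variables (c : R) (ip : (Cplx R -> Cplx R) -> (Cplx R -> Cplx R) -> Cplx R).
Hypothesis c_gt0 : 0 < c.
Hypothesis ip_dirichletE : forall f g, D f -> D g -> ip f g = rc c * dirichlet_ip f g.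

Let c_neq0 : rc c != 0 :> Cplx R.
Proof. by rewrite -cmod_gt0 cmod_rc gtr0_norm. Qed.

Lemma ip_disk_fun a b : a 0%N = 0 -> l2 a -> b 0%N = 0 -> l2 b ->
  ip (disk_fun a) (disk_fun b) = rc c * l2ip a b.
Proof.
move=> a0 la b0 lb; rewrite ip_dirichletE; [|exact: disk_fun_dirichlet..].
by congr (_ * _); apply: dirichlet_ipE => //; apply: disk_fun_repr; exact: l2_pconv.
Qed.

Lemma hnorm_disk_fun a : a 0%N = 0 -> l2 a ->
  hnorm ip (disk_fun a) = Num.sqrt (c * complex.Re (l2ip a a)).
Proof. by move=> a0 la; rewrite /hnorm ip_disk_fun// ReM /= mul0r subr0. Qed.

(** Coefficients of -(1 / c) ln(1 - z conj(w)): scaling the form by c divides the kernel by c. At n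
    = 0 the value is 0, since 0^-1 = 0. *)
Definition dirichlet_kernel_coef w n : Cplx R := rc c^-1 * (n%:R^-1 * w^* ^+ n).
Local Notation A := dirichlet_kernel_coef.

Definition dirichlet_kernel z w : Cplx R := disk_fun (A w) z.
Local Notation k := dirichlet_kernel.

Lemma dirichlet_kernel_coef0 w : A w 0%N = 0.
Proof. by rewrite /A invr0 mul0r mulr0. Qed.

Lemma dirichlet_kernel_coef_l2 w : cmod w < 1 -> l2 (A w).
Proof.
move=> w1; apply: l2Z; exists (1 - cmod w)^-1 => n.
apply: le_trans (geom_sum_le n (cmod_ge0 w) w1); apply: ler_sum => -[[|i] _] _ /=.
  by rewrite mul0r expr0.
rewrite cmodM cmodV cmod_nat cmodX cmodC exprMn.
have p : 0 < i.+1%:R :> R by [].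
have -> : i.+1%:R * (i.+1%:R^-1 ^+ 2 * (cmod w ^+ i.+1) ^+ 2) =
    cmod w ^+ i.+1 * (cmod w ^+ i.+1 / i.+1%:R) :> R by field; rewrite gt_eqF.
rewrite ler_piMr ?exprn_ge0// ler_pdivrMr// mul1r; apply: (@le_trans _ _ 1).
  by rewrite exprn_ile1// ltW.
by rewrite ler1n.
Qed.

Lemma dirichlet_kernel_in w : cmod w < 1 -> D (fun z => k z w).
Proof. by move=> w1; apply: disk_fun_dirichlet; [exact: dirichlet_kernel_coef0 | exact: dirichlet_kernel_coef_l2]. Qed.

(** The weight n of [l2ip] cancels the 1 / n of the kernel and c cancels 1 / c, which leaves the sum
    of a_n w^n. *)
Lemma dirichlet_reproducing f w : D f -> cmod w < 1 -> ip f (fun z => k z w) = f w.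
Proof.
move=> /dirichlet_disk_fun[a [a0 la ->]] w1.
rewrite ip_disk_fun//; [|exact: dirichlet_kernel_coef0|exact: dirichlet_kernel_coef_l2].
rewrite [RHS]/disk_fun w1 /psum /l2ip -csumZ; last exact: l2ip_summ la (dirichlet_kernel_coef_l2 w1).
apply: eq_csum => -[|n]; first by rewrite a0 !mul0r !mulr0.
have n1 : n.+1%:R != 0 :> Cplx R by rewrite pnatr_eq0.
rewrite /A !rmorphM fmorphV rmorphXn /= conjCK conj_rc rcV -rc_nat conj_rc rc_nat.
by move: (n.+1%:R : Cplx R) n1 => x x0; field; rewrite c_neq0 x0.
Qed.

Lemma dirichlet_is_rkhs : is_rkhs (@unit_disk R) D ip k.
Proof.
split.
- by exists 0; apply/unit_diskE; rewrite cmod0.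
- by move=> f [].
- have := disk_fun_dirichlet erefl l2_0; congr dirichlet_space; apply/funext => z.
  by rewrite /disk_fun; case: ifP => // _; apply: csum_eq0 => n; rewrite mul0r.
- move=> x f g /dirichlet_disk_fun[a [a0 la ->]] /dirichlet_disk_fun[b [b0 lb ->]].
  rewrite disk_fun_lin//; apply: disk_fun_dirichlet; first by rewrite a0 b0 mulr0 addr0.
  by apply: l2D => //; exact: l2Z.
- move=> x f g h /dirichlet_disk_fun[a [a0 la ->]] /dirichlet_disk_fun[b [b0 lb ->]].
  move=> /dirichlet_disk_fun[d [d0 ld ->]]; rewrite disk_fun_lin// !ip_disk_fun//.
  + by rewrite l2ip_lin//; ring.
  + by rewrite a0 b0 mulr0 addr0.
  + by apply: l2D => //; exact: l2Z.
- move=> f g /dirichlet_disk_fun[a [a0 la ->]] /dirichlet_disk_fun[b [b0 lb ->]].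
  by rewrite !ip_disk_fun// rmorphM /= conj_rc l2ip_conj.
- move=> f /dirichlet_disk_fun[a [a0 la ->]]; rewrite ip_disk_fun//.
  have -> : l2ip a a = rc (complex.Re (l2ip a a)).
    by apply: Cplx_eq => //=; exact: l2ip_diag_Im.
  rewrite -rcM -rc0 le_rc; apply: mulr_ge0; first exact: ltW.
  by have := l2ip_diag_ub 0 la; rewrite big_ord0.
- move=> f /dirichlet_disk_fun[a [a0 la ->]]; rewrite ip_disk_fun// => /eqP.
  rewrite mulf_eq0 (negPf c_neq0) /= => /eqP aa.
  have an n : a n = 0.
    case: n => [//|n]; have := l2ip_diag_ub n.+2 la; rewrite aa big_ord_recr /= => h.
    have s0 : 0 <= \sum_(i < n.+1) i%:R * cmod (a i) ^+ 2.
      by apply: sumr_ge0 => i _; exact: l2_term_ge0.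
    have t0 : n.+1%:R * cmod (a n.+1) ^+ 2 = 0 :> R.
      by apply/eqP; rewrite eq_le l2_term_ge0 andbT; apply: le_trans h; rewrite lerDr.
    apply/eqP; rewrite -cmod_eq0 -sqrf_eq0; move/eqP: t0.
    by rewrite mulf_eq0 pnatr_eq0.
  apply/funext => z; rewrite /disk_fun; case: ifP => // _.
  by apply: csum_eq0 => n; rewrite an mul0r.
- move=> u Du cau; have [a ha] := choice (fun m => dirichlet_disk_fun (Du m)).
  have a0 m : a m 0%N = 0 by case: (ha m).
  have la m : l2 (a m) by case: (ha m).
  have dist m b : b 0%N = 0 -> l2 b -> hnorm ip (fun z => u m z - disk_fun b z) =
      Num.sqrt (c * complex.Re (l2ip (fun i => a m i - b i) (fun i => a m i - b i))).
    move=> b0 lb; have [_ _ ->] := ha m; rewrite disk_fun_sub// hnorm_disk_fun//.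
      by rewrite a0 b0 subrr.
    exact: l2B.
  have [|b [b0 lb hb]] := l2_complete a0 la.
    move=> e e0; have ce : 0 < Num.sqrt (c * e) by rewrite sqrtr_gt0 mulr_gt0.
    have [N hN] := cau _ ce; exists N => m n Nm Nn.
    have := hN m n Nm Nn; have [_ _ ->] := ha n; rewrite dist//.
    by rewrite ltr_sqrt ?mulr_gt0// ltr_pM2l// => /ltW.
  exists (disk_fun b); first exact: disk_fun_dirichlet.
  apply/cvgR => e e0; have e1 : 0 < (e / 2) ^+ 2 / c by rewrite divr_gt0// exprn_gt0// divr_gt0.
  have [N hN] := hb _ e1; exists N => m /hN h.
  rewrite subr0 ger0_norm ?sqrtr_ge0// dist//.
  apply: (@le_lt_trans _ _ (e / 2)); last by lra.
  have e2 : 0 <= e / 2 by lra.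
  rewrite -[leRHS]ger0_norm// -sqrtr_sqr ler_wsqrtr//.
  by rewrite mulrC -ler_pdivlMr.
- by move=> w /unit_diskE; exact: dirichlet_kernel_in.
- by move=> f w Df /unit_diskE; exact: dirichlet_reproducing.
Qed.

Lemma dirichlet_kernel_repr w : cmod w < 1 -> disk_repr (fun z => k z w) (A w).
Proof. by move=> w1; apply: disk_fun_repr; apply: l2_pconv; exact: dirichlet_kernel_coef_l2. Qed.

Lemma dirichlet_kernel_wbar_repr z : cmod z < 1 ->
  disk_repr (fun v => k z v^*) (A z^*).
Proof.
move=> z1; split; first by apply: l2_pconv; apply: dirichlet_kernel_coef_l2; rewrite cmodC.
move=> v v1; rewrite /k /disk_fun z1; apply: eq_csum => n.
by rewrite /A !conjCK; ring.
Qed.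

(** The derivative is (1 / c) z / (1 - z conj(w)). *)
Lemma dirichlet_kernel_wbar w : cmod w < 1 ->
  disk_repr (fun z => d_wbar k z w) (fun n => if n is n'.+1 then rc c^-1 * w^* ^+ n' else 0).
Proof.
move=> w1; have S1 : pconv (fun n => if n is n'.+1 then rc c^-1 * w^* ^+ n' else 0) 1.
  move=> s s0 s1; have p0 : 0 <= c^-1 by rewrite invr_ge0 ltW.
  exists c^-1 => -[|n]; first by rewrite cmod0 mul0r.
  rewrite cmodM cmodX cmodC cmod_rc ger0_norm// -mulrA ler_piMr//.
  by rewrite mulr_ile1 ?exprn_ge0// exprn_ile1// ltW.
split=> // z z1; have wc : cmod w^* < 1 by rewrite cmodC.
rewrite /d_wbar (derive1_repr (dirichlet_kernel_wbar_repr z1) wc).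
rewrite [RHS]/psum (@csum_shiftn _ _ 1).
- apply: eq_csum => n; rewrite dcoef1 /A addn1 conjCK exprS.
  have n1 : n.+1%:R != 0 :> Cplx R by rewrite pnatr_eq0.
  move: (n.+1%:R : Cplx R) n1 (rc c^-1) (w^* ^+ n) (z ^+ n) => x x0 p q r; field.
  by [].
- by case=> // _; rewrite mul0r.
- exact: pconv_summ S1 z1.
Qed.

(** Both sides are the series of (1 / c) conj(w)^2 / (1 - z conj(w))^2. *)
Lemma dirichlet_kernel_equation : kernel_equation k.
Proof.
move=> z w /unit_diskE z1 /unit_diskE w1.
have r := dirichlet_kernel_repr w1.
have r1 : disk_repr (fun z => d_z k z w) (dcoef 1 (A w)).
  by split; [exact: pconv_dcoef r.1 | move=> u u1; exact: derive1_repr r u1].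
have rw := dirichlet_kernel_wbar w1.
rewrite {1}/d_z (derive1_repr r1 z1) [X in _ = _ * X]/d_z (derive1_repr rw z1).
rewrite /psum -csumZ; last exact: pconv_summ (pconv_dcoef 1 rw.1) z1.
apply: eq_csum => n; rewrite !dcoef1 /A !exprS expr0.
have n1 : n.+2%:R != 0 :> Cplx R by rewrite pnatr_eq0.
move: (n.+2%:R : Cplx R) n1 (rc c^-1) (w^* ^+ n) (z ^+ n) => x x0 p q s; field.
by [].
Qed.

(** The kernel at w = 1/2 has first Taylor coefficient 1 / (2 c). *)
Lemma dirichlet_nonzero : exists2 f, D f & f <> fun=> 0.
Proof.
have w1 : cmod (rc (1 / 2) : Cplx R) < 1 by rewrite cmod_rc ger0_norm; lra.
exists (fun z => k z (rc (1 / 2))); first exact: dirichlet_kernel_in.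
move=> k0; have := dirichlet_kernel_repr w1; rewrite k0 => r.
have r0 : disk_repr (fun=> 0 : Cplx R) (fun=> 0).
  split=> [|z z1]; first exact: l2_pconv l2_0.
  by rewrite /psum csum_eq0// => i; rewrite mul0r.
have /eqP := congr1 (fun a => a 1%N) (disk_repr_inj r r0).
by rewrite /A invr1 mul1r expr1 conj_rc -rcM -cmod_eq0 cmod_rc normr_eq0 mulf_eq0 invr_eq0 !gt_eqF.
Qed.

End dirichlet_rkhs.

(* The kernel equation alone also has the solutions
   k = a + b z + conj (b w) - c ln (1 - z conj w), and k = 0. Vanishing at 0
   and H <> 0 exclude all of them but the positive multiples of the Dirichlet
   kernel. *)
Theorem theorem1p3 (R : realType) (H : set (Cplx R -> Cplx R))
    (ip : (Cplx R -> Cplx R) -> (Cplx R -> Cplx R) -> Cplx R) :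
  (exists k : Cplx R -> Cplx R -> Cplx R,
    [/\ is_rkhs (@unit_disk R) H ip k,
        forall f, H f -> analytic_on (@unit_disk R) f,
        forall f, H f -> f 0 = 0,
        exists2 f, H f & f <> (fun=> 0)
      & kernel_equation k])
  <->
  (exists c : R,
    [/\ 0 < c,
        H = @dirichlet_space R
      & forall f g, H f -> H g ->
          ip f g = (c%:C)%C * dirichlet_ip f g]).
Proof.
split=> [[k [K Han H0 nz keq]]|[c [c0 HD ipE]]].
  have C0 := gram_const_gt0 K Han keq H0 nz.
  (* On the disk E_1 is C z and |E_1|^2 = C, so the function z has squared norm 1 / C in [H],
     against 1 in the Dirichlet space. *)
  exists (gram_const K Han)^-1; split; first by rewrite invr_gt0.
    exact: H_dirichlet K Han keq H0 C0.
  exact: (ip_dirichlet keq H0 C0).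
rewrite HD in ipE *; exists (dirichlet_kernel c); split.
- exact: dirichlet_is_rkhs c0 ipE.
- by move=> f [].
- by move=> f [].
- exact: dirichlet_nonzero c0.
- exact: dirichlet_kernel_equation c0.
Qed.
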